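(* The value function $V_\infty$ is the unique solution $V$ of $$\nabla V(x)^\top J_nx-\frac{q-1}{q}\left|\frac{\partial V}{\partial x_n}(x)\right|^{\frac{q}{q-1}}+F(x)=0,\qquad\forall x\in\mathbb{R}^n,$$ among positive definite functions in $\mathcal{C}^1(\mathbb{R}^n,\mathbb{R})$. Conversely, assume that $W\in\mathcal{C}^1(\mathbb{R}^n,\mathbb{R})$ is a positive definite mapping such that the function $$F_W(x):=\frac{q-1}{q}\left|\frac{\partial W}{\partial x_n}(x)\right|^{\frac{q}{q-1}}-\nabla W(x)^\top J_nx$$ is continuously differentiable, convex and positive definite. Then $W$ is the value function associated with $(OCP)_\infty$ with $F=F_W$, and the corresponding optimal control $u_W$ is given in feedback form by $u_W(x)=-\left\lfloor\frac{\partial W}{\partial x_n}(x)\right\rceil^{\frac1{q-1}}$.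
   Context: Let $n\ge 1$ be an integer and $q\in(1,\infty)$. $J_n$ is the $n\times n$ Jordan block with eigenvalue $0$ (ones on the superdiagonal, zeros elsewhere) and $e_n$ is the last canonical basis vector of $\mathbb{R}^n$. The control system is $\dot x=J_nx+e_nu$. A function $f:\mathbb{R}^n\to\mathbb{R}$ is positive definite if $f(0)=0$ and $f(x)>0$ for $x\neq0$. The function $F:\mathbb{R}^n\to\mathbb{R}_{\ge 0}$ is assumed continuously differentiable, convex and positive definite. For $x_0\in\mathbb{R}^n$ and $u\in L^q(\mathbb{R}_{\ge0},\mathbb{R})$, $\mathcal{J}_\infty(x_0,u)=\int_0^\infty\left(\frac{|u(t)|^q}{q}+F(x(t))\right)dt$, where $x(\cdot)$ is the trajectory of the control system with $x(0)=x_0$ and control $u$. $(OCP)_\infty$ is the problem of minimizing $\mathcal{J}_\infty(x_0,\cdot)$ over $L^q(\mathbb{R}_{\ge0},\mathbb{R})$ (it has a unique minimizer, the optimal control, for every $x_0$) and $V_\infty(x_0)=\inf_{u}\mathcal{J}_\infty(x_0,u)$ is its value function. For $a\in\mathbb{R}$ and $r>0$, $\lfloor a\rceil^r=|a|^r\,\mathrm{sgn}(a)$. An optimal control is given in feedback form by $u_W(\cdot)$ if for every $x_0$ the optimal control $u$ and optimal trajectory $x$ from $x_0$ satisfy $u(t)=u_W(x(t))$ for almost every $t\ge0$. *)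

(* Defs.v *)
From HB Require Import structures.
From mathcomp Require Import all_boot all_order all_algebra.
From mathcomp Require Import all_classical all_reals all_analysis.

Set Implicit Arguments.
Unset Strict Implicit.
Unset Printing Implicit Defensive.

Import Order.TTheory GRing.Theory Num.Theory.
Import numFieldNormedType.Exports.

Local Open Scope classical_set_scope.
Local Open Scope ring_scope.

Definition jordan0 (R : realType) (n : nat) : 'M[R]_n :=
  \matrix_(i, j) (j == i.+1 :> nat)%:R.

(* For 0 < n, the last vector of the canonical basis. *)
Definition elast (R : realType) (n : nat) : 'cV[R]_n :=
  \col_i (i.+1 == n)%:R.

Definition gradient (R : realType) (n : nat) (f : 'cV[R]_n -> R)
    (x : 'cV[R]_n) : 'cV[R]_n :=
  \col_i 'D_(delta_mx i 0) f x.

Definition partial_last (R : realType) (n : nat) (f : 'cV[R]_n -> R)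
    (x : 'cV[R]_n) : R :=
  'D_(elast R n) f x.

Definition C1 (R : realType) (n : nat) (f : 'cV[R]_n -> R) : Prop :=
  (forall x, differentiable f x) /\ continuous (gradient f).

Definition positive_definite (R : realType) (n : nat) (f : 'cV[R]_n -> R)
    : Prop :=
  f 0 = 0 /\ forall x, x != 0 -> 0 < f x.

Definition convex_on_space (R : realType) (n : nat) (f : 'cV[R]_n -> R)
    : Prop :=
  convex_function [set: convex_lmodType 'cV[R]_n] f.

Definition signed_pow (R : realType) (a r : R) : R :=
  `|a| `^ r * Num.sg a.

(* Controls are functions on the whole line of which only the restriction to
   [0, +oo[ matters: L^q(R_{>=0}) is the set of those whose extension by zero
   from [0, +oo[ is in L^q(R). *)
Definition Lq_control (R : realType) (q : R) : set (R -> R) :=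
  [set u | (u \_ `[0, +oo[) \in
     Lfun (@lebesgue_measure R : {measure set measurableTypeR R -> \bar R})
          q%:E].

(* Caratheodory solutions on [0, +oo[ of the control system, i.e. continuous
   solutions of the integrated equation, coordinate by coordinate. *)
Definition is_trajectory (R : realType) (n : nat) (x0 : 'cV[R]_n) (u : R -> R)
    : set (R -> 'cV[R]_n) :=
  [set x : R -> 'cV[R]_n | {within `[0, +oo[, continuous x} /\
    forall t, 0 <= t -> forall i, x t i 0 = x0 i 0 +
      \int[@lebesgue_measure R]_(s in `[0, t])
        ((jordan0 R n *m x s + u s *: elast R n) i 0)].

(* For u locally integrable on [0, +oo[, there is a trajectory and its values
   at nonnegative times are unique; values at negative times, and the default
   value 0 of xget, are irrelevant. *)
Definition trajectory (R : realType) (n : nat) (x0 : 'cV[R]_n) (u : R -> R)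
    : R -> 'cV[R]_n :=
  xget (fun=> 0) (is_trajectory x0 u).

Definition cost (R : realType) (n : nat) (q : R) (F : 'cV[R]_n -> R)
    (x0 : 'cV[R]_n) (u : R -> R) : \bar R :=
  (\int[@lebesgue_measure R]_(t in `[0%R, +oo[)
    (`|u t| `^ q / q + F (trajectory x0 u t))%:E)%E.

Definition value_function (R : realType) (n : nat) (q : R)
    (F : 'cV[R]_n -> R) (x0 : 'cV[R]_n) : \bar R :=
  ereal_inf (cost q F x0 @` Lq_control q).

Definition minimizer (R : realType) (n : nat) (q : R) (F : 'cV[R]_n -> R)
    (x0 : 'cV[R]_n) (u : R -> R) : Prop :=
  Lq_control q u /\
  forall v, Lq_control q v -> (cost q F x0 u <= cost q F x0 v)%E.

Definition optimal_control (R : realType) (n : nat) (q : R)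
    (F : 'cV[R]_n -> R) (x0 : 'cV[R]_n) (u : R -> R) : Prop :=
  minimizer q F x0 u /\
  forall v, minimizer q F x0 v ->
    {ae @lebesgue_measure R, forall t, 0 <= t -> v t = u t}.

Definition optimal_feedback (R : realType) (n : nat) (q : R)
    (F : 'cV[R]_n -> R) (w : 'cV[R]_n -> R) : Prop :=
  forall x0, (exists u, optimal_control q F x0 u) /\
    forall u, optimal_control q F x0 u ->
      {ae @lebesgue_measure R,
        forall t, 0 <= t -> u t = w (trajectory x0 u t)}.

Definition HJB_solution (R : realType) (n : nat) (q : R)
    (F V : 'cV[R]_n -> R) : Prop :=
  forall x, ((gradient V x)^T *m jordan0 R n *m x) 0 0
    - (q - 1) / q * `|partial_last V x| `^ (q / (q - 1)) + F x = 0.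

Definition inverse_running_cost (R : realType) (n : nat) (q : R)
    (W : 'cV[R]_n -> R) (x : 'cV[R]_n) : R :=
  (q - 1) / q * `|partial_last W x| `^ (q / (q - 1))
    - ((gradient W x)^T *m jordan0 R n *m x) 0 0.

(* Main.v *)
(* Along a trajectory from x0, a C^1 solution W of the HJB equation satisfies
     int_0^T (|u|^q/q + F(x)) = W(x0) - W(x(T)) + int_0^T gap(u, dW/dx_n(x)),
   where gap >= 0 is the defect in Young's inequality and vanishes exactly when
   u = - |_dW/dx_n_]^(1/(q-1)).  Since a trajectory of finite cost comes close to
   the minimum 0 of F, and hence to the origin, W is at most the value.
   Conversely, sampling the feedback on a fine time grid gives controls of
   almost zero gap, so the value is at most W; existence of solutions of the
   closed-loop equation is not needed.  Thus a solution of the HJB equation is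
   the value function, and an optimal control has zero gap almost everywhere.

   It remains to see that the value V is C^1 and solves the equation.  The
   problem is convex, so V is convex.  Uniform convexity of |.|^q makes a
   minimizing sequence Cauchy in L^q, which gives the unique minimizer.
   Perturbing the optimal control at x0 by controls depending linearly on h and
   steering h to 0 in unit time bounds V(x0 + h) from above by a function
   differentiable at h = 0; a convex function with such upper bounds is C^1.
   The equation then follows from the dynamic programming principle at
   time 0, applied to constant controls and to the optimal control. *)

Require Import Defs.
From HB Require Import structures.
From mathcomp Require Import all_boot all_order all_algebra.
From mathcomp Require Import all_classical all_reals all_analysis.
From mathcomp Require Import measurable_realfun ring lra.
Set Implicit Arguments.
Unset Strict Implicit.
Unset Printing Implicit Defensive.
Import Order.TTheory GRing.Theory Num.Theory.
Import numFieldNormedType.Exports.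
Local Open Scope classical_set_scope.
Local Open Scope ring_scope.

(** * Power functions and the Legendre transform of the control cost *)

(** The feedback is only continuous: $\partial W/\partial x_n$ is no better than continuous, and the
    power $1/(q-1)$ is below $1$ when $q>2$. This is why the closed loop is sampled instead of
    solved.

    Controls are only in $L^q$, hence possibly unbounded and without meaningful values at single
    times, which shapes three steps. The chain rule along a trajectory sums first-order errors over
    fine partitions instead of differentiating almost everywhere. The first variation of
    $\int|u|^q/q$ needs a remainder dominated by $\varepsilon(1+|u|^q)$. The optimal control cannot
    be evaluated at time $0$, so Young's inequality first removes it from the integrand and leaves a
    continuous function of the state.

    Sampling stops at a finite time near the origin, and the value that remains there must be known
    to be small. For the comparison with a given solution this comes from the regularity of the
    value, proved beforehand.

    Perturbing by a control that cancels $h$ at time $1$ makes both trajectories meet, so the costs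
    after time $1$ cancel and only an integral over $[0,1]$ is expanded. *)

Section ScalarPowers.
Context {R : realType}.
Implicit Types a b p q r x : R.

(** With $x=e^t$, the inequality $e^s>1+s$ is used twice: $x^q=xe^{(q-1)t}>x+(q-1)xt$, and
    $1=xe^{-t}>x-xt$, that is, $xt>x-1$. *)
Lemma bernoulli_powR_lt q x : 1 < q -> 0 <= x -> x != 1 ->
  1 + q * (x - 1) < x `^ q.
Proof.
move=> q1 x0 x1.
have [->|xn0] := eqVneq x 0.
  by rewrite powR0 ?gt_eqF//; lra.
have {xn0}x0 : 0 < x by rewrite lt0r xn0.
pose t := ln x; have xE : x = expR t by rewrite /t lnK.
have t0 : t != 0 by rewrite /t ln_eq0.
have E1 : x `^ q = x * expR ((q - 1) * t).
  by rewrite /powR gt_eqF// xE -expRD -xE -/t; congr expR; ring.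
have H1 : 1 + (q - 1) * t < expR ((q - 1) * t).
  by apply: expR_gt1Dx; rewrite mulf_neq0// subr_eq0 gt_eqF.
have H2 : 1 - t < expR (- t) by apply: expR_gt1Dx; rewrite oppr_eq0.
have H3 : x * expR (- t) = 1 by rewrite xE expRxMexpNx_1.
have H4 : x * (1 - t) < 1 by rewrite -[ltRHS]H3 ltr_pM2l.
have H5 : x * (1 + (q - 1) * t) < x * expR ((q - 1) * t) by rewrite ltr_pM2l.
have H6 : (q - 1) * (x - 1) < (q - 1) * (x * t) by rewrite ltr_pM2l ?subr_gt0//; lra.
rewrite E1; lra.
Qed.

Lemma continuous_powR_norm r : 0 < r -> continuous (fun a => `|a| `^ r).
Proof.
move=> r0 a.
have [->|a0] := eqVneq a 0.
  apply/cvgrPdist_lt => e e0.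
  rewrite normr0 powR0 ?gt_eqF//.
  near=> x.
  rewrite sub0r normrN ger0_norm ?powR_ge0//.
  rewrite -[ltRHS](@powRr1 _ e) ?(ltW e0)// -[X in _ < _ `^ X](mulVf (lt0r_neq0 r0)).
  rewrite powRrM gt0_ltr_powR ?nnegrE ?powR_ge0 //.
  near: x; apply: cvgr0_norm_lt; first exact: cvg_id.
  by rewrite powR_gt0.
have na0 : 0 < `|a| by rewrite normr_gt0.
apply: (@continuous_comp _ _ _ (fun a : R => `|a|) (fun y : R => y `^ r)).
  exact: norm_continuous.
apply: differentiable_continuous; apply/derivable1_diffP; apply: derivable_powR.
by rewrite in_itv/= andbT.
Unshelve. all: by end_near. Qed.

Lemma continuous_signed_pow r : 0 < r -> continuous (fun a => signed_pow a r).
Proof.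
move=> r0 a; rewrite /signed_pow.
have [->|a0] := eqVneq a 0.
  rewrite /continuous_at sgr0 mulr0.
  have := @continuous_powR_norm r r0 0.
  rewrite /continuous_at normr0 powR0 ?gt_eqF// => /cvgr0_norm_lt H.
  apply/cvgrPdist_lt => e e0; rewrite /=.
  near=> x.
  rewrite sub0r normrN; apply: (@le_lt_trans _ _ (`| `|x| `^ r |)).
    rewrite normrM -[leRHS]mulr1 ler_wpM2l// normr_sg.
    by case: (x == 0); rewrite /= ?lexx ?ler01.
  by near: x; exact: H.
apply: cvgM; first exact: continuous_powR_norm.
have [lt0|gt0|/eqP] := ltgtP a 0; last by rewrite (negbTE a0).
  rewrite (ltr0_sg lt0).
  apply: (cvg_trans _ (@cvg_cst _ _ _ (nbhs a) _)).
  apply: near_eq_cvg; near=> x; rewrite ltr0_sg//.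
  by near: x; exact: lt_nbhsl.
rewrite (gtr0_sg gt0).
apply: (cvg_trans _ (@cvg_cst _ _ _ (nbhs a) _)).
apply: near_eq_cvg; near=> x; rewrite gtr0_sg//.
by near: x; exact: lt_nbhsr.
Unshelve. all: by end_near. Qed.

Lemma signed_powN a r : signed_pow (- a) r = - signed_pow a r.
Proof. by rewrite /signed_pow normrN sgrN mulrN. Qed.

Lemma norm_signed_pow a r : 0 < r -> `|signed_pow a r| = `|a| `^ r.
Proof.
move=> r0; rewrite /signed_pow normrM ger0_norm ?powR_ge0// normr_sg.
have [->|] := eqVneq a 0; last by rewrite mulr1.
by rewrite normr0 powR0 ?gt_eqF// mul0r.
Qed.

Lemma signed_powK a r : 0 < r -> signed_pow (signed_pow a r^-1) r = a.
Proof.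
move=> r0; have r'0 : 0 < r^-1 by rewrite invr_gt0.
rewrite {1}/signed_pow norm_signed_pow// -powRrM mulVf ?gt_eqF//.
rewrite powRr1// /signed_pow sgrM.
have [->|a0] := eqVneq a 0; first by rewrite normr0 mul0r.
rewrite (gtr0_sg (powR_gt0 _ _)) ?normr_gt0// mul1r.
by rewrite sgr_id mulrC -numEsg.
Qed.

(* [signed_pow a (q - 1)] is the derivative of [fun a => `|a| `^ q / q]. *)
Lemma powR_tangent_lt q a b : 1 < q -> b != a ->
  `|a| `^ q / q + signed_pow a (q - 1) * (b - a) < `|b| `^ q / q.
Proof.
move=> q1; wlog a0 : a b / 0 <= a.
  move=> H ba; have [a0|a0] := leP 0 a; first exact: H.
  have := H (- a) (- b); rewrite !normrN signed_powN eqr_opp oppr_ge0 (ltW a0).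
  by move=> /(_ isT ba); rewrite mulNr -mulrN opprB opprK [- a + b]addrC.
move=> ba; have q0 : 0 < q by lra.
rewrite ltr_pdivlMr// mulrDl divfK ?gt_eqF//.
have [aE|an0] := eqVneq a 0.
  rewrite aE /signed_pow sgr0 mulr0 !mul0r normr0 powR0 ?gt_eqF// addr0.
  by rewrite powR_gt0// normr_gt0 -aE.
have {an0}a0 : 0 < a by rewrite lt0r an0.
have -> : signed_pow a (q - 1) = a `^ (q - 1).
  by rewrite /signed_pow gtr0_sg// mulr1 gtr0_norm.
rewrite (gtr0_norm a0).
have aq : 0 < a `^ (q - 1) by rewrite powR_gt0.
have E : a `^ q = a * a `^ (q - 1) by rewrite mulr_powRB1// ltW.
(* Bernoulli's inequality at $c/a$, multiplied by $a^q$. *)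
have key c : 0 <= c -> c != a ->
    a `^ q + a `^ (q - 1) * (c - a) * q < c `^ q.
  move=> c0 ca; have := bernoulli_powR_lt (x := c / a) q1.
  rewrite divr_ge0 ?(ltW a0)// => /(_ isT).
  have -> : (c / a != 1) by apply: contra ca => /eqP E'; rewrite -[c](divfK (lt0r_neq0 a0)) E' mul1r.
  move=> /(_ isT) H.
  have := H; rewrite -(ltr_pM2l (powR_gt0 q a0)) -powRM ?divr_ge0 ?(ltW a0)//.
  rewrite mulrC [a * _]mulrC divfK ?gt_eqF//; apply: le_lt_trans.
  by rewrite E le_eqVlt; apply/orP; left; apply/eqP; field; rewrite gt_eqF.
have [b0|b0] := leP 0 b; first by rewrite ger0_norm//; exact: key.
have [ca|ca] := eqVneq (- b) a.
  rewrite ltr0_norm// ca -[ltRHS]addr0 ltrD2l pmulr_llt0// pmulr_rlt0//; lra.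
rewrite ltr0_norm//; apply: lt_trans (key (- b) _ ca); last lra.
rewrite ltrD2l ltr_pM2r// ltr_pM2l//; lra.
Qed.

Lemma powR_tangent_le q a b : 1 < q ->
  `|a| `^ q / q + signed_pow a (q - 1) * (b - a) <= `|b| `^ q / q.
Proof.
move=> q1; have [->|ba] := eqVneq b a; first by rewrite subrr mulr0 addr0.
exact/ltW/powR_tangent_lt.
Qed.

(** The zero of the derivative $\lfloor u\rceil^{q-1}+p$ of $u\mapsto|u|^q/q+pu$. The exponent is
    written [1 / (q - 1)] so that the feedback of the theorem is this term up to unfolding. *)
Definition hamilton_argmin q p := - signed_pow p (1 / (q - 1)).

Lemma hamilton_argmin_pow q p : 1 < q ->
  signed_pow (hamilton_argmin q p) (q - 1) = - p.
Proof.
move=> q1; rewrite /hamilton_argmin signed_powN mul1r signed_powK//; lra.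
Qed.

Lemma hamilton_min q p : 1 < q ->
  `|hamilton_argmin q p| `^ q / q + p * hamilton_argmin q p =
  - ((q - 1) / q * `|p| `^ (q / (q - 1))).
Proof.
move=> q1; have q10 : 0 < q - 1 by lra.
rewrite /hamilton_argmin normrN norm_signed_pow ?divr_gt0// -powRrM.
have -> : 1 / (q - 1) * q = q / (q - 1) by rewrite mul1r mulrC.
have -> : p * - signed_pow p (1 / (q - 1)) = - `|p| `^ (q / (q - 1)).
  rewrite mulrN /signed_pow [_ * Num.sg p]mulrC mulrA [p * _]mulrC -normrEsg mul1r; congr (- _).
  have q'0 : 0 < q / (q - 1) by rewrite divr_gt0//; lra.
  rewrite -[RHS]mulr_powRB1//; congr (_ * _ `^ _).
  by field; rewrite gt_eqF.
by field; rewrite gt_eqF//; lra.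
Qed.

Definition young_gap q u p :=
  `|u| `^ q / q + p * u + (q - 1) / q * `|p| `^ (q / (q - 1)).

(** The gap is the distance from [u] to the tangent of $|\cdot|^q/q$ at the minimizer, so its sign
    and its zero set both follow from strict convexity. *)
Lemma young_gapE q u p : 1 < q ->
  young_gap q u p = `|u| `^ q / q - (`|hamilton_argmin q p| `^ q / q +
   signed_pow (hamilton_argmin q p) (q - 1) * (u - hamilton_argmin q p)).
Proof.
move=> q1; rewrite /young_gap hamilton_argmin_pow//.
have := hamilton_min p q1 => H; rewrite -[(q-1)/q * _]opprK -H; ring.
Qed.

Lemma young_gap_ge0 q u p : 1 < q -> 0 <= young_gap q u p.
Proof. by move=> q1; rewrite young_gapE// subr_ge0 powR_tangent_le. Qed.

Lemma young_gap_argmin q p : 1 < q -> young_gap q (hamilton_argmin q p) p = 0.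
Proof. by move=> q1; rewrite young_gapE// subrr mulr0 addr0 subrr. Qed.

Lemma young_gap_eq0 q u p : 1 < q -> young_gap q u p = 0 ->
  u = hamilton_argmin q p.
Proof.
move=> q1; rewrite young_gapE// => H; apply: contra_eq (H) => /eqP up.
by rewrite gt_eqF// subr_gt0 powR_tangent_lt//; apply/eqP.
Qed.

End ScalarPowers.

(** * Uniform continuity around compact sets *)

Section CompactUniform.
Context {R : realType}.

(** Only [x] is confined to [K]; [y] may leave it. Later, points on a segment or on a trajectory
    issued from a ball can thus be compared with its origin without enlarging the ball. *)
Lemma compact_unif_continuous (V W : normedModType R) (K : set V) (f : V -> W)
    (e : R) : compact K -> continuous f -> 0 < e ->
  exists2 d, 0 < d & forall x y, K x -> `|x - y| <= d -> `|f x - f y| <= e.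
Proof.
move=> /compact_near_coveringP Kc fc e0.
have := Kc R (0^'+) (fun d x => forall y, `|x - y| <= d -> `|f x - f y| <= e) _.
case.
  move=> x Kx.
  have e20 : 0 < e / 2 by rewrite divr_gt0.
  have /cvgrPdist_lt /(_ _ e20) /nbhs_normP [d /= d0 xd] := fc x.
  have d20 : 0 < d / 2 by rewrite divr_gt0.
  exists (ball x (d / 2), [set t | 0 < t < d / 2]) => /=.
    split; first exact: nbhsx_ballx.
    by near=> t; apply/andP; split; near: t; [exact: nbhs_right_gt|exact: nbhs_right_lt].
  move=> [z t]/= [xz /andP[t0 td]] y zy.
  rewrite -ball_normE/= in xz.
  have fz : `|f x - f z| < e / 2 by apply: xd; rewrite /= (lt_trans xz)//; lra.
  have fy : `|f x - f y| < e / 2.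
    apply: xd => /=; rewrite -(subrKA z) (le_lt_trans (ler_normD _ _))//; lra.
  rewrite -(subrKA (f x)) (le_trans (ler_normD _ _))// distrC; lra.
move=> d /= d0 Kd.
exists (d / 2); first by rewrite divr_gt0.
move=> x y Kx xy; apply: (Kd (d / 2)) => //=; last by rewrite divr_gt0.
  rewrite sub0r normrN gtr0_norm ?divr_gt0//; lra.
Unshelve. all: by end_near. Qed.

End CompactUniform.

Section ColumnVectors.
Context {R : realType} {n : nat}.
Implicit Types x : 'cV[R]_n.

Lemma cV_coord_le x i : `|x i 0| <= `|x|.
Proof.
rewrite [leRHS]mx_normrE.
exact: (le_bigmax _ (fun ij : 'I_n * 'I_1 => `|x ij.1 ij.2|) (i, 0)).
Qed.

Lemma cV_norm_le x b : 0 <= b -> (forall i, `|x i 0| <= b) -> `|x| <= b.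
Proof.
move=> b0 xb; rewrite [leLHS]mx_normrE; apply: bigmax_le => // -[i j] _ /=.
by rewrite ord1.
Qed.

(** Transposition is an isometry from row vectors, where closed bounded sets are compact. *)
Lemma compact_cV_ball M : compact [set x : 'cV[R]_n | `|x| <= M].
Proof.
have -> : [set x : 'cV[R]_n | `|x| <= M] =
    (fun y : 'rV[R]_n => y^T) @` [set y : 'rV[R]_n | `|y^T| <= M].
  apply/seteqP; split => [x /= xM|_ [y /= yM <-]//].
  by exists x^T; rewrite /= trmxK.
have nT (y : 'rV[R]_n) : `|y^T| = `|y|.
  apply/eqP; rewrite eq_le; apply/andP; split.
    apply: cV_norm_le => // i; rewrite mxE [leRHS]mx_normrE.
    exact: (le_bigmax _ (fun ij : 'I_1 * 'I_n => `|y ij.1 ij.2|) (0, i)).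
  rewrite [leLHS]mx_normrE; apply: bigmax_le => // -[i j] _ /=.
  by rewrite ord1; have := cV_coord_le y^T j; rewrite mxE.
apply: continuous_compact.
  apply: continuous_subspaceT.
  have Tc : continuous (fun y : 'rV[R]_n => y^T : 'cV[R]_n).
    move=> y; apply/(@cvgrPdist_lt _ _ _ (nbhs y) (nbhs_filter y) trmx) => e e0.
    by apply/(@nbhs_normP R ('rV[R]_n : normedModType R) y); exists e => //= z; rewrite -linearB nT.
  exact: Tc.
apply: bounded_closed_compact.
  exists M; split; first exact: num_real.
  by move=> t Mt y /=; rewrite nT => /le_trans; apply; exact: ltW.
have -> : [set y : 'rV[R]_n | `|y^T| <= M] = (fun y => `|y|) @^-1` [set t | t <= M].
  by apply/seteqP; split => y /=; rewrite nT.
apply: closed_comp; last exact: closed_le.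
by move=> y _; exact: norm_continuous.
Qed.

End ColumnVectors.

(** * Uniform convexity of the control cost, weighted continuity of its derivative *)

Section UniformConvexity.
Context {R : realType}.
Variables (q : R) (q1 : 1 < q).
Implicit Types a b d e : R.

(** Adding the strict tangent inequalities from the midpoint towards [a] and towards [b] cancels the
    slopes. *)
Lemma powR_midpoint_lt a b : a != b ->
  `|(a + b) / 2| `^ q < (`|a| `^ q + `|b| `^ q) / 2.
Proof.
move=> ab; have q0 : 0 < q by rewrite (lt_trans ltr01).
pose c := (a + b) / 2; have cE : c = (a + b) / 2 by [].
rewrite -cE; clearbody c.
have ac : a != c by apply/eqP => E; move/eqP: ab; apply; lra.
have bc : b != c by apply/eqP => E; move/eqP: ab; apply; lra.
have := powR_tangent_lt q1 ac; have := powR_tangent_lt q1 bc.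
have -> : b - c = - (a - c) by rewrite cE; lra.
rewrite mulrN => H1 H2.
have : `|c| `^ q / q < (`|a| `^ q + `|b| `^ q) / 2 / q by lra.
by rewrite ltr_pM2r ?invr_gt0.
Qed.

Lemma powR_midpoint_le a b :
  `|(a + b) / 2| `^ q <= (`|a| `^ q + `|b| `^ q) / 2.
Proof.
have [->|ab] := eqVneq a b; last exact/ltW/powR_midpoint_lt.
have E (t : R) : (t + t) / 2 = t by lra.
by rewrite !E.
Qed.

(* By homogeneity it suffices to treat (1, s) with s in [-1, 1], where the
   midpoint gap is positive away from s = 1. *)
Lemma powR_unif_convex d : 0 < d -> exists2 C, 0 <= C & forall a b,
  `|a - b| `^ q <= d * (`|a| `^ q + `|b| `^ q) +
    C * ((`|a| `^ q + `|b| `^ q) / 2 - `|(a + b) / 2| `^ q).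
Proof.
move=> d0; have q0 : 0 < q by rewrite (lt_trans ltr01).
pose g s := (1 + `|s| `^ q) / 2 - `|(1 + s) / 2| `^ q.
have g0 s : s != 1 -> 0 < g s.
  move=> s1; have := @powR_midpoint_lt 1 s.
  by rewrite eq_sym s1 normr1 powR1 /= => /(_ isT) ?; rewrite /g subr_gt0.
have gc : continuous g.
  move=> s; have c1 := continuous_powR_norm q0.
  have c2 : continuous (fun s : R => (1 + s) / 2).
    by move=> t; apply: cvgM; [apply: cvgD; [exact: cvg_cst|exact: cvg_id]|exact: cvg_cst].
  have c3 := @continuous_comp _ _ _ _ _ s (c2 s) (c1 _).
  apply: cvgB; last exact: c3.
  apply: cvgM; last exact: cvg_cst.
  by apply: cvgD; [exact: cvg_cst|exact: c1].
(* For $s>1-\eta$ the term with $d$ alone dominates $|1-s|^q$. On $[-1,b_0]$ the gap $g$ has a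
   positive minimum $g(c)$, and $C=2^q/g(c)$ makes the other term at least $2^q$. The maximum with
   $-1$ keeps this interval nonempty. *)
pose eta := d `^ q^-1; have eta0 : 0 < eta by rewrite powR_gt0.
pose b0 := Num.max (-1) (1 - eta).
have b0_ge : -1 <= b0 by rewrite le_max lexx.
have b0_lt : b0 < 1 by rewrite gt_max; apply/andP; split; lra.
have [c cI cm] := EVT_min b0_ge (continuous_subspaceT gc).
have gc0 : 0 < g c.
  by apply: g0; rewrite lt_eqF//; move: cI; rewrite in_itv/= => /andP[_ /le_lt_trans]; apply.
pose C := 2 `^ q / g c.
have C0 : 0 <= C by rewrite divr_ge0 ?powR_ge0// ltW.
have key s : -1 <= s <= 1 -> `|1 - s| `^ q <= d * (1 + `|s| `^ q) + C * g s.
  move=> /andP[s1 s2]; have gs : 0 <= g s.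
    rewrite /g; have := powR_midpoint_le 1 s; rewrite normr1 powR1; lra.
  have dp : 0 <= d * `|s| `^ q by rewrite mulr_ge0 ?powR_ge0// ltW.
  have [sb|bs] := leP s b0.
    have H1 : g c <= g s by apply: cm; rewrite in_itv/= s1.
    have H2 : `|1 - s| `^ q <= 2 `^ q.
      by apply: ge0_ler_powR; rewrite ?nnegrE ?(ltW q0)// ger0_norm; lra.
    have H3 : 2 `^ q <= C * g s.
      rewrite -[leLHS](divfK (lt0r_neq0 gc0)) /C ler_wpM2l//.
    lra.
  have H2 : `|1 - s| `^ q <= d.
    rewrite -[leRHS]powRr1 ?(ltW d0)// -[X in _ <= _ `^ X](mulVf (lt0r_neq0 q0)) powRrM.
    apply: ge0_ler_powR; rewrite ?nnegrE ?powR_ge0 ?(ltW q0)//.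
    rewrite ger0_norm; last lra.
    by rewrite -/eta; move: bs; rewrite gt_max => /andP[_]; lra.
  have := mulr_ge0 C0 gs; lra.
exists C => //.
have main a b : `|b| <= `|a| -> `|a - b| `^ q <= d * (`|a| `^ q + `|b| `^ q) +
    C * ((`|a| `^ q + `|b| `^ q) / 2 - `|(a + b) / 2| `^ q).
  have [->|a0] := eqVneq a 0.
    rewrite normr0 normr_le0 => /eqP ->; rewrite subrr addr0 mul0r normr0.
    by rewrite powR0 ?gt_eqF//; lra.
  move=> ba; have na0 : 0 < `|a| by rewrite normr_gt0.
  have := key (b / a).
  have : `|b / a| <= 1 by rewrite normrM normfV ler_pdivrMr// mul1r.
  rewrite ler_norml => -> /(_ isT); rewrite -(ler_pM2l (powR_gt0 q na0)).
  have hom s : `|a| `^ q * `|s| `^ q = `|a * s| `^ q by rewrite -powRM// -normrM.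
  have -> : `|a - b| `^ q = `|a| `^ q * `|1 - b / a| `^ q.
    by rewrite hom; congr (`|_| `^ _); field.
  have -> : `|b| `^ q = `|a| `^ q * `|b / a| `^ q.
    by rewrite hom; congr (`|_| `^ _); field.
  have -> : `|(a + b) / 2| `^ q = `|a| `^ q * `|(1 + b / a) / 2| `^ q.
    by rewrite hom; congr (`|_| `^ _); field.
  move=> /le_trans; apply; rewrite /g le_eqVlt; apply/orP; left; apply/eqP; ring.
move=> a b; have [/ltW ba|ab] := ltP `|b| `|a|; first exact: main.
by have := main b a ab; rewrite distrC [b + a]addrC [`|b| `^ q + _]addrC.
Qed.

(** Uniform continuity fails on the line when $q>2$, but the weight $1+|a|^q$ restores it, and this
    weight is locally integrable along an $L^q$ control. For bounded [a] compactness suffices; for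
    large [a] both terms are of order $|a|^{q-1}$, negligible against $|a|^q$. *)
Lemma signed_pow_unif_continuous e : 0 < e -> exists2 d, 0 < d & forall a b,
  `|b| <= d -> `|signed_pow (a + b) (q - 1) - signed_pow a (q - 1)|
    <= e * (1 + `|a| `^ q).
Proof.
move=> e0; have q0 : 0 < q by rewrite (lt_trans ltr01).
have r0 : 0 < q - 1 by rewrite subr_gt0.
pose K := 2 `^ (q - 1).
have K0 : 0 < K by rewrite powR_gt0.
(* For $|a|>M$ and $|b|\le1$ one has $|a+b|\le2|a|$, so the difference is at most $(K+1)|a|^{q-1}\le
   Me|a|^{q-1}\le e|a|^q$. *)
pose M := Num.max 1 ((K + 1) / e).
have M1 : 1 <= M by rewrite le_max lexx.
have M2 : (K + 1) <= M * e by rewrite -ler_pdivrMr// le_max lexx orbT.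
have [d d0 Hd] := compact_unif_continuous (@segment_compact R (- M) M)
  (continuous_signed_pow r0) e0.
exists (Num.min d 1) => [|a b]; first by rewrite lt_min d0 ltr01.
rewrite le_min => /andP[bd b1].
have pa : 0 <= `|a| `^ q by rewrite powR_ge0.
have ea := mulr_ge0 (ltW e0) pa.
have [aM|Ma] := leP `|a| M.
  rewrite distrC; apply: le_trans (Hd a (a + b) _ _) _.
  - by rewrite /= in_itv/= -ler_norml.
  - by rewrite opprD addNKr normrN.
  - lra.
have na0 : 0 < `|a| by lra.
have E : `|a| * `|a| `^ (q - 1) = `|a| `^ q by rewrite mulr_powRB1.
rewrite (le_trans (ler_normB _ _))// !norm_signed_pow//.
have H1 : `|a + b| `^ (q - 1) <= K * `|a| `^ (q - 1).
  rewrite -powRM//; apply: ge0_ler_powR; rewrite ?nnegrE ?mulr_ge0 ?(ltW r0)//.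
  rewrite (le_trans (ler_normD _ _))//; lra.
have H2 : (K + 1) * `|a| `^ (q - 1) <= `|a| * e * `|a| `^ (q - 1).
  rewrite ler_wpM2r ?powR_ge0// (le_trans M2)// ler_wpM2r ?(ltW e0)// ltW//.
have : `|a| * e * `|a| `^ (q - 1) = e * `|a| `^ q by rewrite -E; ring.
lra.
Qed.

(** Gives local integrability of a locally $L^q$ control without Hölder's inequality. *)
Lemma ler_norm_powR a : `|a| <= 1 + `|a| `^ q.
Proof.
have [a1|a1] := leP `|a| 1; first by have := powR_ge0 `|a| q; lra.
have := @le1r_powR _ `|a| q (ltW a1) (ltW q1); lra.
Qed.

End UniformConvexity.

(** * Translation invariance of Lebesgue integrals *)

Section Translation.
Context {R : realType}.
Notation mu := (@lebesgue_measure R).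

Let shift_fun (T : R) : measurableTypeR R -> measurableTypeR R := fun x => x + T.

Let measurable_shift_fun T : measurable_fun setT (shift_fun T).
Proof. exact: measurable_funD. Qed.

HB.instance Definition _ T :=
  isMeasurableFun.Build _ _ _ _ _ (measurable_shift_fun T).

(** The translated measure gives half-open intervals their length, which characterizes Lebesgue
    measure. *)
Lemma lebesgue_measure_shift (T : R) (A : set (measurableTypeR R)) :
  measurable A -> mu A = pushforward mu (shift_fun T) A.
Proof.
apply: lebesgue_measure_unique => X [[a b] /= ab <-].
rewrite /pushforward.
have -> : shift_fun T @^-1` `]a, b] = `]a - T, b - T]%classic.
  by apply/seteqP; split => x /=; rewrite /shift_fun !in_itv/= ltrBlDr lerBrDr.
by rewrite !lebesgue_measure_itv/= !lte_fin ltrD2r; case: ifP => // _; rewrite -!EFinB; congr EFin; ring.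
Qed.

Lemma measurable_shift_preimage (T : R) (D : set (measurableTypeR R)) :
  measurable D -> measurable (shift_fun T @^-1` D).
Proof. by move=> mD; rewrite -[X in measurable X]setTI; exact: measurable_shift_fun. Qed.

Lemma measurable_fun_shift (T : R) (D : set (measurableTypeR R)) (d : measure_display)
    (Y : measurableType d) (f : measurableTypeR R -> Y) : measurable D ->
  measurable_fun D f ->
  measurable_fun ((fun x => x + T) @^-1` D) (fun x => f (x + T)).
Proof.
move=> mD mf.
apply: (@measurable_comp _ _ _ _ _ _ D) => //; first by move=> _ [x /= Dx <-].
apply: measurable_funS (measurable_shift_fun T) => //.
Qed.

Lemma ge0_integral_shift (T : R) (D : set (measurableTypeR R)) (f : R -> \bar R) :
  measurable D -> measurable_fun D f -> (forall x, D x -> 0 <= f x)%E ->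
  (\int[mu]_(x in D) f x = \int[mu]_(x in (fun x => x + T)%R @^-1` D) f (x + T)%R)%E.
Proof.
move=> mD mf f0.
rewrite (eq_measure_integral (pushforward mu (shift_fun T))); last first.
  by move=> A mA _; exact: lebesgue_measure_shift.
rewrite ge0_integral_pushforward//.
by move=> y /set_mem; exact: f0.
Qed.

Lemma integral_shift (T : R) (D : set (measurableTypeR R)) (f : R -> \bar R) :
  measurable D -> measurable_fun D f ->
  (\int[mu]_(x in D) f x = \int[mu]_(x in (fun x => x + T)%R @^-1` D) f (x + T)%R)%E.
Proof.
move=> mD mf; rewrite integralE [RHS]integralE; congr (_ - _)%E.
  rewrite (ge0_integral_shift T mD (measurable_funepos mf))//.
  by apply: eq_integral => x _; rewrite !funeposE.

rewrite (ge0_integral_shift T mD (measurable_funeneg mf))//.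
  by apply: eq_integral => x _; rewrite !funenegE.

Qed.

Lemma integrable_shift (T : R) (D : set (measurableTypeR R)) (f : R -> R) : measurable D ->
  mu.-integrable D (EFin \o f) ->
  mu.-integrable ((fun x => x + T) @^-1` D) (EFin \o (fun x => f (x + T))).
Proof.
move=> mD /integrableP[mf foo]; apply/integrableP; split.
  move/measurable_EFinP : mf => mf; apply/measurable_EFinP.
  exact: (@measurable_fun_shift T D _ _ f mD mf).
rewrite (_ : (\int[mu]_(x in _) _)%E = (\int[mu]_(x in D) `|(f x)%:E|)%E)//.
rewrite [RHS](@ge0_integral_shift T)//.
exact: measurableT_comp.
Qed.

Lemma Rintegral_shift (T : R) (D : set (measurableTypeR R)) (f : R -> R) : measurable D ->
  measurable_fun D f ->
  \int[mu]_(x in D) f x = \int[mu]_(x in (fun x => x + T) @^-1` D) f (x + T).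
Proof.
move=> mD mf; rewrite /Rintegral (@integral_shift T)//.
exact/measurable_EFinP.
Qed.

End Translation.

Section LqControls.
Context {R : realType}.
Variables (q : R) (q1 : 1 < q).
Notation mu := (@lebesgue_measure R).
Implicit Types u v : R -> R.

(** Outside the half-line the extension by zero contributes $|0|^q=0$, so the $q$-th power of the
    $L^q$ norm is the integral over the half-line. *)
Lemma Lq_controlP u : Lq_control q u <->
  mu.-integrable `[0, +oo[ (EFin \o (fun t => `|u t| `^ q)) /\
  measurable_fun (`[0, +oo[ : set (measurableTypeR R)) u.
Proof.
have q0 : 0 < q by rewrite (lt_trans ltr01).
have E : ('N[mu]_q%:E[EFin \o (u \_ `[0%R, +oo[)] `^ q =
    \int[mu]_(t in `[0%R, +oo[) `|(`|u t| `^ q)%:E|)%E.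
  rewrite poweR_Lnorm ?gt_eqF// [RHS]integral_mkcond; apply: eq_integral => t _ /=.
  rewrite /patch; case: ifPn => _ /=; first by rewrite (ger0_norm (powR_ge0 _ _)).
  by rewrite normr0 powR0// gt_eqF.
have mE : measurable_fun (`[0, +oo[ : set (measurableTypeR R)) u -> measurable_fun (`[0, +oo[ : set (measurableTypeR R)) (fun t => `|u t| `^ q).
  move=> mu'; apply: (measurableT_comp (measurable_powR q)).
  exact: measurableT_comp.
have mI : measurable (`[0, +oo[ : set (measurableTypeR R)) by exact: measurable_itv.
split.
  rewrite /Lq_control /= /Lfun inE /= => /andP[].
  rewrite !inE /= => mu' foo.
  have mu'' : measurable_fun (`[0, +oo[ : set (measurableTypeR R)) u.
    exact/(measurable_restrictT u mI).
  split => //; apply/integrableP; split; first by apply/measurable_EFinP; exact: mE.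
  rewrite -E; exact: poweR_lty.
move=> [/integrableP[mf foo] mu'].
rewrite /Lq_control /= /Lfun inE/=; apply/andP; rewrite !inE/=; split.
  exact/(measurable_restrictT u mI).
rewrite /finite_norm; apply: (@lty_poweRy _ _ q); rewrite ?gt_eqF// E; exact: foo.
Qed.

End LqControls.

(* Continuity on [0, +oo[, stated as continuity of the extension of [f] by
   [f 0] to the whole line. *)
Definition cont0 {R : realType} {V : topologicalType} (f : R -> V) :=
  continuous (fun t : R => f (Num.max t 0)).

Section Cont0.
Context {R : realType}.

Lemma cont0_continuous (V : topologicalType) (f : R -> V) :
  continuous f -> cont0 f.
Proof.
move=> fc t.
apply: (@continuous_comp _ _ _ (fun s : R => Num.max s 0) f); last exact: fc.
by apply: (@continuous_max R R (fun s => s) (fun=> 0)); [exact: cvg_id|exact: cvg_cst].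
Qed.

Lemma cont0_comp (V W : topologicalType) (f : R -> V) (g : V -> W) :
  cont0 f -> continuous g -> cont0 (g \o f).
Proof.
by move=> fc gc t; apply: (@continuous_comp _ _ _ (fun s : R => f (Num.max s 0)) g); [exact: fc|exact: gc].
Qed.

Lemma cont0P (V : topologicalType) (f : R -> V) :
  cont0 f <-> {within `[0, +oo[, continuous f}.
Proof.
split=> fc.
  have : {within `[0, +oo[, continuous (fun t : R => f (Num.max t 0))}.
    exact: continuous_subspaceT.
  apply: subspace_eq_continuous => t; rewrite /from_subspace/= inE/= in_itv/= andbT => t0.
  by rewrite max_l.
move/subspace_continuousP : fc => fc t.
have := fc (Num.max t 0); rewrite /= in_itv/= le_max lexx orbT => /(_ isT) H.
have c : (fun s : R => Num.max s 0) @ t --> (Num.max t 0 : R).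
  by apply: (@continuous_max R R (fun s => s) (fun=> 0)); [exact: cvg_id|exact: cvg_cst].
move=> A /H HA; have := c _ HA; apply: (@filterS _ (nbhs t)) => s /=; apply.
by rewrite in_itv/= le_max lexx orbT.
Qed.

End Cont0.

(** * Locally integrable functions on the half-line and their primitives *)

Definition locint {R : realType} (f : R -> R) :=
  forall t, (@lebesgue_measure R).-integrable `[0, t] (EFin \o f).

Notation "'IR' f t" := (\int[@lebesgue_measure _]_(s in `[0, t]) f s)
  (at level 10, f at level 8, t at level 8).

Section LocalIntegrability.
Context {R : realType}.
Notation mu := (@lebesgue_measure R).
Implicit Types (f g : R -> R) (s t T : R).

Lemma locint_cont0 f : cont0 f -> locint f.
Proof.
move=> fc t.
have H : mu.-integrable `[0, t] (EFin \o (fun t : R => f (Num.max t 0))).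
  apply: continuous_compact_integrable; first exact: segment_compact.
  exact: continuous_subspaceT.
apply: eq_integrable H => // s.
by rewrite inE/= in_itv/= => /andP[s0 _]; rewrite max_l.
Qed.

Lemma eq_locint f g : (forall t, 0 <= t -> f t = g t) -> locint f -> locint g.
Proof.
move=> fg fi t; apply: eq_integrable (fi t) => // s.
by rewrite inE/= in_itv/= => /andP[s0 _]; rewrite /= fg.
Qed.

Lemma locintD f g : locint f -> locint g -> locint (fun t => f t + g t).
Proof. by move=> fi gi t; exact: (integrableD _ (fi t) (gi t)). Qed.

Lemma locintB f g : locint f -> locint g -> locint (fun t => f t - g t).
Proof. by move=> fi gi t; exact: (integrableB _ (fi t) (gi t)). Qed.

Lemma locintZ f k : locint f -> locint (fun t => k * f t).
Proof. by move=> fi t; exact: (integrableZl _ k (fi t)). Qed.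

Lemma locint_cst (k : R) : locint (fun _ : R => k).
Proof. by apply: locint_cont0 => t; exact: cvg_cst. Qed.

Lemma locint_norm f : locint f -> locint (fun t => `|f t|).
Proof. by move=> fi t; exact: integrable_norm (fi t). Qed.

Lemma locint_sum n (f : 'I_n -> R -> R) : (forall i, locint (f i)) ->
  locint (fun t => \sum_i f i t).
Proof.
move=> fi; rewrite (_ : (fun t => _) = \sum_i f i); last first.
  by apply/funext => t; rewrite fct_sumE.
elim/big_ind: _ => [|g h gi hi|i _]; [exact: locint_cst|exact: locintD|exact: fi].
Qed.

Lemma locint_le f g : measurable_fun (`[0, +oo[ : set (measurableTypeR R)) f ->
  (forall t, 0 <= t -> `|f t| <= g t) -> locint g -> locint f.
Proof.
move=> mf fg gi t; apply: le_integrable (gi t) => //.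
  apply/measurable_EFinP; apply: measurable_funS mf => //.
  by move=> s /=; rewrite !in_itv/= => /andP[->].
move=> s /=; rewrite in_itv/= => /andP[s0 _]; rewrite lee_fin.
by rewrite (le_trans (fg s s0))// ler_norm.
Qed.

Lemma cont0_measurable f : cont0 f ->
  measurable_fun (`[0, +oo[ : set (measurableTypeR R)) f.
Proof.
move=> fc; apply: (eq_measurable_fun (fun t : R => f (Num.max t 0))).
  by move=> t; rewrite inE/= in_itv/= andbT => t0; rewrite max_l.
apply: (@measurable_funS _ _ _ _ setT) => //.
exact: continuous_measurable_fun.
Qed.

Lemma locint_measurable f : locint f ->
  measurable_fun (`[0, +oo[ : set (measurableTypeR R)) f.
Proof.
move=> fi; have -> : (`[0, +oo[ : set R)%classic = \bigcup_k `[0, k%:R]%classic.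
  by rewrite itv_bndy_bigcup_BRight; apply: eq_bigcupr => k _; rewrite add0r.
apply/measurable_fun_bigcup => k; first exact: measurable_itv.
by have /measurable_int/measurable_EFinP := fi k%:R.
Qed.

Lemma locintM g f : cont0 g -> locint f -> locint (fun t => g t * f t).
Proof.
move=> gc fi t; apply: (@integrableMr _ _ _ mu _ _ g (EFin \o f)) => //.
  apply: measurable_funS (cont0_measurable gc) => //.
  by move=> s /=; rewrite !in_itv/= => /andP[->].
have cK : compact ((fun s : R => g (Num.max s 0)) @` `[0, t]).
  by apply: continuous_compact; [exact: continuous_subspaceT|exact: segment_compact].
have [M [Mr MP]] := compact_bounded cK; exists M; split => // x /MP H s /= sI.
apply: H; exists s => //; move: sI; rewrite in_itv/= => /andP[s0 _].
by rewrite max_l.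
Qed.

Lemma IRD f g t : locint f -> locint g ->
  IR (fun s => f s + g s) t = IR f t + IR g t.
Proof. by move=> fi gi; rewrite RintegralD. Qed.

Lemma IRB f g t : locint f -> locint g ->
  IR (fun s => f s - g s) t = IR f t - IR g t.
Proof. by move=> fi gi; rewrite RintegralB. Qed.

Lemma IRZ f k t : locint f -> IR (fun s => k * f s) t = k * IR f t.
Proof. by move=> fi; rewrite RintegralZl. Qed.

Lemma eq_IR f g t : (forall s, 0 <= s -> s <= t -> f s = g s) -> IR f t = IR g t.
Proof.
by move=> fg; apply: eq_Rintegral => s; rewrite inE/= in_itv/= => /andP[s0 st]; exact: fg.
Qed.

Lemma IR_cst (k : R) t : 0 <= t -> IR (fun=> k) t = k * t.
Proof.
move=> t0; rewrite Rintegral_cst//= lebesgue_measure_itv/= lte_fin.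
by case: ltP => [_|]; rewrite ?oppr0 ?addr0 ?subr0//= => t0'; rewrite (le_anti (introT andP (conj t0 t0'))).
Qed.

Lemma IR0 f : IR f 0 = 0.
Proof. by rewrite set_itv1 Rintegral_set1. Qed.

Lemma IR_sum n (f : 'I_n -> R -> R) t : (forall i, locint (f i)) ->
  IR (fun s => \sum_i f i s) t = \sum_i IR (f i) t.
Proof.
elim: n f => [|n IH] f fi.
  under eq_IR do rewrite big_ord0.
  rewrite big_ord0 /Rintegral integral0//.
under eq_IR do rewrite big_ord_recl.
by rewrite big_ord_recl IRD ?IH//; apply: locint_sum.
Qed.

Lemma le_IR f g t : locint f -> locint g ->
  (forall s, 0 <= s -> s <= t -> f s <= g s) -> IR f t <= IR g t.
Proof.
move=> fi gi fg; apply: le_Rintegral => // s /=; rewrite in_itv/= => /andP[? ?].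
exact: fg.
Qed.

Lemma IR_ge0 f t : (forall s, 0 <= s -> s <= t -> 0 <= f s) -> 0 <= IR f t.
Proof. by move=> f0; apply: Rintegral_ge0 => s /=; rewrite in_itv/= => /andP[? ?]; exact: f0. Qed.

Lemma le_norm_IR f t : locint f -> `|IR f t| <= IR (fun s => `|f s|) t.
Proof. by move=> fi; exact: le_normr_Rintegral. Qed.

Lemma integrable_sub f s t : locint f -> 0 <= s ->
  mu.-integrable `]s, t] (EFin \o f).
Proof.
move=> fi s0; apply: integrableS (fi t) => //.
by move=> r /=; rewrite !in_itv/= => /andP[sr ->]; rewrite (le_trans s0)// ltW.
Qed.

Lemma IR_chasles f s t : locint f -> 0 <= s -> s <= t ->
  IR f t - IR f s = \int[mu]_(r in `]s, t]) f r.
Proof.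
by move=> fi s0 st; rewrite Rintegral_itvB// bnd_simp.
Qed.

Lemma IR_incr_le f g s t : locint f -> locint g -> 0 <= s -> s <= t ->
  (forall r, s < r -> r <= t -> f r <= g r) ->
  IR f t - IR f s <= IR g t - IR g s.
Proof.
move=> fi gi s0 st fg; rewrite !IR_chasles//.
apply: le_Rintegral => //; try exact: integrable_sub.
by move=> r /=; rewrite in_itv/= => /andP[? ?]; exact: fg.
Qed.

Lemma IR_incr_ge0 f s t : locint f -> 0 <= s -> s <= t ->
  (forall r, s < r -> r <= t -> 0 <= f r) -> IR f s <= IR f t.
Proof.
move=> fi s0 st f0; rewrite -subr_ge0 IR_chasles//.
by apply: Rintegral_ge0 => r /=; rewrite in_itv/= => /andP[? ?]; exact: f0.
Qed.

Lemma norm_IR_incr f s t : locint f -> 0 <= s -> s <= t ->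
  `|IR f t - IR f s| <= IR (fun r => `|f r|) t - IR (fun r => `|f r|) s.
Proof.
move=> fi s0 st; rewrite !IR_chasles//; last exact: locint_norm.
by apply: le_normr_Rintegral => //; exact: integrable_sub.
Qed.

Lemma cont0_IR f : locint f -> cont0 (fun t => IR f t).
Proof.
move=> fi; apply/cont0P/subspace_continuousP => t /=; rewrite in_itv/= andbT => t0.
have t1 : 0 <= t + 1 by lra.
have /subspace_continuousP/(_ t) := parameterized_integral_continuous t1 (fi (t + 1)).
rewrite /= in_itv/= t0 lerDl ler01 => /(_ isT) H.
apply: cvg_trans H; apply: (@cvg_app _ _ _ _ (fun x => IR f x)).
move=> A; rewrite /within /nbhs/= => HA.
have : \forall x \near t, x < t + 1 by apply: lt_nbhsl; lra.
move: HA; apply: filterS2 => x /= H xt; rewrite in_itv/= andbT => x0.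
by apply: H; rewrite in_itv/= x0 ltW.
Qed.

Lemma IR_shift f T t : locint f -> 0 <= T -> 0 <= t ->
  IR (fun s => f (s + T)) t = IR f (T + t) - IR f T.
Proof.
move=> fi T0 t0; rewrite IR_chasles//; last lra.
rewrite [RHS](@Rintegral_shift _ T)//; last first.
  by have /measurable_int/measurable_EFinP := integrable_sub (T + t) fi T0.
have -> : (fun x => x + T) @^-1` `]T, T + t] = `]0, t]%classic.
  apply/seteqP; split => x /=; rewrite !in_itv/= => /andP[? ?]; apply/andP; split; lra.
rewrite -Rintegral_itv_obnd_cbnd//.
have := integrable_shift T (measurable_itv _) (integrable_sub (T + t) fi T0).
congr (integrable _ _ _).
  apply/seteqP; split => x /=; rewrite !in_itv/= => /andP[? ?]; apply/andP; split; lra.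
Qed.

Lemma locint_shift f T : locint f -> 0 <= T -> locint (fun s => f (s + T)).
Proof.
move=> fi T0 t.
have : mu.-integrable `[T, T + t] (EFin \o f).
  apply: integrableS (fi (T + t)) => //.
  by move=> r /=; rewrite !in_itv/= => /andP[sr ->]; rewrite (le_trans T0).
move=> /(integrable_shift T (measurable_itv _)).
have -> // : (fun x => x + T) @^-1` `[T, T + t] = `[0, t]%classic.
apply/seteqP; split => x /=; rewrite !in_itv/= => /andP[? ?]; apply/andP; split; lra.
Qed.

(** A fundamental theorem of calculus without derivatives: the increments of [Phi] are small
    relative to those of [A], which add up, so telescoping over a uniform partition gives
    $|\Phi(T)-\Phi(0)|\le e(A(T)-A(0))$ for every $e>0$. *)
Lemma partition_const (Phi A : R -> R) T : 0 <= T ->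
  (forall e, 0 < e -> exists2 d, 0 < d &
     forall s t, 0 <= s -> s <= t -> t <= T -> t - s <= d ->
     `|Phi t - Phi s| <= e * (A t - A s)) ->
  Phi T = Phi 0.
Proof.
move=> T0 H; apply/eqP; rewrite -subr_eq0 -normr_le0.
have key e : 0 < e -> `|Phi T - Phi 0| <= e * (A T - A 0).
  move=> e0; have [d d0 Hd] := H e e0.
  pose N := (Num.truncn (T / d)).+1.
  have N0 : 0 < N%:R :> R by rewrite ltr0n.
  have hd : T / N%:R <= d.
    rewrite ler_pdivrMr// mulrC -ler_pdivrMr// ltW// /N.
    by rewrite truncnS_gt.
  have h0 : 0 <= T / N%:R by rewrite divr_ge0// ltW.
  have kk k : (k <= N)%N ->
      `|Phi (k%:R * (T / N%:R)) - Phi 0| <= e * (A (k%:R * (T / N%:R)) - A 0).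
    elim: k => [|k IH] kN; first by rewrite mul0r !subrr normr0 mulr0.
    have E : k.+1%:R * (T / N%:R) = k%:R * (T / N%:R) + T / N%:R.
      by rewrite -natr1 mulrDl mul1r.
    have le1 : k.+1%:R * (T / N%:R) <= T.
      rewrite mulrA ler_pdivrMr// mulrC ler_wpM2l// ler_nat//.
    have := Hd (k%:R * (T / N%:R)) (k.+1%:R * (T / N%:R)).
    rewrite mulr_ge0 ?ler0n//= => /(_ isT).
    rewrite {1}E lerDl => /(_ h0 le1); rewrite {1}E addrAC subrr add0r => /(_ hd) H1.
    have H2 := IH (ltnW kN).
    rewrite -(subrKA (Phi (k%:R * (T / N%:R)))) (le_trans (ler_normD _ _))//.
    lra.
  by have := kk N (leqnn _); rewrite mulrC divfK// gt_eqF.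
have [|AT] := leP (A T - A 0) 0.
  by move=> /(mulr_ge0_le0 ler01) /(le_trans (key 1 ltr01)).
apply/ler_addgt0Pr => e e0; rewrite add0r.
have := key (e / (A T - A 0)); rewrite divfK ?gt_eqF//; apply.
by rewrite divr_gt0.
Qed.

End LocalIntegrability.

Lemma continuous_cV {R : realType} {n : nat} (T : topologicalType)
    (f : T -> 'cV[R]_n) :
  (forall i, continuous (fun t => f t i 0)) -> continuous f.
Proof.
move=> fc t A [P Pn PA].
have : \forall s \near t, forall i, P i 0 (f s i 0).
  by apply: filter_forall => i; apply: (fc i t); exact: Pn.
apply: (@filterS _ (nbhs t)) => s Ps; apply: PA => i j; rewrite ord1; exact: Ps.
Qed.

(* The coordinate of index [k] of [y], the scalar [v] coming after the last one:
   this turns the system into the chain [x_k' = x_(k+1)]. *)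
Definition chain_coord {R : realType} {n : nat} (y : 'cV[R]_n) (v : R) (k : nat) : R :=
  oapp (fun i : 'I_n => y i 0) v (insub k).

(** * Trajectories *)

Section Trajectories.
Context {R : realType} {n : nat}.
Implicit Types (u v : R -> R) (t T : R).

Lemma chain_coord_lt (y : 'cV[R]_n) (v : R) k (kn : (k < n)%N) :
  chain_coord y v k = y (Ordinal kn) 0.
Proof. by rewrite /chain_coord insubT. Qed.

Lemma chain_coord_last (y : 'cV[R]_n) (v : R) : chain_coord y v n = v.
Proof. by rewrite /chain_coord insubF// ltnn. Qed.

Lemma drift_chain_coord (y : 'cV[R]_n) (v : R) i :
  (jordan0 R n *m y + v *: elast R n) i 0 = chain_coord y v i.+1.
Proof.
rewrite !mxE; have := ltn_ord i; rewrite leq_eqVlt => /orP[/eqP iE|i1].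
  rewrite big1 => [|j _]; last first.
    by rewrite mxE iE ltn_eqF ?mul0r// ltn_ord.
  by rewrite add0r iE eqxx mulr1 /chain_coord insubF// ltnn.
rewrite chain_coord_lt (bigD1 (Ordinal i1))//= mxE eqxx mul1r big1 => [|j jn].
  by rewrite addr0 ltn_eqF// mulr0 addr0.
by rewrite mxE -(inj_eq val_inj)/= in jn *; rewrite (negbTE jn) mul0r.
Qed.

Lemma is_trajectoryP (x0 : 'cV[R]_n) u (x : R -> 'cV[R]_n) : is_trajectory x0 u x <->
  cont0 x /\ forall t, 0 <= t -> forall i,
    x t i 0 = x0 i 0 + IR (fun s => chain_coord (x s) (u s) i.+1) t.
Proof.
rewrite /is_trajectory /=; split => -[xc xE]; split; try exact/cont0P.
  move=> t t0 i; rewrite xE//; congr (_ + _).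
  by apply: eq_Rintegral => s _; rewrite drift_chain_coord.
move=> t t0 i; rewrite xE//; congr (_ + _).
by apply: eq_Rintegral => s _; rewrite drift_chain_coord.
Qed.

Lemma cont0_coord (x : R -> 'cV[R]_n) i : cont0 x -> cont0 (fun t => x t i 0).
Proof. by move=> xc; apply: (cont0_comp xc (@coord_continuous R n 1 i 0)). Qed.

Lemma locint_chain_coord (x : R -> 'cV[R]_n) u k : cont0 x -> locint u ->
  locint (fun t => chain_coord (x t) (u t) k).
Proof.
move=> xc ui; rewrite /chain_coord; case: insubP => [i _ _|_] //=.
exact/locint_cont0/cont0_coord.
Qed.

(** Coordinates are counted from the end: [k] stands for the coordinate [n - k], and [0] for the
    control. The system is a chain of integrators, so a trajectory is obtained by successive
    integrations starting with the last coordinate. *)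
Fixpoint chain_solution (x0 : 'cV[R]_n) u (k : nat) : R -> R :=
  if k is k'.+1 then
    fun t => chain_coord x0 0 (n - k) + IR (chain_solution x0 u k') t
  else u.

Lemma locint_chain_solution (x0 : 'cV[R]_n) u k : locint u -> locint (chain_solution x0 u k).
Proof.
move=> ui; elim: k => [//|k IH]; apply: locintD; first exact: locint_cst.
exact/locint_cont0/cont0_IR.
Qed.

Lemma trajectory_exists (x0 : 'cV[R]_n) u : locint u -> exists x, is_trajectory x0 u x.
Proof.
move=> ui; exists (fun t => \col_(i < n) chain_solution x0 u (n - i) t).
have E (i : 'I_n) : (n - i = (n - i.+1).+1)%N by rewrite subnSK.
have sc k : cont0 (chain_solution x0 u k.+1).
  have Ic := cont0_IR (locint_chain_solution x0 k ui).
  by move=> t; apply: cvgD; [exact: cvg_cst|exact: Ic].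
apply/is_trajectoryP; split.
  apply: continuous_cV => i; rewrite (_ : (fun t => _) =
      (fun t => chain_solution x0 u (n - i) (Num.max t 0))); last first.
    by apply/funext => t; rewrite mxE.
  by rewrite E; exact: sc.
move=> t t0 i; rewrite mxE E [LHS]/=; congr (_ + _).
  rewrite -E subKn; last exact/ltnW.
  rewrite (chain_coord_lt _ _ (ltn_ord i)); congr (x0 _ _); exact: val_inj.
apply: eq_Rintegral => s _.
have := ltn_ord i; rewrite leq_eqVlt => /orP[/eqP iE|i1].
  by rewrite iE chain_coord_last subnn.
by rewrite chain_coord_lt mxE.
Qed.

Lemma trajectoryP (x0 : 'cV[R]_n) u : locint u -> is_trajectory x0 u (trajectory x0 u).
Proof. by move=> ui; apply: xgetPex; exact: trajectory_exists. Qed.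

Lemma cont0_trajectory (x0 : 'cV[R]_n) u : locint u -> cont0 (trajectory x0 u).
Proof. by move=> /(trajectoryP x0)/is_trajectoryP[]. Qed.

Lemma is_trajectory_lin (a b : R) (x0 y0 : 'cV[R]_n) u v (x y : R -> 'cV[R]_n) : locint u -> locint v ->
  is_trajectory x0 u x -> is_trajectory y0 v y ->
  is_trajectory (a *: x0 + b *: y0) (fun t => a * u t + b * v t)
    (fun t => a *: x t + b *: y t).
Proof.
move=> ui vi /is_trajectoryP[xc xE] /is_trajectoryP[yc yE]; apply/is_trajectoryP.
split.
  by move=> t; apply: cvgD; apply: cvgZ; try exact: cvg_cst; [exact: xc|exact: yc].
move=> t t0 i; rewrite !mxE xE// yE//.
rewrite [in RHS](_ : (fun s => _) =
  (fun s => a * chain_coord (x s) (u s) i.+1 + b * chain_coord (y s) (v s) i.+1)).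
  rewrite IRD; [|exact/locintZ/locint_chain_coord..].
  by rewrite !IRZ; [ring|exact: locint_chain_coord..].
apply/funext => s; rewrite /chain_coord; case: insub => //= j; by rewrite !mxE.
Qed.

(** No Gronwall inequality is involved: going up the chain from the control, each integration over a
    time at most [T] multiplies the bound by at most $1+T$. *)
Lemma is_trajectory_bound (x0 : 'cV[R]_n) u (x : R -> 'cV[R]_n) T : locint u -> is_trajectory x0 u x ->
  forall t, 0 <= t -> t <= T ->
  `|x t| <= (1 + T) ^+ n * (`|x0| + IR (fun s => `|u s|) T).
Proof.
move=> ui /is_trajectoryP[xc xE] t t0 tT; have T0 := le_trans t0 tT.
pose A := `|x0| + IR (fun s => `|u s|) T.
have U0 : 0 <= IR (fun s => `|u s|) T by apply: IR_ge0.
have A0 : 0 <= A by rewrite addr_ge0.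
have T1 : 1 <= 1 + T by lra.
have key k (i : 'I_n) : (n - i.+1 = k)%N -> forall s, 0 <= s -> s <= T ->
    `|x s i 0| <= (1 + T) ^+ k * A.
  elim: k i => [|k IH] i ik s s0 sT; rewrite xE//.
    rewrite expr0 mul1r (le_trans (ler_normD _ _))// lerD ?cV_coord_le//.
    have -> : i.+1 = n by apply/eqP; rewrite eqn_leq ltn_ord -subn_eq0 ik.
    rewrite (_ : (fun s => _) = u); last first.
      by apply/funext => r; rewrite chain_coord_last.
    apply: le_trans (le_norm_IR _ ui) _.
    by apply: IR_incr_ge0 => //; exact: locint_norm.
  have i1 : (i.+1 < n)%N by rewrite -subn_gt0 ik.
  have B0 : 0 <= (1 + T) ^+ k * A by rewrite mulr_ge0// exprn_ge0//; lra.
  have AB : A <= (1 + T) ^+ k * A by rewrite ler_peMl// exprn_ege1.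
  rewrite (le_trans (ler_normD _ _))// exprS -mulrA mulrDl mul1r lerD//.
    by rewrite (le_trans (cV_coord_le _ _))// (le_trans _ AB)// lerDl.
  have ci : locint (fun s => chain_coord (x s) (u s) i.+1).
    exact: locint_chain_coord.
  apply: le_trans (le_norm_IR _ ci) _.
  apply: (@le_trans _ _ (IR (fun=> (1 + T) ^+ k * A) s)).
    apply: le_IR; [exact: locint_norm|exact: locint_cst|move=> r r0 rs].
    rewrite chain_coord_lt IH//= ?(le_trans rs)//.
    by rewrite subnS ik.
  by rewrite IR_cst// mulrC ler_wpM2r.
apply: cV_norm_le => [|i]; first by rewrite mulr_ge0// exprn_ge0//; lra.
apply: le_trans (key _ i erefl t t0 tT) _.
by rewrite ler_wpM2r// ler_weXn2l// leq_subr.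
Qed.

(** By linearity the difference is a trajectory from the origin with control $u-v$. Convergence of
    controls in $L^1$ on bounded intervals is thus enough for convergence of trajectories. *)
Lemma is_trajectory_dist (x0 : 'cV[R]_n) u v (x y : R -> 'cV[R]_n) T :
  locint u -> locint v -> is_trajectory x0 u x -> is_trajectory x0 v y ->
  forall t, 0 <= t -> t <= T ->
  `|x t - y t| <= (1 + T) ^+ n * IR (fun s => `|u s - v s|) T.
Proof.
move=> ui vi xu yv t t0 tT.
have := is_trajectory_lin 1 (-1) ui vi xu yv.
have wi : locint (fun t => 1 * u t + -1 * v t) by apply: locintD; exact: locintZ.
move=> /(is_trajectory_bound wi) /(_ t t0 tT).
rewrite !scaleN1r !scale1r subrr normr0 add0r.
by rewrite (@eq_IR _ _ (fun s => `|u s - v s|))// => s _ _; rewrite mul1r mulN1r.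
Qed.

Lemma is_trajectory_eq (x0 : 'cV[R]_n) u v (x y : R -> 'cV[R]_n) T : locint u -> locint v ->
  is_trajectory x0 u x -> is_trajectory x0 v y ->
  IR (fun s => `|u s - v s|) T = 0 ->
  forall t, 0 <= t -> t <= T -> x t = y t.
Proof.
move=> ui vi xu yv uv t t0 tT; apply/eqP; rewrite -subr_eq0 -normr_le0.
by have := is_trajectory_dist ui vi xu yv t0 tT; rewrite uv mulr0.
Qed.

Lemma trajectory_unique (x0 : 'cV[R]_n) u (x : R -> 'cV[R]_n) : locint u -> is_trajectory x0 u x ->
  forall t, 0 <= t -> trajectory x0 u t = x t.
Proof.
move=> ui xu t t0.
apply: (is_trajectory_eq ui ui (trajectoryP x0 ui) xu _ t0 (lexx t)).
rewrite (@eq_IR _ _ (fun=> 0)) ?IR_cst ?mul0r// => s _ _.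
by rewrite subrr normr0.
Qed.

Lemma trajectory_local (x0 : 'cV[R]_n) u v T : locint u -> locint v ->
  (forall t, 0 <= t -> t <= T -> u t = v t) ->
  forall t, 0 <= t -> t <= T -> trajectory x0 u t = trajectory x0 v t.
Proof.
move=> ui vi uv t t0 tT.
apply: (is_trajectory_eq ui vi (trajectoryP x0 ui) (trajectoryP x0 vi) _ t0 tT).
rewrite (@eq_IR _ _ (fun=> 0)) ?IR_cst ?mul0r ?(le_trans t0 tT)// => s s0 sT.
by rewrite uv// subrr normr0.
Qed.

Lemma trajectory_lin (a b : R) (x0 y0 : 'cV[R]_n) u v : locint u -> locint v ->
  forall t, 0 <= t ->
  trajectory (a *: x0 + b *: y0) (fun t => a * u t + b * v t) t =
  a *: trajectory x0 u t + b *: trajectory y0 v t.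
Proof.
move=> ui vi t t0; apply: (@trajectory_unique _ _
    (fun t => a *: trajectory x0 u t + b *: trajectory y0 v t)) => //.
  by apply: locintD; exact: locintZ.
by apply: is_trajectory_lin => //; exact: trajectoryP.
Qed.

Lemma trajectory0 (x0 : 'cV[R]_n) u : locint u -> trajectory x0 u 0 = x0.
Proof.
move=> /(trajectoryP x0)/is_trajectoryP[_ E]; apply/matrixP => i j.
by rewrite ord1 E// IR0 addr0.
Qed.

Lemma trajectory_shift (x0 : 'cV[R]_n) u T t : locint u -> 0 <= T -> 0 <= t ->
  trajectory (trajectory x0 u T) (fun s => u (s + T)) t =
  trajectory x0 u (t + T).
Proof.
move=> ui T0 t0; have /is_trajectoryP[xc xE] := trajectoryP x0 ui.
set x := trajectory x0 u in xc xE *.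
apply: (@trajectory_unique _ _ (fun t => x (t + T))) => //.
  exact: locint_shift.
apply/is_trajectoryP; split.
  have mc : continuous (fun t : R => Num.max t 0 + T).
    move=> s; apply: cvgD; last exact: cvg_cst.
    by apply: (@continuous_max R R (fun s => s) (fun=> 0)); [exact: cvg_id|exact: cvg_cst].
  have xmc : continuous (fun s : R => x (Num.max (Num.max s 0 + T) 0)).
    by move=> s; apply: continuous_comp (mc s) (xc _).
  rewrite /cont0 [X in continuous X](_ : _ = (fun s : R => x (Num.max (Num.max s 0 + T) 0)))//.
  by apply/funext => r /=; congr (x _); rewrite [RHS]max_l// addr_ge0// le_max lexx orbT.
move=> s s0 i; rewrite !xE ?addr_ge0//.
rewrite (@IR_shift _ (fun s => chain_coord (x s) (u s) i.+1))//; last first.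
  exact: locint_chain_coord.
by rewrite [T + s]addrC; ring.
Qed.

End Trajectories.

Section ContinuousOperations.
Context {R : realType} {T : topologicalType}.
Implicit Types (f g : T -> R).

Lemma continuous_cst (k : R) : continuous (fun _ : T => k).
Proof. by move=> t; exact: cvg_cst. Qed.

Lemma continuous_add f g :
  continuous f -> continuous g -> continuous (fun t => f t + g t).
Proof. by move=> fc gc t; apply: cvgD; [exact: fc|exact: gc]. Qed.

Lemma continuous_sub f g :
  continuous f -> continuous g -> continuous (fun t => f t - g t).
Proof. by move=> fc gc t; apply: cvgB; [exact: fc|exact: gc]. Qed.

Lemma continuous_mul f g :
  continuous f -> continuous g -> continuous (fun t => f t * g t).
Proof. by move=> fc gc t; apply: cvgM; [exact: fc|exact: gc]. Qed.

Lemma continuous_sum m (f : 'I_m -> T -> R) :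
  (forall i, continuous (f i)) -> continuous (fun t => \sum_i f i t).
Proof.
move=> fc; rewrite (_ : (fun t => _) = \sum_i f i); last first.
  by apply/funext => t; rewrite fct_sumE.
elim/big_ind: _ => [|g h gc hc|i _]; last exact: fc.
  by move=> t; exact: cvg_cst.
by move=> t; apply: cvgD; [exact: gc|exact: hc].
Qed.

End ContinuousOperations.

(** * Chain rule along trajectories *)

Section Gradient.
Context {R : realType} {n : nat}.
Implicit Types (W : 'cV[R]_n -> R).

Definition drift_part W (x : 'cV[R]_n) : R :=
  ((gradient W x)^T *m jordan0 R n *m x) 0 0.

Lemma deriveE_gradient W (x v : 'cV[R]_n) : differentiable W x ->
  'D_v W x = \sum_i gradient W x i 0 * v i 0.
Proof.
move=> dW; rewrite deriveE//.
have {1}-> : v = \sum_i v i 0 *: delta_mx i 0.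
  by rewrite {1}[v]matrix_sum_delta; apply: eq_bigr => i _; rewrite big_ord1.
rewrite linear_sum; apply: eq_bigr => i _.
by rewrite linearZ/= mxE deriveE// mulrC.
Qed.

Lemma gradient_chain_coord W (x : 'cV[R]_n) (v : R) : differentiable W x ->
  \sum_i gradient W x i 0 * chain_coord x v i.+1 =
  drift_part W x + partial_last W x * v.
Proof.
move=> dW; rewrite /partial_last deriveE_gradient// /drift_part.
under eq_bigr do rewrite -drift_chain_coord.
transitivity (((gradient W x)^T *m (jordan0 R n *m x + v *: elast R n)) 0 0).
  by rewrite !mxE; apply: eq_bigr => i _; rewrite [in RHS]mxE.
rewrite mulmxDr mxE mulmxA; congr (_ + _).
rewrite -scalemxAr !mxE mulr_suml mulr_sumr; apply: eq_bigr => i _.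
by rewrite [in LHS]mxE mulrC.
Qed.

Lemma C1_continuous W : C1 W -> continuous W.
Proof. by move=> [dW _] x; exact: differentiable_continuous. Qed.

Lemma C1_gradient_coord W i : C1 W -> continuous (fun x => gradient W x i 0).
Proof.
move=> [_ gW] x.
exact: (continuous_comp (gW x) (@coord_continuous R n 1 i 0 _)).
Qed.

Lemma C1_partial_last W : C1 W -> continuous (partial_last W).
Proof.
move=> cW; have [dW _] := cW.
rewrite (_ : partial_last W = fun x => \sum_i gradient W x i 0 * elast R n i 0).
  apply: continuous_sum => i; apply: continuous_mul; last exact: continuous_cst.
  exact: C1_gradient_coord.
by apply/funext => x; rewrite /partial_last deriveE_gradient.
Qed.

Lemma C1_drift_part W : C1 W -> continuous (drift_part W).
Proof.
move=> cW; have [dW _] := cW.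
rewrite (_ : drift_part W = fun x =>
    \sum_i gradient W x i 0 * chain_coord x 0 i.+1).
  apply: continuous_sum => i; apply: continuous_mul; first exact: C1_gradient_coord.
  rewrite /chain_coord; case: insub => /= [j|]; last exact: continuous_cst.
  exact: coord_continuous.
by apply/funext => x; rewrite gradient_chain_coord// mulr0 addr0.
Qed.

Lemma differentiable_MVT W (x y : 'cV[R]_n) : (forall z, differentiable W z) ->
  exists2 t, 0 <= t <= 1 &
    W y - W x = \sum_i gradient W (x + t *: (y - x)) i 0 * (y - x) i 0.
Proof.
move=> dW; pose l (t : R) : 'cV[R]_n := x + t *: (y - x).
have dl (t : R) : is_derive t (1 : R) (W \o l) ('D_(y - x) W (l t)).
  have E : (fun h : R => h^-1 *: ((W \o l) (h *: 1 + t) - (W \o l) t)) =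
           (fun h : R => h^-1 *: (W (h *: (y - x) + l t) - W (l t))).
    apply/funext => h; rewrite /= /l; congr (_ *: (W _ - _)).
    by rewrite [h *: 1]mulr1 scalerDl addrCA.
  apply: DeriveDef; last by rewrite /derive E.
  by rewrite /derivable E; exact: (diff_derivable (dW (l t))).
have lc : {within `[0, 1], continuous (W \o l)}.
  apply: continuous_subspaceT => t; apply: differentiable_continuous.
  by apply/derivable1_diffP; have [] := dl t.
have [t] := MVT (@ltr01 R) (fun t _ => dl t) lc.
rewrite in_itv/= => /andP[t0 t1]; rewrite /l scale0r scale1r addr0 subrKC subr0 mulr1 => ->.
by exists t; [rewrite !ltW|rewrite deriveE_gradient].
Qed.

(** Mean value theorem on the segment and uniform continuity of the gradient near the ball. The
    remainder is measured by the sum of the coordinates, which along a trajectory is bounded by an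
    additive integral. *)
Lemma C1_unif_diff W M e : C1 W -> 0 < e -> exists2 d, 0 < d &
  forall x y : 'cV[R]_n, `|x| <= M -> `|x - y| <= d ->
  `|W y - W x - \sum_i gradient W x i 0 * (y - x) i 0| <= e * \sum_i `|(y - x) i 0|.
Proof.
move=> [dW gW] e0.
have [d d0 Hd] := compact_unif_continuous (@compact_cV_ball R n M) gW e0.
exists d => // x y xM xy.
have [t /andP[t0 t1] ->] := differentiable_MVT x y dW.
rewrite -sumrB (le_trans (ler_norm_sum _ _ _))// mulr_sumr ler_sum// => i _.
rewrite -mulrBl normrM ler_wpM2r//.
have := Hd x (x + t *: (y - x)) xM; rewrite opprD addNKr normrN normrZ => H.
have {}H := H _; rewrite distrC (le_trans _ (H _))//.
  by have := cV_coord_le (gradient W x - gradient W (x + t *: (y - x))) i; rewrite !mxE.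
rewrite ger0_norm// distrC (le_trans _ xy)// ler_piMl//.
Qed.

End Gradient.

Section ChainRule.
Context {R : realType} {n : nat}.
Implicit Types (W : 'cV[R]_n -> R).

(** The difference between $W(x(t))$ and the candidate integral is constant by [partition_const],
    with $A(t)=\int_0^t\sum_i|\dot x_i|$. Over a short interval $[s,t]$, half of the error comes
    from linearizing $W$ at $x(s)$, half from moving the gradient from $x(s)$ to $x(a)$ under the
    integral. *)
Lemma chain_rule W (x0 : 'cV[R]_n) u x T : C1 W -> locint u ->
  is_trajectory x0 u x -> 0 <= T ->
  W (x T) = W x0 +
    IR (fun s => drift_part W (x s) + partial_last W (x s) * u s) T.
Proof.
move=> cW ui xu T0; have [dW gW] := cW.
have /is_trajectoryP[xc xE] := xu.
pose r (i : 'I_n) s := chain_coord (x s) (u s) i.+1.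
have ri i : locint (r i) by exact: locint_chain_coord.
pose D s := \sum_i gradient W (x s) i 0 * r i s.
have gc i : cont0 (fun s => gradient W (x s) i 0).
  exact: (cont0_comp xc (C1_gradient_coord (i := i) cW)).
have Di : locint D by apply: locint_sum => i; exact: locintM.
have -> : (fun s => drift_part W (x s) + partial_last W (x s) * u s) = D.
  by apply/funext => s; rewrite -gradient_chain_coord.
pose Phi t := W (x t) - IR D t.
have nri : locint (fun s => \sum_i `|r i s|).
  by apply: locint_sum => i; exact: locint_norm.
suff : Phi T = Phi 0.
  rewrite /Phi IR0 subr0 => /eqP; rewrite subr_eq => /eqP ->; congr (W _ + _).
  by apply/matrixP => i j; rewrite ord1 xE// IR0 addr0.
apply: (@partition_const _ _ (fun t => IR (fun s => \sum_i `|r i s|) t)) => // e e0.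
pose M := (1 + T) ^+ n * (`|x0| + IR (fun s => `|u s|) T).
have e2 : 0 < e / 2 by rewrite divr_gt0.
have [d1 d10 Hd1] := C1_unif_diff M cW e2.
have [d2 d20 Hd2] := compact_unif_continuous (@compact_cV_ball R n M) gW e2.
have d12 : 0 < Num.min d1 d2 by rewrite lt_min d10.
have [d d0 Hd] := compact_unif_continuous (@segment_compact R 0 T) xc d12.
exists d => // s t s0 st tT std.
have t0 := le_trans s0 st; have sT := le_trans st tT.
have close a b : 0 <= a -> a <= T -> 0 <= b -> `|a - b| <= d ->
    `|x a - x b| <= d1 /\ `|x a - x b| <= d2.
  move=> a0 aT b0 ab; have := Hd a b; rewrite /= in_itv/= a0 aT !max_l//.
  by move=> /(_ isT ab); rewrite le_min => /andP[].
have xM a : 0 <= a -> a <= T -> `|x a| <= M by exact: (is_trajectory_bound ui xu).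
(* Integrand of the error made by freezing the gradient at $x(s)$. *)
pose h a := \sum_i (gradient W (x s) i 0 - gradient W (x a) i 0) * r i a.
have hi : locint h.
  apply: locint_sum => i; apply: locintM => // a; apply: cvgB; first exact: cvg_cst.
  exact: gc.
have incr i : (x t - x s) i 0 = IR (r i) t - IR (r i) s.
  by rewrite !mxE !xE//; ring.
have -> : Phi t - Phi s =
    (W (x t) - W (x s) - \sum_i gradient W (x s) i 0 * (x t - x s) i 0) +
    (IR h t - IR h s).
  have hE a : IR h a = \sum_i gradient W (x s) i 0 * IR (r i) a - IR D a.
    rewrite -(eq_bigr _ (fun i _ => IRZ _ _ (ri i))) -IR_sum; last first.
      by move=> i; exact: locintZ.
    rewrite -IRB//; last by apply: locint_sum => i; exact: locintZ.
    congr (Rintegral _ _ _); apply/funext => b; rewrite /h /D -sumrB.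
    by apply: eq_bigr => i _; rewrite mulrBl.
  rewrite !hE (eq_bigr _ (fun i _ => congr1 (fun z => _ * z) (incr i))).
  under eq_bigr do rewrite mulrBr.
  by rewrite sumrB /Phi; ring.
rewrite (le_trans (ler_normD _ _))//.
have [] := close s t s0 sT t0; first by rewrite distrC ger0_norm ?subr_ge0.
move=> /(Hd1 _ _ (xM s s0 sT)) H1 _.
have H2 : \sum_i `|(x t - x s) i 0| <=
    IR (fun s => \sum_i `|r i s|) t - IR (fun s => \sum_i `|r i s|) s.
  rewrite !IR_sum; try by move=> i; exact: locint_norm.
  rewrite -sumrB ler_sum// => i _; rewrite incr; exact: norm_IR_incr.
have H3 : `|IR h t - IR h s| <= e / 2 *
    (IR (fun s => \sum_i `|r i s|) t - IR (fun s => \sum_i `|r i s|) s).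
  apply: (le_trans (norm_IR_incr hi s0 st)); rewrite mulrBr -!IRZ//.
  apply: IR_incr_le => //; [exact: locint_norm|exact: locintZ|move=> a sa at'].
  rewrite (le_trans (ler_norm_sum _ _ _))// mulr_sumr ler_sum// => i _.
  rewrite normrM ler_wpM2r//.
  have a0 : 0 <= a by rewrite (le_trans s0)// ltW.
  have [] := close s a s0 sT a0.
    by rewrite distrC ger0_norm ?subr_ge0 ?(ltW sa)//; lra.
  move=> _ /(Hd2 _ _ (xM s s0 sT)); apply: le_trans.
  by have := cV_coord_le (gradient W (x s) - gradient W (x a)) i; rewrite !mxE.
have := ler_wpM2l (ltW e2) H2; lra.
Qed.

End ChainRule.

(** * Splitting integrals over the half-line *)

Section HalfLineIntegrals.
Context {R : realType}.
Notation mu := (@lebesgue_measure R).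
Notation halfline := (`[0, +oo[%classic : set (measurableTypeR R)).
Implicit Types (f g : R -> R) (T : R).

Lemma fine_IR f T : locint f -> (\int[mu]_(s in `[0%R, T]) (f s)%:E = (IR f T)%:E)%E.
Proof. by move=> fi; rewrite /Rintegral fineK// integrable_fin_num. Qed.

Lemma measurable_fun_halfline_shift f T : 0 <= T -> measurable_fun halfline f ->
  measurable_fun halfline (fun s => f (s + T)).
Proof.
move=> T0 mf; have mI : measurable halfline by exact: measurable_itv.
have := @measurable_fun_shift R T _ _ _ f mI mf.
apply: measurable_funS; first exact: measurable_shift_preimage.
by move=> x /=; rewrite !in_itv/= !andbT => x0; rewrite addr_ge0.
Qed.

Lemma ge0_integral_halfline_split f T : 0 <= T -> measurable_fun halfline f ->
  (forall t, 0 <= t -> 0 <= f t) ->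
  (\int[mu]_(t in `[0%R, +oo[) (f t)%:E =
   \int[mu]_(t in `[0%R, T]) (f t)%:E +
   \int[mu]_(t in `[0%R, +oo[) (f (t + T))%:E)%E.
Proof.
move=> T0 mf f0.
have E : `[0, +oo[%classic = `[0, T] `|` `]T, +oo[ :> set R.
  apply/seteqP; split => t /=; rewrite !in_itv/= ?andbT.
    by move=> ->; have [?|?] := leP t T; [left|right].
  by case=> [/andP[]//|/ltW]; exact: le_trans.
rewrite [in LHS]E ge0_integral_setU//=; first last.
- by apply/disj_setPS => t /= []; rewrite !in_itv/= andbT => /andP[_ tT]; rewrite ltNge tT.
- move=> t; rewrite !in_itv/= => -[/andP[? _]|]; rewrite lee_fin; first exact: f0.
  by rewrite andbT => tT; rewrite f0// (le_trans T0)// ltW.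
- by rewrite -E; exact/measurable_EFinP.
congr (_ + _)%E.
have mI : measurable (`]T, +oo[ : set (measurableTypeR R)) by exact: measurable_itv.
have mf' : measurable_fun (`]T, +oo[ : set (measurableTypeR R)) f.
  apply: measurable_funS mf => // t /=; rewrite !in_itv/= !andbT => /ltW.
  exact: le_trans.
rewrite (@ge0_integral_shift _ T)//.
- have -> : (fun x => x + T) @^-1` `]T, +oo[ = `]0, +oo[%classic.
    by apply/seteqP; split => x /=; rewrite !in_itv/= !andbT ltrDr.
  rewrite integral_itv_obnd_cbnd//.
  apply/measurable_EFinP.
  apply: measurable_funS (measurable_fun_halfline_shift T0 mf) => //.
  by move=> t /=; rewrite !in_itv/= !andbT => /ltW.
- exact/measurable_EFinP.
- move=> t /=; rewrite in_itv/= andbT lee_fin => /ltW/(le_trans T0); exact: f0.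
Qed.

(** The end point is left out because a concatenated control already follows its second piece at
    time [T]. *)
Lemma eq_IR_lt f g T : locint f -> locint g ->
  (forall t, 0 <= t -> t < T -> f t = g t) -> IR f T = IR g T.
Proof.
move=> fi gi fg.
have sub : `[0, T[ `<=` `[0, T].
  by move=> t /=; rewrite !in_itv/= => /andP[-> /ltW].
rewrite -!Rintegral_itv_bndo_bndc.
- by apply: eq_Rintegral => t; rewrite inE/= in_itv/= => /andP[? ?]; exact: fg.
- exact: integrableS (gi T).
- exact: integrableS (fi T).
Qed.

End HalfLineIntegrals.

Definition Lq_loc {R : realType} (q : R) (u : R -> R) : Prop :=
  measurable_fun (`[0, +oo[%classic : set (measurableTypeR R)) u /\
  locint (fun t => `|u t| `^ q).

Definition concat_control {R : realType} (T : R) (u v : R -> R) : R -> R :=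
  fun t => if t < T then u t else v (t - T).

(** * Controls and costs *)

Section LqLoc.
Context {R : realType}.
Variables (q : R) (q1 : 1 < q).
Notation mu := (@lebesgue_measure R).
Notation halfline := (`[0, +oo[%classic : set (measurableTypeR R)).
Implicit Types (u v : R -> R) (T : R).

Let q0 : 0 < q. Proof. by rewrite (lt_trans ltr01). Qed.

Lemma measurable_powR_norm u : measurable_fun halfline u ->
  measurable_fun halfline (fun t => `|u t| `^ q).
Proof.
move=> mu'; apply: (measurableT_comp (measurable_powR q)).
exact: measurableT_comp.
Qed.

Lemma Lq_control_loc u : Lq_control q u -> Lq_loc q u.
Proof.
move=> /(Lq_controlP q1)[iu mu']; split=> // t.
apply: integrableS iu => // s /=; by rewrite !in_itv/= => /andP[->].
Qed.

Lemma Lq_loc_locint u : Lq_loc q u -> locint u.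
Proof.
move=> [mu' iu]; apply: (@locint_le _ _ (fun t => 1 + `|u t| `^ q)) => //.
  by move=> t _; exact: ler_norm_powR.
by apply: locintD => //; exact: locint_cst.
Qed.

Lemma cont0_Lq_loc u : cont0 u -> Lq_loc q u.
Proof.
move=> uc; split; first exact: cont0_measurable.
apply: locint_cont0; exact: (cont0_comp uc (continuous_powR_norm q0)).
Qed.

(** Midpoint convexity at $2ax$ and $2by$; the constant is crude, only membership in $L^q$ is at
    stake. *)
Lemma powR_norm_lin (a b x y : R) :
  `|a * x + b * y| `^ q <= (`|2 * a| `^ q + `|2 * b| `^ q) * (`|x| `^ q + `|y| `^ q).
Proof.
have -> : a * x + b * y = (2 * a * x + 2 * b * y) / 2 by field.
apply: (le_trans (powR_midpoint_le q1 _ _)).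
rewrite [`|2 * a * x|]normrM [`|2 * b * y|]normrM !powRM//.
have A := @powR_ge0 R `|2 * a| q; have B := @powR_ge0 R `|2 * b| q.
have C := @powR_ge0 R `|x| q; have D := @powR_ge0 R `|y| q.
have := mulr_ge0 A C; have := mulr_ge0 A D; have := mulr_ge0 B C; have := mulr_ge0 B D.
move: (`|2 * a| `^ q) (`|2 * b| `^ q) (`|x| `^ q) (`|y| `^ q) => a' b' x' y'.
nra.
Qed.

Lemma measurable_fun_lin (a b : R) u v : measurable_fun halfline u ->
  measurable_fun halfline v -> measurable_fun halfline (fun t => a * u t + b * v t).
Proof.
move=> mu' mv; by apply: measurable_funD; apply: measurable_funM.
Qed.

Lemma Lq_loc_lin (a b : R) u v : Lq_loc q u -> Lq_loc q v ->
  Lq_loc q (fun t => a * u t + b * v t).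
Proof.
move=> [mu' iu] [mv iv]; have mw := measurable_fun_lin a b mu' mv; split=> //.
apply: (@locint_le _ _ (fun t => (`|2 * a| `^ q + `|2 * b| `^ q) * (`|u t| `^ q + `|v t| `^ q))).
- exact: measurable_powR_norm.
- by move=> t _; rewrite ger0_norm ?powR_ge0// powR_norm_lin.
- by apply: locintZ; exact: locintD.
Qed.

Lemma Lq_control_lin (a b : R) u v : Lq_control q u -> Lq_control q v ->
  Lq_control q (fun t => a * u t + b * v t).
Proof.
move=> /(Lq_controlP q1)[iu mu'] /(Lq_controlP q1)[iv mv].
have mw := measurable_fun_lin a b mu' mv; apply/(Lq_controlP q1); split=> //.
have mI : measurable halfline by exact: measurable_itv.
have iw := integrableZl mI (`|2 * a| `^ q + `|2 * b| `^ q) (integrableD mI iu iv).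
apply: le_integrable iw => //.
  by apply/measurable_EFinP; exact: measurable_powR_norm.
move=> t _; rewrite /= lee_fin ger0_norm ?powR_ge0//.
by rewrite (le_trans (powR_norm_lin _ _ _ _))// ler_norm.
Qed.

Lemma Lq_control_lty u : Lq_control q u <-> measurable_fun halfline u /\
  (\int[mu]_(t in `[0%R, +oo[) (`|u t| `^ q)%:E < +oo)%E.
Proof.
have E : (\int[mu]_(t in `[0%R, +oo[) `|(`|u t| `^ q)%:E| =
    \int[mu]_(t in `[0%R, +oo[) (`|u t| `^ q)%:E)%E.
  by apply: eq_integral => t _; rewrite gee0_abs// lee_fin powR_ge0.
split => [/(Lq_controlP q1)[/integrableP[_ +] mu']|[mu' iu]].
  by rewrite E.
apply/(Lq_controlP q1); split => //; apply/integrableP; split.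
  by apply/measurable_EFinP; exact: measurable_powR_norm.
by rewrite E.
Qed.

Lemma Lq_control_shift u T : 0 <= T -> Lq_control q u ->
  Lq_control q (fun s => u (s + T)).
Proof.
move=> T0 /Lq_control_lty[mu' iu]; apply/Lq_control_lty; split.
  exact: measurable_fun_halfline_shift.
move: iu; rewrite (ge0_integral_halfline_split T0 (measurable_powR_norm mu')).
  apply: le_lt_trans; rewrite leeDr//.
  by apply: integral_ge0 => t _; rewrite lee_fin powR_ge0.
by move=> t _; exact: powR_ge0.
Qed.

Lemma concat_control_shift T u v : 0 <= T ->
  forall s, 0 <= s -> concat_control T u v (s + T) = v s.
Proof.
by move=> T0 s s0; rewrite /concat_control ltNge lerDr s0/= addrK.
Qed.

Lemma measurable_concat_control T u v : 0 <= T -> measurable_fun halfline u ->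
  measurable_fun halfline v -> measurable_fun halfline (concat_control T u v).
Proof.
move=> T0 mu' mv; have mI : measurable halfline by exact: measurable_itv.
apply: measurable_fun_if => //.
- by apply: measurable_fun_ltr.
- apply: measurable_funS mu' => //; exact: subIsetl.
have := @measurable_fun_shift R (- T) _ _ _ v mI mv.
apply: measurable_funS; first exact: measurable_shift_preimage.
by move=> x /= [_]; rewrite in_itv/= andbT subr_ge0 leNgt => ->.
Qed.

Lemma locint_concat T (u v : R -> R) : 0 <= T -> locint u -> locint v ->
  locint (concat_control T u v).
Proof.
move=> T0 ui vi t.
have mc := measurable_concat_control T0 (locint_measurable ui) (locint_measurable vi).
have mI : measurable (`[0, t] : set (measurableTypeR R)) by exact: measurable_itv.
have iT := integrable_shift (- T) mI (vi t).
have iu : mu.-integrable setT (EFin \o u \_ `[0, t]).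
  by have /(integrable_mkcond _ mI) := ui t; rewrite restrict_EFin.
have iv : mu.-integrable setT (EFin \o (fun x => v (x - T)) \_ ((fun x => x - T) @^-1` `[0, t])).
  have /(integrable_mkcond _ (measurable_shift_preimage (- T) mI)) := iT.
  by rewrite restrict_EFin.
have iuv : mu.-integrable `[0, t] (fun x => (`|(u \_ `[0, t]) x|%:E +
    `|((fun x => v (x - T)) \_ ((fun x => x - T) @^-1` `[0, t])) x|%:E)%E).
  by apply: integrableD => //; apply: integrable_norm;
     [apply: integrableS iu|apply: integrableS iv].
apply: le_integrable iuv => //.
  apply/measurable_EFinP; apply: measurable_funS mc => //.
  by move=> s /=; rewrite !in_itv/= => /andP[->].
move=> s; rewrite /= in_itv/= => /andP[s0 st]; rewrite lee_fin /concat_control.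
rewrite [leRHS]ger0_norm//; case: ltP => sT.
  by rewrite [X in _ <= `|X| + _]patchE ifT ?lerDl// inE/= in_itv/= s0.
rewrite [X in _ <= _ + `|X|]patchE ifT ?lerDr// inE/= in_itv/= subr_ge0 sT/=.
by rewrite lerBlDr (le_trans st)// lerDl.
Qed.

Lemma Lq_loc_concat T u v : 0 <= T -> Lq_loc q u -> Lq_loc q v ->
  Lq_loc q (concat_control T u v).
Proof.
move=> T0 [mu' iu] [mv iv]; split; first exact: measurable_concat_control.
apply: eq_locint (locint_concat T0 iu iv) => t _.
by rewrite /concat_control; case: ifP.
Qed.

Lemma Lq_control_concat T u v : 0 <= T -> Lq_loc q u -> Lq_control q v ->
  Lq_control q (concat_control T u v).
Proof.
move=> T0 [mu' iu] Lv; have [mv iv] := Lq_control_loc Lv.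
have mc := measurable_concat_control T0 mu' mv.
apply/Lq_control_lty; split => //.
rewrite (ge0_integral_halfline_split T0 (measurable_powR_norm mc)); last first.
  by move=> t _; exact: powR_ge0.
have ic := (Lq_loc_concat T0 (conj mu' iu) (Lq_control_loc Lv)).2.
rewrite fine_IR// lte_add_pinfty ?ltry//.
have -> : (\int[mu]_(t in `[0%R, +oo[) (`|concat_control T u v (t + T)| `^ q)%:E =
    \int[mu]_(t in `[0%R, +oo[) (`|v t| `^ q)%:E)%E.
  apply: eq_integral => t; rewrite inE/= in_itv/= andbT => t0.
  by rewrite concat_control_shift.
by have /Lq_control_lty[] := Lv.
Qed.

End LqLoc.

(** * Coercivity of convex positive definite functions *)

Section Coercivity.
Context {R : realType} {n : nat}.
Implicit Types (F : 'cV[R]_n -> R).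

Lemma convex_on_spaceP F : convex_on_space F ->
  forall (l : R) (x y : 'cV[R]_n), 0 <= l -> l <= 1 ->
  F (l *: x + (1 - l) *: y) <= l * F x + (1 - l) * F y.
Proof.
move=> cF l x y l0 l1.
have := cF (Itv01 l0 l1) x y; rewrite !inE => /(_ I I); exact.
Qed.

Lemma positive_definite_ge0 F x : positive_definite F -> 0 <= F x.
Proof.
move=> [F0 Fpos]; have [->|x0] := eqVneq x 0; first by rewrite F0.
exact/ltW/Fpos.
Qed.

(** On the ray through [x], convexity and $F(0)=0$ give $F(x)\ge(|x|/e)F(ex/|x|)$, and $F$ has a
    positive minimum on the sphere of radius [e]. *)
Lemma convex_coercive F e : continuous F -> convex_on_space F ->
  positive_definite F -> 0 < e ->
  exists2 c, 0 < c & forall x, e <= `|x| -> c * `|x| <= F x.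
Proof.
move=> Fc /convex_on_spaceP cF Fpd e0; have [F0 Fpos] := Fpd.
pose S := [set x : 'cV[R]_n | `|x| = e].
have scale_S (x : 'cV[R]_n) : e <= `|x| -> S ((e / `|x|) *: x).
  move=> ex; have x0 : 0 < `|x| by rewrite (lt_le_trans e0).
  by rewrite /S /= normrZ ger0_norm ?divfK ?gt_eqF// divr_ge0// ltW.
(* If the sphere is empty, no vector has norm at least [e] and any constant will do; this covers
   dimension $0$. *)
have [[z Sz]|S0] := pselect (S !=set0); last first.
  exists 1 => // x /scale_S Sx; exfalso; apply: S0; by exists ((e / `|x|) *: x).
have cS : compact S.
  apply: subclosed_compact (@compact_cV_ball R n e) _; last by move=> x /= ->.
  have -> : S = (fun x => `|x|) @^-1` [set e] by [].
  apply: closed_comp; last exact: closed_eq.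
  by move=> x _; exact: norm_continuous.
have [s0] := compact_EVT_min (ex_intro _ z Sz) cS (continuous_subspaceT Fc).
rewrite inE /= => s0e sm.
have m0 : 0 < F s0 by apply: Fpos; rewrite -normr_gt0 s0e.
exists (F s0 / e); first by rewrite divr_gt0.
move=> x ex; have x0 : 0 < `|x| by rewrite (lt_le_trans e0).
have l1 : e / `|x| <= 1 by rewrite ler_pdivrMr// mul1r.
have l0 : 0 <= e / `|x| by rewrite divr_ge0// ltW.
have := cF _ x 0 l0 l1; rewrite scaler0 addr0 F0 mulr0 addr0 => H.
have H2 : F s0 <= F ((e / `|x|) *: x) by apply: sm; rewrite inE; exact: scale_S.
have : F s0 <= e / `|x| * F x by apply: le_trans H.
by rewrite mulrAC ler_pdivlMr// mulrAC ler_pdivrMr// mulrC [F x * e]mulrC.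
Qed.

(** Positive definiteness alone would let $F$ tend to $0$ at infinity; the linear growth coming from
    convexity excludes this. *)
Lemma small_value_small F e : continuous F -> convex_on_space F ->
  positive_definite F -> 0 < e ->
  exists2 r, 0 < r & forall x, F x <= r -> `|x| <= e.
Proof.
move=> Fc cF Fpd e0; have [c c0 Hc] := convex_coercive Fc cF Fpd e0.
exists (c * e / 2); first by rewrite divr_gt0// mulr_gt0.
move=> x Fx; rewrite leNgt; apply/negP => ex.
have := Hc x (ltW ex); have := mulr_gt0 c0 e0.
have : c * e <= c * `|x| by rewrite ler_wpM2l// ltW.
lra.
Qed.

End Coercivity.

(** * Finite-horizon costs and concatenation *)

Section Cost.
Context {R : realType} {n : nat}.
Variables (q : R) (q1 : 1 < q) (F : 'cV[R]_n -> R).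
Hypotheses (Fc : continuous F) (F0 : forall x, 0 <= F x).
Implicit Types (u v : R -> R) (T : R).

Definition running_cost (x0 : 'cV[R]_n) u s := `|u s| `^ q / q + F (trajectory x0 u s).

Let q0 : 0 < q. Proof. by rewrite (lt_trans ltr01). Qed.

Lemma running_cost_ge0 x0 u s : 0 <= running_cost x0 u s.
Proof. by rewrite addr_ge0// divr_ge0 ?powR_ge0// ltW. Qed.

Lemma locint_control_cost u : Lq_loc q u -> locint (fun s => `|u s| `^ q / q).
Proof.
move=> [_ iu]; apply: (eq_locint _ (locintZ q^-1 iu)) => t _; exact: mulrC.
Qed.

Lemma locint_F_traj (x0 : 'cV[R]_n) u : locint u -> locint (fun s => F (trajectory x0 u s)).
Proof. by move=> ui; apply: locint_cont0; exact: (cont0_comp (cont0_trajectory (x0 := x0) ui) Fc). Qed.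

Lemma locint_running_cost x0 u : Lq_loc q u -> locint (running_cost x0 u).
Proof.
move=> Lu; apply: locintD; first exact: locint_control_cost.
exact/locint_F_traj/(Lq_loc_locint q1).
Qed.

Lemma cost_ge0 x0 u : (0 <= cost q F x0 u)%E.
Proof. by apply: integral_ge0 => t _; rewrite lee_fin running_cost_ge0. Qed.

Lemma cost_split x0 u T : Lq_loc q u -> 0 <= T ->
  (cost q F x0 u = (IR (running_cost x0 u) T)%:E +
    cost q F (trajectory x0 u T) (fun s => (u (s + T))%R))%E.
Proof.
move=> Lu T0; have ui := Lq_loc_locint q1 Lu.
rewrite /cost (ge0_integral_halfline_split T0
  (locint_measurable (locint_running_cost x0 Lu))); last first.
  by move=> t _; exact: running_cost_ge0.
rewrite fine_IR; last exact: locint_running_cost.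
congr (_ + _)%E; apply: eq_integral => t; rewrite inE/= in_itv/= andbT => t0.
by rewrite /running_cost trajectory_shift.
Qed.

Lemma IR_running_cost_le x0 u T : Lq_loc q u -> 0 <= T ->
  ((IR (running_cost x0 u) T)%:E <= cost q F x0 u)%E.
Proof. by move=> Lu T0; rewrite (cost_split x0 Lu T0) leeDl// cost_ge0. Qed.

Lemma eq_cost x0 u v : locint u -> locint v -> (forall t, 0 <= t -> u t = v t) ->
  cost q F x0 u = cost q F x0 v.
Proof.
move=> ui vi uv; apply: eq_integral => t; rewrite inE/= in_itv/= andbT => t0.
have E : trajectory x0 u t = trajectory x0 v t.
  apply: (@trajectory_local _ _ x0 u v t ui vi _ t t0 (lexx t)) => s s0 _.
  exact: uv.
by rewrite (uv t t0) E.
Qed.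

Lemma trajectory_local_lt (x0 : 'cV[R]_n) u v T : locint u -> locint v ->
  (forall t, 0 <= t -> t < T -> u t = v t) ->
  forall t, 0 <= t -> t <= T -> trajectory x0 u t = trajectory x0 v t.
Proof.
move=> ui vi uv t t0 tT.
apply: (is_trajectory_eq ui vi (trajectoryP x0 ui) (trajectoryP x0 vi) _ t0 tT).
rewrite (@eq_IR_lt _ _ (fun=> 0)).
- by rewrite IR_cst ?mul0r// (le_trans t0).
- exact/locint_norm/locintB.
- exact: locint_cst.
- by move=> s s0 sT; rewrite uv// subrr normr0.
Qed.

Lemma running_cost_local_lt x0 u v T : Lq_loc q u -> Lq_loc q v ->
  (forall t, 0 <= t -> t < T -> u t = v t) ->
  IR (running_cost x0 u) T = IR (running_cost x0 v) T.
Proof.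
move=> Lu Lv uv; apply: eq_IR_lt; [exact: locint_running_cost..|move=> t t0 tT].
have E := trajectory_local_lt x0 (Lq_loc_locint q1 Lu) (Lq_loc_locint q1 Lv) uv t0 (ltW tT).
by rewrite /running_cost (uv t t0 tT) E.
Qed.

(** Hides the control, so that pieces of trajectories are composed through their durations, costs
    and end points alone. *)
Definition reach T (x0 : 'cV[R]_n) (c : R) (x1 : 'cV[R]_n) : Prop :=
  0 <= T /\ exists u, [/\ Lq_loc q u, trajectory x0 u T = x1 &
    IR (running_cost x0 u) T = c].

Lemma reach_concat T S x0 c x1 d x2 : reach T x0 c x1 -> reach S x1 d x2 ->
  reach (T + S) x0 (c + d) x2.
Proof.
move=> [T0 [u [Lu uT uc]]] [S0 [v [Lv vS vc]]]; split; first exact: addr_ge0.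
have ui := Lq_loc_locint q1 Lu; have vi := Lq_loc_locint q1 Lv.
have Lw := Lq_loc_concat T0 Lu Lv.
have wi := Lq_loc_locint q1 Lw.
have wu t : 0 <= t -> t < T -> concat_control T u v t = u t.
  by move=> _ tT; rewrite /concat_control tT.
have wT : trajectory x0 (concat_control T u v) T = x1.
  by rewrite (trajectory_local_lt x0 wi ui wu).
have tail : forall t, 0 <= t -> trajectory x0 (concat_control T u v) (t + T) =
    trajectory x1 v t.
  move=> t t0; rewrite -(trajectory_shift x0 wi T0 t0) wT.
  apply: (@trajectory_local _ _ _ _ _ t) => //; first exact: locint_shift.
  by move=> s s0 _; rewrite concat_control_shift.
exists (concat_control T u v); split => //.
  by rewrite addrC tail.
have := IR_shift (locint_running_cost x0 Lw) T0 S0.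
rewrite (@eq_IR _ _ (running_cost x1 v)); last first.
  by move=> s s0 sS; rewrite /running_cost concat_control_shift// tail.
rewrite vc (running_cost_local_lt x0 Lw Lu wu) uc => ->; ring.
Qed.

Lemma value_le_cost x0 u : Lq_control q u -> (value_function q F x0 <= cost q F x0 u)%E.
Proof. by move=> Lu; apply: ge_ereal_inf; exists (cost q F x0 u) => //; exists u. Qed.

(** The half of dynamic programming that needs no optimal control: any admissible control from [x1]
    may follow the given piece. *)
Lemma value_reach T x0 c x1 : reach T x0 c x1 ->
  (value_function q F x0 <= c%:E + value_function q F x1)%E.
Proof.
move=> [T0 [u [Lu uT uc]]]; rewrite -leeBlDl//; apply/ereal_infP => _ [v Lv <-].
rewrite leeBlDl//; have Lw := Lq_control_concat q1 T0 Lu Lv.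
apply: (le_trans (value_le_cost x0 Lw)).
have Lw' := Lq_control_loc q1 Lw.
have ui := Lq_loc_locint q1 Lu; have wi := Lq_loc_locint q1 Lw'.
have vi := Lq_loc_locint q1 (Lq_control_loc q1 Lv).
have wu t : 0 <= t -> t < T -> concat_control T u v t = u t.
  by move=> _ tT; rewrite /concat_control tT.
have xT : trajectory x0 (concat_control T u v) T = x1.
  by rewrite (trajectory_local_lt x0 wi ui wu T0 (lexx T)).
have tE : cost q F x1 (fun s => concat_control T u v (s + T)) = cost q F x1 v.
  apply: eq_cost => [||s s0]; [exact: locint_shift|exact: vi|].
  exact: concat_control_shift.
by rewrite (cost_split x0 Lw' T0) (running_cost_local_lt x0 Lw' Lu wu) uc xT tE.
Qed.

Lemma reach_initial x0 u T : Lq_loc q u -> 0 <= T ->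
  reach T x0 (IR (running_cost x0 u) T) (trajectory x0 u T).
Proof. by move=> Lu T0; split => //; exists u. Qed.

(** The minimum of $F$ along the trajectory is at most its mean over $[0,T]$. *)
Lemma exists_small_F x0 u T c : Lq_loc q u -> 0 < T ->
  IR (running_cost x0 u) T <= c ->
  exists2 t, 0 <= t <= T & F (trajectory x0 u t) <= c / T.
Proof.
move=> Lu T0 uc; have ui := Lq_loc_locint q1 Lu.
have xc := cont0_comp (cont0_trajectory (x0 := x0) ui) Fc.
have [t] := EVT_min (ltW T0) (continuous_subspaceT xc).
rewrite in_itv/= => /andP[t0 tT] tm; exists t; first by rewrite t0.
rewrite ler_pdivlMr// (le_trans _ uc)// -IR_cst ?(ltW T0)//.
apply: le_IR; [exact: locint_cst|exact: locint_running_cost|move=> s s0 sT].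
have := tm s; rewrite in_itv/= s0 sT => /(_ isT); rewrite /= !max_l// => /le_trans; apply.
by rewrite lerDr divr_ge0 ?powR_ge0// ltW.
Qed.

(** From $|u|\le1+|u|^q\le1+q(|u|^q/q+F)$. A bound on the cost thereby bounds the control in $L^1$,
    hence the trajectory. *)
Lemma IR_norm_control x0 u T c : Lq_loc q u -> 0 <= T ->
  IR (running_cost x0 u) T <= c -> IR (fun s => `|u s|) T <= T + q * c.
Proof.
move=> Lu T0 uc; have ui := Lq_loc_locint q1 Lu.
have ic := locint_running_cost x0 Lu.
apply: (@le_trans _ _ (IR (fun s => 1 + q * running_cost x0 u s) T)).
  apply: le_IR.
  - exact: locint_norm.
  - by apply: locintD; [exact: locint_cst|exact: locintZ].
  move=> s _ _; rewrite (le_trans (ler_norm_powR q1 _))// lerD2l /running_cost mulrDr.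
  by rewrite mulrC divfK ?gt_eqF// lerDl mulr_ge0// ltW.
rewrite IRD; [|exact: locint_cst|exact: locintZ].
by rewrite IR_cst// mul1r IRZ// lerD2l ler_wpM2l// ltW.
Qed.

End Cost.

(** * Verification: comparison of the value with a solution of the HJB equation *)

Section Verification.
Context {R : realType} {n : nat}.
Variables (q : R) (q1 : 1 < q) (F : 'cV[R]_n -> R).
Hypotheses (Fc : continuous F) (cF : convex_on_space F) (Fpd : positive_definite F).
Variable (V : 'cV[R]_n -> R).
Hypotheses (cV : C1 V) (Vpd : positive_definite V) (hjbV : HJB_solution q F V).
Implicit Types (u v : R -> R) (T : R).

Let q0 : 0 < q. Proof. by rewrite (lt_trans ltr01). Qed.
Let F0 x : 0 <= F x. Proof. exact: positive_definite_ge0. Qed.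
Let V0 x : 0 <= V x. Proof. exact: positive_definite_ge0. Qed.

Lemma hjb_gapE (x : 'cV[R]_n) (a : R) :
  `|a| `^ q / q + F x + (drift_part V x + partial_last V x * a) =
  young_gap q a (partial_last V x).
Proof.
have := hjbV x; rewrite -/(drift_part V x) /young_gap.
move: (drift_part V x) (partial_last V x) => d p.
move: (_ * _ `^ _) => w; lra.
Qed.

Lemma locint_chain_integrand (x0 : 'cV[R]_n) u : locint u ->
  locint (fun s => drift_part V (trajectory x0 u s) +
                   partial_last V (trajectory x0 u s) * u s).
Proof.
move=> ui; have xc := cont0_trajectory (x0 := x0) ui; apply: locintD.
  by apply: locint_cont0; exact: (cont0_comp xc (C1_drift_part cV)).
by apply: locintM => //; exact: (cont0_comp xc (C1_partial_last cV)).
Qed.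

Lemma locint_young_gap (x0 : 'cV[R]_n) u : Lq_loc q u ->
  locint (fun s => young_gap q (u s) (partial_last V (trajectory x0 u s))).
Proof.
move=> Lu; have ui := Lq_loc_locint q1 Lu.
apply: eq_locint (locintD (locint_running_cost q1 Fc x0 Lu)
  (locint_chain_integrand x0 ui)) => t _.
exact: hjb_gapE.
Qed.

Lemma hjb_identity x0 u T : Lq_loc q u -> 0 <= T ->
  IR (running_cost q F x0 u) T = V x0 - V (trajectory x0 u T) +
    IR (fun s => young_gap q (u s) (partial_last V (trajectory x0 u s))) T.
Proof.
move=> Lu T0; have ui := Lq_loc_locint q1 Lu.
have H := chain_rule cV ui (trajectoryP x0 ui) T0.
have -> : IR (fun s => young_gap q (u s) (partial_last V (trajectory x0 u s))) T =
    IR (running_cost q F x0 u) T + IR (fun s => drift_part V (trajectory x0 u s) +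
                   partial_last V (trajectory x0 u s) * u s) T.
  rewrite -IRD; [|exact: locint_running_cost|exact: locint_chain_integrand].
  by apply: eq_IR => s _ _; rewrite -hjb_gapE.
by rewrite H; ring.
Qed.

Lemma hjb_dissipation x0 u T : Lq_loc q u -> 0 <= T ->
  V x0 - V (trajectory x0 u T) <= IR (running_cost q F x0 u) T.
Proof.
move=> Lu T0; rewrite hjb_identity// lerDl; apply: IR_ge0 => s _ _.
exact: young_gap_ge0.
Qed.

Lemma V_small e : 0 < e -> exists2 d, 0 < d & forall x, `|x| <= d -> V x <= e.
Proof.
move=> e0; have [d d0 Hd] := compact_unif_continuous (@compact_cV_ball R n 0)
  (C1_continuous cV) e0.
exists d => // x xd; have := Hd 0 x; rewrite /= normr0 sub0r normrN => /(_ (lexx 0) xd).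
by rewrite (proj1 Vpd) sub0r normrN; apply: le_trans; exact: ler_norm.
Qed.

Lemma hjb_le_cost x0 u : Lq_control q u -> ((V x0)%:E <= cost q F x0 u)%E.
Proof.
move=> Lu; have Lu' := Lq_control_loc q1 Lu.
have := cost_ge0 q1 F0 x0 u; case E : (cost q F x0 u) => [J| |]//; last by rewrite !leey.
rewrite !lee_fin => J0; apply/ler_addgt0Pr => e e0.
have [d d0 Vd] := V_small e0.
have [r r0 Fr] := small_value_small Fc cF Fpd d0.
(* With this horizon the mean of $F$ is at most $Jr/(J+1)\le r$; the $1$ keeps the horizon positive
   when $J=0$. *)
have T0 : 0 < (J + 1) / r by rewrite divr_gt0//; lra.
have JT t : 0 <= t -> IR (running_cost q F x0 u) t <= J.
  by move=> t0; rewrite -lee_fin -E; exact: IR_running_cost_le.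
have [t /andP[t0 tT] Ft] := exists_small_F q1 Fc Lu' T0 (JT _ (ltW T0)).
have xt : F (trajectory x0 u t) <= r.
  rewrite (le_trans Ft)// invf_div mulrCA ler_piMr ?(ltW r0)//.
  by rewrite ler_pdivrMr; lra.
have := hjb_dissipation x0 Lu' t0; have := JT _ t0; have := Vd _ (Fr _ xt).
lra.
Qed.

Lemma trajectory_displacement (x0 : 'cV[R]_n) u h b : locint u -> 0 <= h -> 0 <= b ->
  (forall s, 0 <= s -> s <= h -> `|u s| <= b /\ `|trajectory x0 u s| <= b) ->
  `|trajectory x0 u h - x0| <= b * h.
Proof.
move=> ui h0 b0 H; have /is_trajectoryP[xc xE] := trajectoryP x0 ui.
apply: cV_norm_le => [|i]; first exact: mulr_ge0.
rewrite !mxE xE// addrAC subrr add0r.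
have ci : locint (fun s => chain_coord (trajectory x0 u s) (u s) i.+1).
  exact: locint_chain_coord.
rewrite (le_trans (le_norm_IR _ ci))// -IR_cst//.
apply: le_IR; [exact: locint_norm|exact: locint_cst|move=> s s0 sh].
have [ub xb] := H s s0 sh.
rewrite /chain_coord; case: insub => //= j.
by rewrite (le_trans (cV_coord_le _ _)).
Qed.

Lemma young_gap_perturb (a p p' : R) :
  young_gap q a p' - young_gap q a p = (p' - p) * a +
    ((q - 1) / q * `|p'| `^ (q / (q - 1)) - (q - 1) / q * `|p| `^ (q / (q - 1))).
Proof. by rewrite /young_gap; ring. Qed.

(* Holding the value of the optimal feedback at the initial point for a short
   time makes the gap in the HJB identity small, uniformly on compact sets. *)
Lemma sample_and_hold_step M e : 0 <= M -> 0 < e -> exists2 h0, 0 < h0 &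
  forall h x, 0 <= h -> h <= h0 -> `|x| <= M ->
  exists c y, reach q F h x c y /\ c + V y <= V x + e * h.
Proof.
move=> M0 e0.
pose p := partial_last V.
have pc : continuous p by exact: C1_partial_last.
pose w (a : R) : R := hamilton_argmin q a.
have wpc : continuous (w \o p).
  move=> x; apply: continuous_comp; first exact: pc.
  have q10 : 0 < 1 / (q - 1) by rewrite divr_gt0// subr_gt0.
  by apply: cvgN; exact: (continuous_signed_pow q10).
pose psi (a : R) : R := (q - 1) / q * `|a| `^ (q / (q - 1)).
have psic : continuous (psi \o p).
  move=> x; apply: continuous_comp; first exact: pc.
  have q10 : 0 < q / (q - 1) by rewrite divr_gt0// subr_gt0.
  by apply: cvgM; [exact: cvg_cst|exact: (continuous_powR_norm q10)].
have [b b0 Hb] : exists2 b, 0 < b & forall x : 'cV[R]_n, `|x| <= M -> `|w (p x)| <= b.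
  have cK := continuous_compact (continuous_subspaceT wpc) (@compact_cV_ball R n M).
  have [b [_ Hb]] := compact_bounded cK.
  exists (Num.max 1 (b + 1)); first by rewrite lt_max ltr01.
  move=> x xM; apply: Hb; last by exists x.
  by rewrite lt_max; apply/orP; right; rewrite ltrDl.
(* In the perturbed gap the variation of $\partial V/\partial x_n$ is multiplied by the held
   control, of size at most [b]; this tolerance makes the product at most $e/2$. *)
have e1 : 0 < e / (2 * b) by rewrite divr_gt0// mulr_gt0.
have e2 : 0 < e / 2 by rewrite divr_gt0.
have [d1 d10 Hd1] := compact_unif_continuous (@compact_cV_ball R n M) pc e1.
have [d2 d20 Hd2] := compact_unif_continuous (@compact_cV_ball R n M) psic e2.
(* Bounds the velocity during the hold: up to time $1$ the state stays below $2^n(M+b)$ and the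
   control below $b$. The displacement is then at most $Bh\le d$. *)
pose B := 2 ^+ n * (M + b) + b.
have B0 : 0 < B by rewrite ltr_pwDr// mulr_ge0 ?exprn_ge0//; lra.
pose d := Num.min d1 d2.
have d0 : 0 < d by rewrite lt_min d10.
exists (Num.min 1 (d / B)); first by rewrite lt_min ltr01 divr_gt0.
move=> h x h0; rewrite le_min => /andP[h1 hd] xM.
pose a := w (p x).
have Ga : young_gap q a (p x) = 0 by exact: young_gap_argmin.
have ab : `|a| <= b by exact: Hb.
have uc : cont0 (fun _ : R => a) by move=> t; exact: cvg_cst.
have Lu := cont0_Lq_loc q1 uc; have ui := Lq_loc_locint q1 Lu.
exists (IR (running_cost q F x (fun=> a)) h), (trajectory x (fun=> a) h); split.
  exact: reach_initial.
have near_x s : 0 <= s -> s <= h -> `|trajectory x (fun=> a) s - x| <= d.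
  move=> s0 sh; apply: (@le_trans _ _ (B * s)); last first.
    by rewrite mulrC -ler_pdivlMr// (le_trans sh).
  apply: trajectory_displacement => //; first exact: ltW.
  move=> r r0 rs; split; first by rewrite (le_trans ab)// lerDr mulr_ge0 ?exprn_ge0//; lra.
  have r1 : r <= 1 by rewrite (le_trans rs)// (le_trans sh).
  rewrite (le_trans (is_trajectory_bound ui (trajectoryP x ui) r0 r1))//.
  rewrite IR_cst// mulr1 (_ : 1 + 1 = 2 :> R)//.
  apply: (@le_trans _ _ (2 ^+ n * (M + b))); last by rewrite lerDl ltW.
  by rewrite ler_wpM2l ?exprn_ge0// lerD.
rewrite hjb_identity// addrAC subrK lerD2l -IR_cst//.
apply: le_IR; [exact: locint_young_gap|exact: locint_cst|move=> s s0 sh].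
have := near_x s s0 sh; rewrite distrC le_min => /andP[n1 n2].
have := Hd1 x _ xM n1; have := Hd2 x _ xM n2; rewrite /= -/p.
move: (trajectory x (fun=> a) s) => y Hpsi Hp.
(* The gap vanishes at the sampling point, so the gap at [y] is only its variation. *)
have E : young_gap q a (p y) = (p y - p x) * a + (psi (p y) - psi (p x)).
  by rewrite -(young_gap_perturb a (p x) (p y)) Ga subr0.
have H1 : (p y - p x) * a <= e / 2.
  rewrite (le_trans (ler_norm _))// normrM distrC.
  have -> : e / 2 = e / (2 * b) * b by field; rewrite gt_eqF.
  by rewrite ler_pM.
have H2 : psi (p y) - psi (p x) <= e / 2.
  by rewrite distrC in Hpsi; exact: le_trans (ler_norm _) Hpsi.
have := lerD H1 H2; rewrite -(splitr e) -E; exact.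
Qed.

Lemma reach_bound T t x0 c y : 0 <= t -> t <= T -> reach q F t x0 c y ->
  `|y| <= (1 + T) ^+ n * (`|x0| + (T + q * c)).
Proof.
move=> t0 tT [_ [u [Lu <- uc]]].
have ui := Lq_loc_locint q1 Lu.
have := is_trajectory_bound ui (trajectoryP x0 ui) t0 (lexx t).
move=> /le_trans; apply; apply: ler_pM.
- by rewrite exprn_ge0//; lra.
- by rewrite addr_ge0// IR_ge0.
- by rewrite lerXn2r ?nnegrE//; lra.
have uc' : IR (running_cost q F x0 u) t <= c by rewrite uc.
by have := IR_norm_control q1 Fc F0 Lu t0 uc'; lra.
Qed.

(** The sampling step depends on a ball that must contain all sampled states. The invariant
    $c+V(y)\le V(x_0)+e\,t$ provides it: with $eT\le1$ and $V\ge0$ the cost so far is at most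
    $V(x_0)+1$, and [reach_bound] then gives a radius [M] independent of the number of steps. *)
Lemma closed_loop_approx T e x0 : 0 < T -> 0 < e -> e * T <= 1 ->
  exists c y, reach q F T x0 c y /\ c + V y <= V x0 + e * T.
Proof.
move=> T0 e0 eT.
pose M := (1 + T) ^+ n * (`|x0| + (T + q * (V x0 + 1))).
have M0 : 0 <= M.
  have ? : 0 <= q * (V x0 + 1) by rewrite mulr_ge0 ?addr_ge0// ltW.
  have ? := normr_ge0 x0.
  by rewrite mulr_ge0 ?exprn_ge0//; lra.
have [h0 h00 Hh] := sample_and_hold_step M0 e0.
pose N := (Num.truncn (T / h0)).+1.
have N0 : 0 < N%:R :> R by rewrite ltr0n.
pose h := T / N%:R.
have hh : h <= h0.
  by rewrite ler_pdivrMr// mulrC -ler_pdivrMr// ltW// truncnS_gt.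
have hp : 0 <= h by rewrite divr_ge0// ltW.
have NT : N%:R * h = T by rewrite mulrC divfK// gt_eqF.
have key k : (k <= N)%N -> exists c y,
    reach q F (k%:R * h) x0 c y /\ c + V y <= V x0 + e * (k%:R * h).
  elim: k => [_|k IH kN].
    rewrite mul0r; exists 0, x0; split; last by rewrite mulr0 add0r addr0.
    split => //; exists (fun=> 0).
    have uc : cont0 (fun _ : R => 0 : R) by move=> t; exact: cvg_cst.
    have Lu := cont0_Lq_loc q1 uc; split => //; last exact: IR0.
    exact: trajectory0 (Lq_loc_locint q1 Lu).
  have [c [y [rc cy]]] := IH (ltnW kN).
  have kh0 : 0 <= k%:R * h by rewrite mulr_ge0.
  have khT : k%:R * h <= T by rewrite -NT ler_wpM2r// ler_nat ltnW.
  have ekh : e * (k%:R * h) <= e * T by rewrite ler_wpM2l// ltW.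
  have cV1 : c <= V x0 + 1 by have := V0 y; lra.
  have yM : `|y| <= M.
    rewrite (le_trans (reach_bound kh0 khT rc))// ler_wpM2l//.
      by rewrite exprn_ge0//; lra.
    by rewrite !lerD2l ler_wpM2l// ltW.
  have [d [z [rd dz]]] := Hh h y hp hh yM.
  exists (c + d), z; split; last first.
    by rewrite -natr1 mulrDl mul1r mulrDr; lra.
  rewrite -natr1 mulrDl mul1r.
  exact: (reach_concat q1 Fc rc rd).
by have := key N (leqnn N); rewrite NT.
Qed.

(** The sampled control is followed only up to a time when $F$ is small; there the state is near the
    origin, and the hypothesis bounds the cost still to be paid. *)
Lemma value_le_hjb x0 :
  (forall e, 0 < e -> exists2 d, 0 < d &
     forall x, `|x| <= d -> (value_function q F x <= e%:E)%E) ->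
  (value_function q F x0 <= (V x0)%:E)%E.
Proof.
move=> small; apply/lee_addgt0Pr => e e0.
have e20 : 0 < e / 2 by rewrite divr_gt0.
have [d d0 Hd] := small _ e20.
have [r r0 Fr] := small_value_small Fc cF Fpd d0.
have VT : 0 < V x0 + 1 by have := V0 x0; lra.
(* Since the cost [c] is at most $V(x_0)+1$, the mean of $F$ over $[0,T]$ is at most [r]. *)
pose T := (V x0 + 1) / r.
have T0 : 0 < T by rewrite divr_gt0.
(* Total excess allowed to the sampling, at rate $m/T$: at most $e/2$ for the conclusion, and at
   most $1$ for the bound on the cost. *)
pose m := Num.min 1 (e / 2).
have m0 : 0 < m by rewrite lt_min ltr01.
have m1 : m <= 1 by rewrite ge_min lexx.
have m2 : m <= e / 2 by rewrite ge_min lexx orbT.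
have mT : m / T * T = m by rewrite divfK// gt_eqF.
have [||c [y [[_ [u [Lu uT uc]]] cy]]] := @closed_loop_approx T (m / T) x0 T0.
- by rewrite divr_gt0.
- by rewrite mT.
rewrite mT in cy; have Vy := V0 y.
have cle : IR (running_cost q F x0 u) T <= c by rewrite uc.
have [t /andP[t0 tT] Ft] := exists_small_F q1 Fc Lu T0 cle.
have cT : c / T <= r.
  have -> : r = (V x0 + 1) / T by rewrite /T invf_div mulrCA divff ?mulr1// gt_eqF.
  by rewrite ler_pM2r ?invr_gt0//; lra.
have xt := Hd _ (Fr _ (le_trans Ft cT)).
apply: (le_trans (value_reach q1 Fc F0 (reach_initial F x0 Lu t0))).
have ct : IR (running_cost q F x0 u) t <= c.
  rewrite -uc; apply: IR_incr_ge0 => //; first exact: locint_running_cost.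
  by move=> s _ _; exact: running_cost_ge0.
apply: (@le_trans _ _ (c%:E + (e / 2)%:E)%E); first by rewrite leeD// lee_fin.
by rewrite -!EFinD lee_fin; lra.
Qed.

End Verification.

(** * Existence and uniqueness of minimizers *)

Section AlmostEverywhereLimits.
Context {R : realType}.
Notation mu := (@lebesgue_measure R).
Notation halfline := (`[0, +oo[%classic : set (measurableTypeR R)).

Lemma fatou_ae (D : set (measurableTypeR R)) (f_ : nat -> R -> R) (f : R -> R)
    (c : \bar R) : measurable D ->
  (forall k, measurable_fun D (f_ k)) -> measurable_fun D f ->
  (forall k t, D t -> 0 <= f_ k t) ->
  {ae mu, forall t, D t -> f_ k t @[k --> \oo] --> f t} ->
  (forall k, (\int[mu]_(t in D) (f_ k t)%:E <= c)%E) ->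
  (\int[mu]_(t in D) (f t)%:E <= c)%E.
Proof.
move=> mD mf_ mf f0 fcvg fc.
have -> : (\int[mu]_(t in D) (f t)%:E =
    \int[mu]_(t in D) limn_einf (fun k => (f_ k t)%:E))%E.
  apply: ae_eq_integral => //.
  - exact/measurable_EFinP.
  - rewrite (_ : (fun t => _) =
        (fun t => - limn_esup (fun k => - (f_ k t)%:E))%E); last first.
      apply/funext => t; rewrite -limn_einfN; congr limn_einf.
      by apply/funext => k /=; rewrite opprK.
    apply: measurableT_comp => //; apply: measurable_fun_limn_esup => k.
    by apply: measurableT_comp => //; exact/measurable_EFinP.
  apply: filterS fcvg => t H Dt; have {}H := H Dt.
  have : (f_ k t)%:E @[k --> \oo] --> (f t)%:E.
    by apply: cvg_EFin => //; exact: nearW.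
  by move=> /cvg_limn_einf_sup ->.
have H := @fatou _ _ _ mu D mD (fun k t => (f_ k t)%:E).
apply: le_trans (H _ _) _; first by move=> k; exact/measurable_EFinP.
  by move=> k t Dt; rewrite lee_fin f0.
rewrite limn_einf_lim; apply: lime_le; first exact: is_cvg_einfs.
apply: nearW => k; apply: le_trans (fc k); apply: ereal_inf_lbound.
by exists k => /=.
Qed.

(** The series of $|u_{k+1}-u_k|$ has integral at most $2(N+1)$ over $[0,N]$, so it is finite almost
    everywhere there, and the telescoping series converges absolutely. Countably many $N$ exhaust
    the half-line. *)
Lemma fast_cauchy_cvg_ae (u_ : nat -> R -> R) : (forall k, locint (u_ k)) ->
  (forall k T, 0 <= T -> IR (fun s => `|u_ k.+1 s - u_ k s|) T <= 2^-1 ^+ k * (T + 1)) ->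
  {ae mu, forall t, 0 <= t -> cvgn (fun k => u_ k t)}.
Proof.
move=> ui uD.
have di k : locint (fun s => `|u_ k.+1 s - u_ k s|) by exact/locint_norm/locintB.
pose S t : \bar R := (\sum_(0 <= k <oo) (`|u_ k.+1 t - u_ k t|)%:E)%E.
have Sfin N : {ae mu, forall t, `[0, N%:R]%classic t -> S t \is a fin_num}.
  apply: integrable_ae => //.
  have md k : measurable_fun (`[0, N%:R] : set (measurableTypeR R))
      (fun t => (`|u_ k.+1 t - u_ k t|)%:E).
    exact: (measurable_int _ (di k N%:R)).
  have Sge t : (0 <= S t)%E by apply: nneseries_ge0.
  apply/integrableP; split.
    by apply: ge0_emeasurable_sum => // k _; exact: md.
  under eq_integral do rewrite gee0_abs//.
  rewrite /S integral_nneseries//.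
  apply: (@le_lt_trans _ _ (2 * (N%:R + 1))%:E); last exact: ltry.
  apply: lime_le; first by apply: is_cvg_nneseries => k _ _; apply: integral_ge0.
  apply: nearW => m.
  apply: (@le_trans _ _ (\sum_(0 <= k < m) ((2^-1 ^+ k * (N%:R + 1))%:E))%E).
    apply: lee_sum => k _; rewrite fine_IR// lee_fin; exact: uD.
  rewrite sumEFin lee_fin -mulr_suml ler_wpM2r ?addr_ge0//.
  rewrite big_mkord; have := subrX1 (2^-1 : R) m.
  set s := \sum_(i < m) _; have : 0 <= (2^-1 : R) ^+ m by rewrite exprn_ge0// invr_ge0.
  by move: (2^-1 ^+ m) => z; lra.
have {}Sfin := ae_foralln Sfin.
apply: filterS Sfin => t H t0.
have tN : `[0, ((Num.truncn t).+1)%:R]%classic t.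
  by rewrite /= in_itv/= t0/= ltW// truncnS_gt.
have {tN} := H _ tN => Sf.
have cs : cvgn [normed series (telescope (u_^~ t))].
  apply: nondecreasing_is_cvgn.
    by apply: nondecreasing_series => *; exact: normr_ge0.
  exists (fine (S t)) => _ [m _ <-].
  rewrite -lee_fin fineK// /series /= -sumEFin /telescope.
  by apply: nneseries_lim_ge => k _ _; rewrite lee_fin.
have := normed_cvg cs; rewrite telescopeK => /= c1.
have c2 : cvgn (fun k => u_ k t - u_ 0%N t + u_ 0%N t).
  by apply: is_cvgD; [exact: c1|exact: is_cvg_cst].
by rewrite (_ : (fun k => u_ k t) = (fun k => u_ k t - u_ 0%N t + u_ 0%N t))//;
  apply/funext => k; rewrite subrK.
Qed.

(** The upper limit is measurable whether or not the sequence converges, and agrees with the limit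
    where it exists; [fine] gives infinite upper limits the value $0$. *)
Definition esup_limit (u_ : nat -> R -> R) (t : R) : R :=
  fine (limn_esup (fun k => (u_ k t)%:E)).

Lemma measurable_esup_limit (u_ : nat -> R -> R) :
  (forall k, measurable_fun halfline (u_ k)) ->
  measurable_fun halfline (esup_limit u_).
Proof.
move=> um; apply: (@measurableT_comp _ _ _ _ _ _ fine).
  exact: fine_measurable.
by apply: measurable_fun_limn_esup => k; exact/measurable_EFinP.
Qed.

Lemma cvg_esup_limit (u_ : nat -> R -> R) t : cvgn (fun k => u_ k t) ->
  u_ k t @[k --> \oo] --> esup_limit u_ t.
Proof.
move=> c; have : (u_ k t)%:E @[k --> \oo] --> (limn (fun k => u_ k t))%:E.
  by apply: cvg_EFin => //; exact: nearW.
by move=> /cvg_limn_einf_sup[_ E]; rewrite /esup_limit E.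
Qed.

End AlmostEverywhereLimits.

Section HalfLineErealIntegral.
Context {R : realType}.
Notation mu := (@lebesgue_measure R).
Notation halfline := (`[0, +oo[%classic : set (measurableTypeR R)).
Notation Ih f := (\int[mu]_(t in `[0%R, +oo[) (f t)%:E)%E.
Implicit Types (f g : R -> R).

Lemma Ih_lin (a b : R) f g : 0 <= a -> 0 <= b ->
  measurable_fun halfline f -> measurable_fun halfline g ->
  (forall t, 0 <= t -> 0 <= f t) -> (forall t, 0 <= t -> 0 <= g t) ->
  (Ih (fun t => a * f t + b * g t)%R = a%:E * Ih f + b%:E * Ih g)%E.
Proof.
move=> a0 b0 mf mg f0 g0.
have mI : measurable halfline by exact: measurable_itv.
have f0' t : halfline t -> (0 <= (f t)%:E)%E.
  by rewrite /= in_itv/= andbT lee_fin; exact: f0.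
have g0' t : halfline t -> (0 <= (g t)%:E)%E.
  by rewrite /= in_itv/= andbT lee_fin; exact: g0.
rewrite -(ge0_integralZl_EFin mu mI f0' _ a0); last exact/measurable_EFinP.
rewrite -(ge0_integralZl_EFin mu mI g0' _ b0); last exact/measurable_EFinP.
rewrite -ge0_integralD//.
- by move=> t /f0'; exact: mule_ge0.
- by apply: measurable_funeM; exact/measurable_EFinP.
- by move=> t /g0'; exact: mule_ge0.
- by apply: measurable_funeM; exact/measurable_EFinP.
Qed.

Lemma Ih_add f g :
  measurable_fun halfline f -> measurable_fun halfline g ->
  (forall t, 0 <= t -> 0 <= f t) -> (forall t, 0 <= t -> 0 <= g t) ->
  (Ih (fun t => f t + g t)%R = Ih f + Ih g)%E.
Proof.
move=> mf mg f0 g0; have := Ih_lin ler01 ler01 mf mg f0 g0.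
rewrite !mul1e => <-; apply: eq_integral => t _; by rewrite !mul1r.
Qed.

Lemma le_Ih f g : measurable_fun halfline f -> measurable_fun halfline g ->
  (forall t, 0 <= t -> 0 <= f t) -> (forall t, 0 <= t -> f t <= g t) ->
  (Ih f <= Ih g)%E.
Proof.
move=> mf mg f0 fg; apply: ge0_le_integral => //.
- by move=> t; rewrite /= in_itv/= andbT lee_fin; exact: f0.
- exact/measurable_EFinP.
- exact/measurable_EFinP.
- by move=> t; rewrite /= in_itv/= andbT lee_fin; exact: fg.
Qed.

End HalfLineErealIntegral.

Section Minimizers.
Context {R : realType} {n : nat}.
Variables (q : R) (q1 : 1 < q) (F : 'cV[R]_n -> R).
Hypotheses (Fc : continuous F) (F0 : forall x, 0 <= F x).
Hypothesis (cF : forall (l : R) (x y : 'cV[R]_n), 0 <= l -> l <= 1 ->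
  F (l *: x + (1 - l) *: y) <= l * F x + (1 - l) * F y).
Notation mu := (@lebesgue_measure R).
Notation halfline := (`[0, +oo[%classic : set (measurableTypeR R)).
Notation Ih f := (\int[mu]_(t in `[0%R, +oo[) (f t)%:E)%E.
Implicit Types (u v : R -> R) (T : R).

Let q0 : 0 < q. Proof. by rewrite (lt_trans ltr01). Qed.

Lemma running_cost_convex (l : R) (x0 y0 : 'cV[R]_n) u v t :
  locint u -> locint v -> 0 <= l -> l <= 1 -> 0 <= t ->
  running_cost q F (l *: x0 + (1 - l) *: y0) (fun t => l * u t + (1 - l) * v t) t <=
  `|l * u t + (1 - l) * v t| `^ q / q +
  (l * F (trajectory x0 u t) + (1 - l) * F (trajectory y0 v t)).
Proof.
move=> ui vi l0 l1 t0; rewrite /running_cost (trajectory_lin _ _ _ _ ui vi t0).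
by rewrite lerD2l cF.
Qed.

(** Defect of midpoint convexity of $|\cdot|^q/q$. The midpoint is written with weights $2^{-1}$ and
    $1-2^{-1}$, the form of the general convexity inequality. *)
Definition midpoint_gap u v t :=
  ((`|u t| `^ q + `|v t| `^ q) / 2 - `|2^-1 * u t + (1 - 2^-1) * v t| `^ q) / q.

Lemma midpoint_gap_ge0 u v t : 0 <= midpoint_gap u v t.
Proof.
rewrite divr_ge0 ?(ltW q0)// subr_ge0.
have -> : 2^-1 * u t + (1 - 2^-1) * v t = (u t + v t) / 2 by field.
exact: powR_midpoint_le.
Qed.

Lemma measurable_midpoint_gap u v : measurable_fun halfline u ->
  measurable_fun halfline v -> measurable_fun halfline (midpoint_gap u v).
Proof.
move=> mu' mv; apply: measurable_funM => //; apply: measurable_funB.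
  by apply: measurable_funM => //; apply: measurable_funD; exact: measurable_powR_norm.
by apply: measurable_powR_norm; exact: measurable_fun_lin.
Qed.

(** The midpoint control costs at least [m], while by convexity of $F$ its cost plus the integrated
    gap is at most the mean of the two costs, hence at most $m+e$. *)
Lemma midpoint_gap_integral x0 u v m e : value_function q F x0 = m%:E ->
  Lq_control q u -> Lq_control q v ->
  (cost q F x0 u <= (m + e)%:E)%E -> (cost q F x0 v <= (m + e)%:E)%E ->
  (Ih (midpoint_gap u v) <= e%:E)%E.
Proof.
move=> Vm Lu Lv Ju Jv.
have Lu' := Lq_control_loc q1 Lu; have Lv' := Lq_control_loc q1 Lv.
have ui := Lq_loc_locint q1 Lu'; have vi := Lq_loc_locint q1 Lv'.
pose w t := 2^-1 * u t + (1 - 2^-1) * v t.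
have Lw : Lq_control q w by exact: Lq_control_lin.
have Jw : (m%:E <= cost q F x0 w)%E by rewrite -Vm; exact: value_le_cost.
have mr z : Lq_loc q z -> measurable_fun halfline (running_cost q F x0 z).
  by move=> Lz; apply: locint_measurable; exact: locint_running_cost.
have mru := mr _ Lu'; have mrv := mr _ Lv'; have mrw := mr _ (Lq_control_loc q1 Lw).
have mg := measurable_midpoint_gap Lu'.1 Lv'.1.
have rc0 z t : 0 <= t -> 0 <= running_cost q F x0 z t by move=> _; exact: running_cost_ge0.
have g0 t : 0 <= t -> 0 <= midpoint_gap u v t by move=> _; exact: midpoint_gap_ge0.
have half0 : 0 <= 2^-1 :> R by rewrite invr_ge0.
have key : (Ih (running_cost q F x0 w) + Ih (midpoint_gap u v) <=
    (2^-1)%:E * Ih (running_cost q F x0 u) + (2^-1)%:E * Ih (running_cost q F x0 v))%E.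
  have E1 := Ih_add mrw mg (rc0 w) g0.
  have E2 := Ih_lin half0 half0 mru mrv (rc0 u) (rc0 v).
  rewrite -[X in (X <= _)%E]E1 -[X in (_ <= X)%E]E2.
  apply: le_Ih; [exact: measurable_funD|exact: measurable_fun_lin| |].
    by move=> t t0; apply: addr_ge0; [exact: rc0|exact: g0].
  move=> t t0; have l1 : 2^-1 <= 1 :> R by lra.
  have := running_cost_convex x0 x0 ui vi half0 l1 t0.
  have -> : 2^-1 *: x0 + (1 - 2^-1) *: x0 = x0.
    by rewrite -scalerDl addrC subrK scale1r.
  rewrite -/w => H.
  apply: (@le_trans _ _ (`|w t| `^ q / q + (2^-1 * F (trajectory x0 u t) +
    (1 - 2^-1) * F (trajectory x0 v t)) + midpoint_gap u v t)).
    by rewrite lerD2r.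
  rewrite /midpoint_gap -/(w t) /running_cost.
  move: (F (trajectory x0 u t)) (F (trajectory x0 v t)) => a b.
  move: (`|u t| `^ q) (`|v t| `^ q) (`|w t| `^ q) => c d f.
  by rewrite le_eqVlt; apply/orP; left; apply/eqP; field; rewrite gt_eqF.
rewrite -(@leeD2lE _ m%:E)//.
apply: (@le_trans _ _ (Ih (running_cost q F x0 w) + Ih (midpoint_gap u v))%E).
  by rewrite leeD2r.
apply: (le_trans key).
apply: (@le_trans _ _ ((2^-1)%:E * (m + e)%:E + (2^-1)%:E * (m + e)%:E)%E).
  have half0' : (0 <= (2^-1 : R)%:E)%E by rewrite lee_fin.
  by apply: leeD; apply: (lee_wpmul2l half0'); [exact: Ju|exact: Jv].
by rewrite -!EFinM -!EFinD lee_fin; lra.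
Qed.

Lemma near_minimal_close x0 m d : value_function q F x0 = m%:E -> 0 < d ->
  exists2 e, 0 < e & forall u v, Lq_control q u -> Lq_control q v ->
  (cost q F x0 u <= (m + e)%:E)%E -> (cost q F x0 v <= (m + e)%:E)%E ->
  (Ih (fun t => `|u t - v t| `^ q)%R <= d%:E)%E.
Proof.
move=> Vm d0.
have m0 : 0 <= m.
  rewrite -lee_fin -Vm; apply/ereal_infP => _ [u _ <-]; exact: cost_ge0.
(* The integral of $|u|^q+|v|^q$ is at most $2q(m+1)$, so the part weighted by $d/A$ contributes at
   most $d/2$. The choice of [e] below makes the part weighted by $C$ at most $d/2$ as well. *)
pose A := 4 * q * (m + 1).
have A0 : 0 < A by rewrite !mulr_gt0// ltr_wpDl.
have dA : 0 < d / A by rewrite divr_gt0.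
have [C C0 HC] := powR_unif_convex q1 dA.
pose e := Num.min 1 (d / (2 * (C * q + 1))).
have Cq : 0 <= C * q by rewrite mulr_ge0// ltW.
have Cq1 : 0 < 2 * (C * q + 1) by lra.
have e0 : 0 < e by rewrite lt_min ltr01 divr_gt0.
have e1 : e <= 1 by rewrite ge_min lexx.
have e2 : e * (2 * (C * q + 1)) <= d.
  by rewrite -ler_pdivlMr// ge_min lexx orbT.
exists e => // u v Lu Lv Ju Jv.
have Lu' := Lq_control_loc q1 Lu; have Lv' := Lq_control_loc q1 Lv.
have Jg := midpoint_gap_integral Vm Lu Lv Ju Jv.
have mr z : Lq_loc q z -> measurable_fun halfline (running_cost q F x0 z).
  by move=> Lz; apply: locint_measurable; exact: locint_running_cost.
have mru := mr _ Lu'; have mrv := mr _ Lv'.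
have mg := measurable_midpoint_gap Lu'.1 Lv'.1.
have rc0 z t : 0 <= t -> 0 <= running_cost q F x0 z t by move=> _; exact: running_cost_ge0.
have g0 t : 0 <= t -> 0 <= midpoint_gap u v t by move=> _; exact: midpoint_gap_ge0.
pose rr t := running_cost q F x0 u t + running_cost q F x0 v t.
have mrr : measurable_fun halfline rr := measurable_funD mru mrv.
have rr0 t : 0 <= t -> 0 <= rr t by move=> t0; apply: addr_ge0; exact: rc0.
have dAq : 0 <= d / A * q by rewrite mulr_ge0// ltW.
apply: (@le_trans _ _ (Ih (fun t => d / A * q * rr t + C * q * midpoint_gap u v t)%R)).
  apply: le_Ih.
  - apply: measurable_powR_norm; apply: measurable_funB; [exact: Lu'.1|exact: Lv'.1].
  - exact: measurable_fun_lin.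
  - by move=> t _; exact: powR_ge0.
  move=> t t0; apply: (le_trans (HC (u t) (v t))); rewrite /midpoint_gap /rr.
  have -> : (u t + v t) / 2 = 2^-1 * u t + (1 - 2^-1) * v t by field.
  apply: lerD; last first.
    rewrite -mulrA; apply: ler_wpM2l => //.
    by rewrite [leRHS]mulrCA divff ?mulr1// gt_eqF.
  rewrite -[leRHS]mulrA; apply: ler_wpM2l; first exact: ltW.
  have hu := F0 (trajectory x0 u t); have hv := F0 (trajectory x0 v t).
  rewrite /running_cost.
  move: (F (trajectory x0 u t)) hu (F (trajectory x0 v t)) hv => a a0 b b0.
  move: (`|u t| `^ q) (`|v t| `^ q) => c f.
  have -> : q * (c / q + a + (f / q + b)) = c + f + q * (a + b).
    by field; rewrite gt_eqF.
  by rewrite lerDl mulr_ge0 ?addr_ge0// ltW.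
rewrite (Ih_lin dAq Cq mrr mg rr0 g0).
apply: (@le_trans _ _ ((d / A * q)%:E * ((m + e)%:E + (m + e)%:E) + (C * q)%:E * e%:E)%E).
  have dAq' : (0 <= (d / A * q)%:E)%E by rewrite lee_fin.
  have Cq' : (0 <= (C * q)%:E)%E by rewrite lee_fin.
  apply: leeD; last exact: (lee_wpmul2l Cq' Jg).
  apply: (lee_wpmul2l dAq').
  have E1 : (Ih rr = cost q F x0 u + cost q F x0 v)%E.
    exact: (Ih_add mru mrv (rc0 u) (rc0 v)).
  by rewrite E1; apply: leeD; [exact: Ju|exact: Jv].
rewrite -[leLHS]/((d / A * q * (m + e + (m + e)) + C * q * e)%:E) lee_fin.
have E1 : d / A * q * (4 * (m + 1)) = d by rewrite /A; field; rewrite !gt_eqF//; lra.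
have : d / A * q * (m + e + (m + e)) <= d / A * q * (2 * (m + 1)).
  by apply: ler_wpM2l => //; lra.
have := mulr_ge0 Cq (ltW e0).
move: E1 e2; move: (d / A * q) (C * q) => a b; lra.
Qed.

End Minimizers.

Section MinimizerExistence.
Context {R : realType} {n : nat}.
Variables (q : R) (q1 : 1 < q) (F : 'cV[R]_n -> R).
Hypotheses (Fc : continuous F) (F0 : forall x, 0 <= F x).
Hypothesis (cF : forall (l : R) (x y : 'cV[R]_n), 0 <= l -> l <= 1 ->
  F (l *: x + (1 - l) *: y) <= l * F x + (1 - l) * F y).
Notation mu := (@lebesgue_measure R).
Notation halfline := (`[0, +oo[%classic : set (measurableTypeR R)).
Notation Ih f := (\int[mu]_(t in `[0%R, +oo[) (f t)%:E)%E.
Implicit Types (u v : R -> R) (T : R).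

Let q0 : 0 < q. Proof. by rewrite (lt_trans ltr01). Qed.

(** The inequality $|a|\le1+|a|^q$, applied to $z/\eta$ and multiplied by $\eta$, turns the $L^q$
    bound into an $L^1$ bound on $[0,T]$ that is again linear in $\eta$. *)
Lemma IR_norm_le_Lq z eta T : Lq_control q z -> 0 < eta -> 0 <= T ->
  (Ih (fun t => `|z t| `^ q)%R <= (eta `^ q)%:E)%E ->
  IR (fun t => `|z t|) T <= eta * (T + 1).
Proof.
move=> Lz eta0 T0 zq; have Lz' := Lq_control_loc q1 Lz.
have zi := Lq_loc_locint q1 Lz'; have [mz iz] := Lz'.
have eq0 : 0 < eta `^ q by rewrite powR_gt0.
have pt (a : R) : `|a| <= eta + eta / eta `^ q * `|a| `^ q.
  have := ler_norm_powR q1 (a / eta); rewrite normrM normfV (gtr0_norm eta0).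
  rewrite powRM ?invr_ge0 ?(ltW eta0)// => H.
  have E : eta^-1 `^ q = (eta `^ q)^-1.
    by rewrite -[in LHS]powR_inv1 ?(ltW eta0)// -powRrM mulN1r powRN.
  move: H; rewrite E -(ler_pM2l eta0) mulrCA divff ?gt_eqF// mulr1 => /le_trans; apply.
  by rewrite mulrDr mulr1 lerD2l mulrCA mulrC.
apply: (@le_trans _ _ (IR (fun t => eta + eta / eta `^ q * `|z t| `^ q) T)).
  apply: le_IR => //; first exact: locint_norm.
  by apply: locintD; [exact: locint_cst|exact: locintZ].
rewrite IRD; [|exact: locint_cst|exact: locintZ].
rewrite IR_cst// IRZ// mulrDr mulr1 lerD2l.
have H : IR (fun t => `|z t| `^ q) T <= eta `^ q.
  rewrite -lee_fin; apply: le_trans zq.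
  rewrite (ge0_integral_halfline_split T0 (measurable_powR_norm q mz)); last first.
    by move=> t _; exact: powR_ge0.
  rewrite -fine_IR// leeDl//; apply: integral_ge0 => t _.
  by rewrite lee_fin powR_ge0.
apply: (@le_trans _ _ (eta / eta `^ q * eta `^ q)).
  by apply: ler_wpM2l => //; rewrite divr_ge0// ltW.
by rewrite divfK// gt_eqF.
Qed.

Lemma minimizing_sequence x0 m : value_function q F x0 = m%:E ->
  exists u_ : nat -> R -> R, [/\ forall k, Lq_control q (u_ k),
    forall j k, (k <= j)%N -> (cost q F x0 (u_ j) <= (m + 2^-1 ^+ k)%:E)%E &
    forall j k T, (k <= j)%N -> 0 <= T ->
      IR (fun s => `|u_ j s - u_ k s|) T <= 2^-1 ^+ k * (T + 1)].
Proof.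
move=> Vm.
have eta0 k : 0 < 2^-1 ^+ k :> R by rewrite exprn_gt0// invr_gt0.
have /choice [e_ He] k : exists e, 0 < e /\ forall u v,
    Lq_control q u -> Lq_control q v ->
    (cost q F x0 u <= (m + e)%:E)%E -> (cost q F x0 v <= (m + e)%:E)%E ->
    (Ih (fun t => `|u t - v t| `^ q)%R <= ((2^-1 ^+ k) `^ q)%:E)%E.
  have d0 : 0 < (2^-1 ^+ k) `^ q :> R by rewrite powR_gt0.
  by have [e e0 He] := near_minimal_close q1 Fc F0 cF Vm d0; exists e.
pose h i := Num.min (e_ i) (2^-1 ^+ i).
(* The tolerances [h i] need not decrease; their minimum up to [k] makes each term of the sequence
   meet all the earlier ones. *)
pose g k := \big[Num.min/1]_(i < k.+1) h i.
have g0 k : 0 < g k.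
  apply: lt_bigmin => // i _; rewrite lt_min eta0 andbT.
  by have [] := He i.
have gh j k : (k <= j)%N -> g j <= h k.
  move=> kj; rewrite -ltnS in kj.
  exact: (@bigmin_le_cond _ _ _ 1 (Ordinal kj) predT (fun i => h i)).
have /choice [u_ Hu] k : exists u, Lq_control q u /\ (cost q F x0 u <= (m + g k)%:E)%E.
  have : ereal_inf (cost q F x0 @` Lq_control q) \is a fin_num.
    by rewrite -/(value_function q F x0) Vm.
  move=> /(lb_ereal_inf_adherent (g0 k))[_ [u Lu <-]].
  rewrite -/(value_function q F x0) Vm => /ltW uc; by exists u.
have cle j k : (k <= j)%N -> (cost q F x0 (u_ j) <= (m + h k)%:E)%E.
  move=> kj; apply: le_trans (proj2 (Hu j)) _.
  by rewrite lee_fin lerD2l gh.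
exists u_; split.
- by move=> k; have [] := Hu k.
- move=> j k kj; apply: le_trans (cle j k kj) _.
  by rewrite lee_fin lerD2l ge_min lexx orbT.
move=> j k T kj T0.
have cle' i : (k <= i)%N -> (cost q F x0 (u_ i) <= (m + e_ k)%:E)%E.
  move=> ki; apply: le_trans (cle i k ki) _.
  by rewrite lee_fin lerD2l ge_min lexx.
have [e0 close] := He k.
have Lj := proj1 (Hu j); have Lk := proj1 (Hu k).
have H := close _ _ Lj Lk (cle' j kj) (cle' k (leqnn k)).
have Ld : Lq_control q (fun t => u_ j t - u_ k t).
  rewrite (_ : (fun t => _) = (fun t => 1 * u_ j t + -1 * u_ k t)).
    exact: Lq_control_lin.
  by apply/funext => t; rewrite mul1r mulN1r.
exact: (IR_norm_le_Lq Ld (eta0 k) T0 H).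
Qed.

Lemma minimizer_exists x0 m : value_function q F x0 = m%:E ->
  exists u, Lq_control q u /\ cost q F x0 u = m%:E.
Proof.
move=> Vm; have [u_ [Lu uc uD]] := minimizing_sequence Vm.
have Lu' k := Lq_control_loc q1 (Lu k).
have ui k := Lq_loc_locint q1 (Lu' k).
have mu_ k := (Lu' k).1.
have cae : {ae mu, forall t, 0 <= t -> cvgn (fun k => u_ k t)}.
  by apply: fast_cauchy_cvg_ae => // k T T0; exact: (uD k.+1 k T (leqnSn k) T0).
pose u := esup_limit u_.
have mu' : measurable_fun halfline u by exact: measurable_esup_limit.
have ucv : {ae mu, forall t, 0 <= t -> u_ k t @[k --> \oo] --> u t}.
  apply: (@filterS _ _ (ae_filter_ringOfSetsType mu) _ _ _ cae) => t H t0.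
  exact: cvg_esup_limit (H t0).
have sub T : (`[0, T]%classic : set R) `<=` `[0, +oo[%classic.
  by move=> t /=; rewrite !in_itv/= => /andP[->].
have diffm k : measurable_fun halfline (fun t => `|u t - u_ k t|).
  by apply: measurableT_comp => //; exact: measurable_funB.
(* The Cauchy estimate passes to the limit in its larger index by Fatou's lemma, the other index
   being fixed. *)
have diff_le k T : 0 <= T ->
    (\int[mu]_(t in `[0%R, T]) (`|u t - u_ k t|)%:E <= (2^-1 ^+ k * (T + 1))%:E)%E.
  move=> T0.
  have mI : measurable (`[0, T]%classic : set (measurableTypeR R)) by exact: measurable_itv.
  apply: (@fatou_ae _ _ (fun j t => `|u_ (j + k)%N t - u_ k t|)) => //.
  - move=> j; apply: (@measurable_funS _ _ _ _ halfline) => //.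
    by apply: measurableT_comp => //; exact: measurable_funB.
  - exact: (@measurable_funS _ _ _ _ halfline).
  - apply: (@filterS _ _ (ae_filter_ringOfSetsType mu) _ _ _ ucv) => t H /sub; rewrite /= in_itv/= andbT => /H c.
    apply: cvg_norm; apply: cvgB; last exact: cvg_cst.
    by move: c; rewrite -(cvg_shiftn k).
  - move=> j; rewrite fine_IR; last exact/locint_norm/locintB.
    by rewrite lee_fin; apply: uD => //; exact: leq_addl.
have diffi k : locint (fun t => u t - u_ k t).
  move=> T; apply/integrableP; split.
    apply/measurable_EFinP; apply: (@measurable_funS _ _ _ _ halfline) => //.
    exact: measurable_funB.
  have [T0|T0] := leP 0 T; last first.
    by rewrite set_itv_ge ?integral_set0 ?ltry// bnd_simp -ltNge.
  exact: le_lt_trans (diff_le k T T0) (ltry _).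
have uloc : locint u.
  by apply: eq_locint (locintD (diffi 0%N) (ui 0%N)) => t _; rewrite subrK.
have IRdiff k T : 0 <= T -> IR (fun t => `|u_ k t - u t|) T <= 2^-1 ^+ k * (T + 1).
  move=> T0; have := diff_le k T T0; rewrite fine_IR ?lee_fin; last exact: locint_norm.
  by apply: le_trans; rewrite le_eqVlt; apply/orP; left; apply/eqP/eq_IR => t _ _; rewrite distrC.
have eta_cvg : (2^-1 : R) ^+ k @[k --> \oo] --> (0 : R).
  by apply: cvg_expr; rewrite ger0_norm ?invr_ge0// invf_lt1// ltr1n.
have xcv t : 0 <= t -> trajectory x0 (u_ k) t @[k --> \oo] --> trajectory x0 u t.
  move=> t0; apply/cvgrPdist_le => e e0.
  have bound k : `|trajectory x0 u t - trajectory x0 (u_ k) t| <=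
      (1 + t) ^+ n * (2^-1 ^+ k * (t + 1)).
    rewrite distrC; apply: (le_trans (is_trajectory_dist (ui k) uloc
      (trajectoryP x0 (ui k)) (trajectoryP x0 uloc) t0 (lexx t))).
    apply: ler_wpM2l; first by rewrite exprn_ge0//; lra.
    exact: IRdiff.
  have c : (1 + t) ^+ n * (2^-1 ^+ k * (t + 1)) @[k --> \oo] --> (0 : R).
    rewrite -[X in _ --> X](mulr0 ((1 + t) ^+ n)); apply: cvgM; first exact: cvg_cst.
    rewrite -[X in _ --> X](mul0r (t + 1)); apply: cvgM => //; exact: cvg_cst.
  move/cvgrPdist_le : c => /(_ _ e0); apply: filterS => k; rewrite sub0r normrN => H.
  apply: le_trans (bound k) (le_trans (ler_norm _) H).
have Fxi z : locint z -> locint (fun s => F (trajectory x0 z s)) by exact: locint_F_traj.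
have mrc z : measurable_fun halfline z -> locint z ->
    measurable_fun halfline (running_cost q F x0 z).
  move=> mz zi; apply: measurable_funD; last by apply: locint_measurable; exact: Fxi.
  by apply: measurable_funM => //; exact: measurable_powR_norm.
(* Lower semicontinuity of the cost, by Fatou's lemma along the sequence started at [K], all of
   whose costs are at most $m+2^{-K}$. *)
have cost_le K : (cost q F x0 u <= (m + 2^-1 ^+ K)%:E)%E.
  have mI : measurable halfline by exact: measurable_itv.
  apply: (@fatou_ae _ _ (fun j t => running_cost q F x0 (u_ (j + K)%N) t)) => //.
  - by move=> j; exact: mrc.
  - exact: mrc.
  - by move=> k t _; exact: running_cost_ge0.
  - apply: (@filterS _ _ (ae_filter_ringOfSetsType mu) _ _ _ ucv) => t H; rewrite /= in_itv/= andbT => t0.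
    have c1 := H t0; have c2 := xcv t t0.
    have c3 : F (trajectory x0 (u_ k) t) @[k --> \oo] --> F (trajectory x0 u t).
      by apply: (cvg_comp _ _ c2); exact: Fc.
    have c4 : `|u_ k t| `^ q @[k --> \oo] --> `|u t| `^ q.
      exact: (@cvg_comp _ _ _ (fun k => u_ k t) (fun a : R => `|a| `^ q) _ _ _ c1
        (@continuous_powR_norm R q q0 (u t))).
    rewrite (cvg_shiftn K (fun j => running_cost q F x0 (u_ j) t) _).
    by apply: cvgD; [apply: cvgM; [exact: c4|exact: cvg_cst]|exact: c3].
  - by move=> j; apply: uc; exact: leq_addl.
have cost_m : (cost q F x0 u <= m%:E)%E.
  apply/lee_addgt0Pr => e e0.
  move/cvgrPdist_le : eta_cvg => /(_ _ e0) [K _ /(_ K (leqnn K))].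
  rewrite /= sub0r normrN => H; apply: le_trans (cost_le K) _.
  by rewrite -EFinD lee_fin lerD2l (le_trans (ler_norm _) H).
(* So far [u] is only locally integrable; the finite cost puts it in $L^q$, since $|u|^q$ is at most
   $q$ times the running cost. *)
have LU : Lq_control q u.
  apply/(Lq_control_lty q1); split => //.
  apply: (@le_lt_trans _ _ (q%:E * cost q F x0 u)%E); last first.
    apply: (@le_lt_trans _ _ (q%:E * m%:E)%E); last by rewrite -EFinM ltry.
    by apply: lee_wpmul2l => //; rewrite lee_fin ltW.
  rewrite /cost -ge0_integralZl_EFin ?(ltW q0)//; first last.
  - by apply/measurable_EFinP; exact: mrc.
  - by move=> t _; rewrite lee_fin running_cost_ge0.
  apply: (@le_Ih _ (fun t => `|u t| `^ q) (fun t => q * running_cost q F x0 u t)).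
  - exact: measurable_powR_norm.
  - by apply: measurable_funM => //; exact: mrc.
  - by move=> t _; exact: powR_ge0.
  - move=> t _; rewrite /running_cost mulrDr mulrC divfK ?gt_eqF// lerDl.
    by rewrite mulr_ge0// ltW.
exists u; split => //; apply/eqP; rewrite eq_le cost_m/= -Vm.
exact: value_le_cost.
Qed.

(** Two minimizers are near-minimal for every tolerance, so the integral of $|u-v|^q$ is below every
    $d>0$. *)
Lemma minimizer_unique x0 m u v : value_function q F x0 = m%:E ->
  Lq_control q u -> Lq_control q v ->
  cost q F x0 u = m%:E -> cost q F x0 v = m%:E ->
  {ae mu, forall t, 0 <= t -> v t = u t}.
Proof.
move=> Vm Lu Lv cu cv.
have [mu' _] := Lq_control_loc q1 Lu; have [mv _] := Lq_control_loc q1 Lv.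
have mI : measurable halfline by exact: measurable_itv.
have md : measurable_fun halfline (fun t => `|u t - v t| `^ q).
  by apply: (measurable_powR_norm q); exact: measurable_funB.
have I0 : (Ih (fun t => `|u t - v t| `^ q)%R <= 0)%E.
  apply/lee_addgt0Pr => d d0; rewrite add0e.
  have [e e0 He] := near_minimal_close q1 Fc F0 cF Vm d0.
  by apply: He => //; rewrite ?cu ?cv lee_fin lerDl ltW.
have /(ae_eq_integral_abs mu mI) : (\int[mu]_(t in halfline) `|(`|u t - v t| `^ q)%:E| = 0)%E.
  apply/eqP; rewrite eq_le; apply/andP; split; last exact: integral_ge0.
  apply: le_trans I0; apply: ge0_le_integral => //.
  - by do 2 apply: measurableT_comp => //.
  - exact/measurable_EFinP.
  - by move=> t _; rewrite lee_fin ger0_norm// powR_ge0.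
move=> H; have {}H := H _; apply: filterS (H _).
  move=> t Ht t0; have := Ht; rewrite /= in_itv/= andbT => /(_ t0) [] /powR_eq0_eq0.
  by move=> /eqP; rewrite normr_eq0 subr_eq0 => /eqP ->.
exact/measurable_EFinP.
Qed.

End MinimizerExistence.

(** * Differentiability of the value function *)

Section DifferentiableBound.
Context {R : realType} {U W : normedModType R}.

Lemma differentiable_bound (f : U -> W) (df : {linear U -> W}) (x : U) :
  continuous df ->
  (forall e, 0 < e -> exists2 d, 0 < d & forall h, `|h| <= d ->
     `|f (x + h) - f x - df h| <= e * `|h|) ->
  differentiable f x /\ 'd f x = df :> (U -> W).
Proof.
move=> dfc H.
have E : f \o shift x = cst (f x) + df +o_ 0 id.
  apply/eqaddoP => e e0; have [d d0 Hd] := H e e0.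
  apply/nbhs_normP; exists d => // h hd0. have hd : `|h| < d by move: hd0 => /=; rewrite sub0r normrN.
  have := Hd h (ltW hd); rewrite [x + h]addrC /=.
  by rewrite !fctE /= opprD addrA.
have dE : 'd f x = df :> (U -> W) by exact: diff_unique.
by split => //; apply/diff_locallyP; rewrite dE.
Qed.

End DifferentiableBound.

Section ConvexDifferentiability.
Context {R : realType} {n : nat}.
Implicit Types (x h p : 'cV[R]_n).

Definition dot_cV p h : R := \sum_i p i 0 * h i 0.

Lemma dot_cVZ p (a : R) h : dot_cV p (a *: h) = a * dot_cV p h.
Proof.
by rewrite /dot_cV mulr_sumr; apply: eq_bigr => i _; rewrite mxE mulrCA.
Qed.

Lemma dot_cVN p h : dot_cV p (- h) = - dot_cV p h.
Proof. by rewrite -scaleN1r dot_cVZ mulN1r. Qed.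

Let dot_cV_linear p : linear (dot_cV p : 'cV[R]_n -> R^o).
Proof.
move=> a x y; rewrite -[a *: dot_cV p x]/(a * dot_cV p x) -dot_cVZ /dot_cV -big_split.
by apply: eq_bigr => i _; rewrite mxE mulrDr.
Qed.

HB.instance Definition _ p :=
  GRing.isLinear.Build R 'cV[R]_n R^o *:%R (dot_cV p) (dot_cV_linear p).

Lemma continuous_dot_cV p : continuous (dot_cV p).
Proof.
apply: continuous_sum => i; apply: continuous_mul; first exact: continuous_cst.
exact: coord_continuous.
Qed.

Lemma dot_cV_delta p i : dot_cV p (delta_mx i 0) = p i 0.
Proof.
rewrite /dot_cV (bigD1 i)//= big1 => [|j ji]; first by rewrite mxE !eqxx mulr1 addr0.
by rewrite mxE (negbTE ji) mulr0.
Qed.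

Lemma differentiable_dot_cV (V : 'cV[R]_n -> R) x p :
  (forall e, 0 < e -> exists2 d, 0 < d & forall h, `|h| <= d ->
     `|V (x + h) - V x - dot_cV p h| <= e * `|h|) ->
  differentiable V x /\ gradient V x = p.
Proof.
move=> H.
have [d0 dE] := @differentiable_bound R 'cV[R]_n R^o V (dot_cV p) x
  (@continuous_dot_cV p) H.
split => //; apply/matrixP => i j; rewrite mxE ord1 deriveE// dE.
exact: dot_cV_delta.
Qed.

Variable V : 'cV[R]_n -> R.
Hypothesis convV : forall (l : R) x y, 0 <= l -> l <= 1 ->
  V (l *: x + (1 - l) *: y) <= l * V x + (1 - l) * V y.
Hypothesis upperV : forall x, exists p, forall e, 0 < e ->
  exists2 d, 0 < d & forall h, `|h| <= d ->
     V (x + h) - V x - dot_cV p h <= e * `|h|.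

(** Convexity gives $V(x+h)+V(x-h)\ge2V(x)$, so the upper bound at $-h$ is a lower bound at $h$ with
    the same linear part. *)
Let diffV x : exists p, forall e, 0 < e ->
  exists2 d, 0 < d & forall h, `|h| <= d ->
     `|V (x + h) - V x - dot_cV p h| <= e * `|h|.
Proof.
have [p Hp] := upperV x; exists p => e e0; have [d d0 Hd] := Hp e e0.
exists d => // h hd; rewrite ler_norml Hd// andbT.
have hdN : `|- h| <= d by rewrite normrN.
have := Hd _ hdN; rewrite normrN dot_cVN.
have half0 : 0 <= 2^-1 :> R by rewrite invr_ge0.
have half1 : 2^-1 <= 1 :> R by lra.
have := convV (x + h) (x - h) half0 half1.
have -> : 2^-1 *: (x + h) + (1 - 2^-1) *: (x - h) = x.
  have -> : 1 - 2^-1 = 2^-1 :> R by field.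
  have E : 2^-1 + 2^-1 = 1 :> R by field.
  by rewrite -scalerDr addrACA subrr addr0 scalerDr -scalerDl E scale1r.
move: (V (x + h)) (V (x - h)) (dot_cV p h) => a b c; lra.
Qed.

(** The slope $(V(x+sh)-V(x))/s$ is at most $V(x+h)-V(x)$ for $0<s\le1$, and is close to $\nabla
    V(x)\cdot h$ for small [s]. *)
Lemma convex_subgradient x h : V x + dot_cV (gradient V x) h <= V (x + h).
Proof.
have [p Hp] := diffV x; have [_ ->] := differentiable_dot_cV Hp.
apply/ler_addgt0Pr => e e0.
have h1 : 0 < `|h| + 1 by rewrite ltr_wpDl.
have e1 : 0 < e / (`|h| + 1) by rewrite divr_gt0.
have [d d0 Hd] := Hp _ e1.
pose s := Num.min 1 (d / (`|h| + 1)).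
have s0 : 0 < s by rewrite lt_min ltr01 divr_gt0.
have s1 : s <= 1 by rewrite ge_min lexx.
have sd : s * (`|h| + 1) <= d by rewrite -ler_pdivlMr// ge_min lexx orbT.
have shd : `|s *: h| <= d.
  rewrite normrZ gtr0_norm// (le_trans _ sd)// ler_wpM2l ?(ltW s0)//; lra.
have := Hd _ shd; rewrite ler_norml => /andP[+ _].
rewrite dot_cVZ normrZ (gtr0_norm s0).
have := convV (x + h) x (ltW s0) s1.
have -> : s *: (x + h) + (1 - s) *: x = x + s *: h.
  by rewrite scalerDr addrAC -scalerDl [s + _]addrC subrK scale1r.
have : e / (`|h| + 1) * `|h| <= e.
  by rewrite mulrAC ler_pdivrMr// ler_wpM2l ?(ltW e0)//; lra.
move: (V (x + s *: h)) (V (x + h)) (V x) (dot_cV p h) (e / (`|h| + 1)) => a b c k f H1 H2 H3.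
have : s * (c + k) <= s * (b + f * `|h|) by lra.
rewrite ler_pM2l//; lra.
Qed.

(** With $k=d\,e_i$, the subgradient inequality at [y] encloses $d\,\partial_iV(y)$ between
    $V(y)-V(y-k)$ and $V(y+k)-V(y)$. By continuity of $V$ these differences are close to those at
    [x], themselves close to $d\,\partial_iV(x)$. The errors add up to $ed/2+2\cdot ed/8<ed$. *)
Lemma convex_upper_differentiable_C1 : C1 V.
Proof.
have dV x : differentiable V x.
  by have [p Hp] := diffV x; have [] := differentiable_dot_cV Hp.
have Vc : continuous V by move=> x; exact: differentiable_continuous.
split => //; apply: continuous_cV => i x.
apply/(@cvgrPdist_le _ _ _ (nbhs x) (nbhs_filter x) (fun y => gradient V y i 0)) => e e0.
have [p Hp] := diffV x; have [_ gE] := differentiable_dot_cV Hp.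
have e4 : 0 < e / 2 by rewrite divr_gt0.
have [d d0 Hd] := Hp _ e4.
pose k : 'cV[R]_n := d *: delta_mx i 0.
have kd : `|k| <= d.
  rewrite normrZ gtr0_norm// ler_piMr ?(ltW d0)//.
  by apply: cV_norm_le => // j; rewrite mxE; case: (_ && _); rewrite ?normr1 ?normr0.
have dotk y : dot_cV (gradient V y) k = d * gradient V y i 0.
  by rewrite dot_cVZ dot_cV_delta.
have H1 := Hd k kd.
have kdN : `|- k| <= d by rewrite normrN.
have H2 := Hd (- k) kdN.
have ed : 0 < e * d / 8 by rewrite divr_gt0// mulr_gt0.
have near_shift c : \forall y \near x, `|V (x + c) - V (y + c)| <= e * d / 8.
  have /cvgrPdist_le/(_ _ ed)/nbhs_normP[r r0 Hr] := Vc (x + c).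
  apply/nbhs_normP; exists r => // y yr; apply: Hr => /=.
  by rewrite opprD addrACA subrr addr0; exact: yr.
have n0 := near_shift 0; have n1 := near_shift k; have n2 := near_shift (- k).
near=> y.
have Y0 : `|V (x + 0) - V (y + 0)| <= e * d / 8 by near: y.
have Y1 : `|V (x + k) - V (y + k)| <= e * d / 8 by near: y.
have Y2 : `|V (x - k) - V (y - k)| <= e * d / 8 by near: y.
rewrite !addr0 in Y0.
have S1 := convex_subgradient y k; have S2 := convex_subgradient y (- k).
rewrite dot_cVN dotk in S2; rewrite dotk in S1.
rewrite -gE in H1 H2; rewrite dot_cVN dotk normrN in H2; rewrite dotk in H1.
have ek : e / 2 * `|k| <= e / 2 * d by rewrite ler_wpM2l// ltW.
rewrite -(ler_pM2l d0) -{1}(gtr0_norm d0) -normrM mulrBr.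
move: Y0 Y1 Y2 H1 H2; rewrite !ler_norml.
move=> /andP[? ?] /andP[? ?] /andP[? ?] /andP[? ?] /andP[? ?].
apply/andP; split; lra.
Unshelve. all: by end_near. Qed.

End ConvexDifferentiability.

(** * Steering to the origin in unit time *)

Section Steering.
Context {R : realType}.

Lemma continuous_horner (p : {poly R}) : continuous (horner p).
Proof.
move=> x; apply: differentiable_continuous; apply/derivable1_diffP.
exact: derivable_horner.
Qed.

Lemma horner_FTC (p : {poly R}) t : 0 <= t ->
  p.[t] = p.[0] + IR (fun s => p^`().[s]) t.
Proof.
rewrite le_eqVlt => /predU1P[<-|t0]; first by rewrite IR0 addr0.
have cp := @continuous_horner p; have cp' := @continuous_horner p^`().
have H := @continuous_FTC2 R (horner p^`()) (horner p) 0 t t0.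
rewrite /Rintegral {}H /= ?subrKC//.
- exact: continuous_subspaceT.
- split => [x _||]; first exact: derivable_horner.
    by apply: cvg_at_right_filter; exact: cp.
  by apply: cvg_at_left_filter; exact: cp.
- by move=> x _; rewrite derivE.
Qed.

(** The first coordinate is a flat output: the others are its derivatives and the control is the
    $n$-th one, so steering becomes Hermite interpolation. *)
Lemma polynomial_trajectory n (p : {poly R}) :
  is_trajectory (\col_(k < n) p^`(k).[0]) (fun t => p^`(n).[t])
    (fun t => \col_(k < n) p^`(k).[t]).
Proof.
apply/is_trajectoryP; split.
  apply: cont0_continuous; apply: continuous_cV => i.
  rewrite (_ : (fun t => _) = horner p^`(i)); first exact: continuous_horner.
  by apply/funext => t; rewrite mxE.
move=> t t0 i; rewrite !mxE (horner_FTC _ t0); congr (_ + _).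
apply: eq_IR => s _ _; rewrite -derivnS.
have := ltn_ord i; rewrite leq_eqVlt => /orP[/eqP iE|i1].
  by rewrite iE chain_coord_last.
by rewrite chain_coord_lt mxE.
Qed.

Lemma derivn_XsubC_exp (c : R) n k (p : {poly R}) : (k < n)%N ->
  ((('X - c%:P) ^+ n * p)^`(k)).[c] = 0.
Proof.
move=> kn; have [r ->] : exists r,
    (('X - c%:P) ^+ n * p)^`(k) = ('X - c%:P) ^+ (n - k) * r.
  elim: k kn => [|k IH] kn; first by exists p; rewrite subn0.
  have [r Er] := IH (ltnW kn).
  exists (r *+ (n - k.+1).+1 + ('X - c%:P) * r^`()).
  rewrite derivnS Er derivM deriv_exp derivXsubC mul1r -(subnSK (ltnW kn)) /=.
  by rewrite mulrDr mulrnAl mulrnAr exprSr mulrA.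
by rewrite hornerM horner_exp !hornerE subrr expr0n subn_eq0 leqNgt kn mul0r.
Qed.

(** Hermite interpolation at $0$ and $1$ by a Bezout identity $a(X-1)^n+bX^n=1$: the polynomial
    $(X-1)^nay$ vanishes to order $n$ at $1$ and is congruent to $y=X^i/i!$ modulo $X^n$. *)
Lemma steering_polynomial n (i : 'I_n) : exists p : {poly R},
  (forall k, (k < n)%N -> p^`(k).[0] = (k == i)%:R) /\
  (forall k, (k < n)%N -> p^`(k).[1] = 0).
Proof.
have cop : coprimep (('X - (1 : R)%:P) ^+ n) (('X - (0 : R)%:P) ^+ n).
  apply: coprimep_expl; apply: coprimep_expr.
  by rewrite coprimep_XsubC2// subr0 oner_neq0.
have /Bezout_eq1_coprimepP[[a b] /= ab] := cop.
pose y : {poly R} := (i`!%:R)^-1 *: 'X^i.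
exists (('X - 1%:P) ^+ n * (a * y)); split => k kn; last exact: derivn_XsubC_exp.
have -> : ('X - 1%:P) ^+ n * (a * y) = y - ('X - 0%:P) ^+ n * (b * y).
  by apply/eqP; rewrite eq_sym subr_eq -{1}[y]mul1r -ab; apply/eqP; ring.
rewrite derivnB hornerD hornerN derivn_XsubC_exp// subr0 /y derivnZ hornerZ.
rewrite derivnXn hornerMn hornerXn.
have [->|ki] := eqVneq k i.
  rewrite subnn expr0 ffactnn mulVf// pnatr_eq0 -lt0n; exact: fact_gt0.
have [ik|ik] := ltnP k i.
  by rewrite expr0n subn_eq0 leqNgt ik mul0rn mulr0.
by rewrite ffact_small ?mulr0n ?mulr0// ltn_neqAle eq_sym ki.
Qed.

Lemma steering_controls n : exists v : 'I_n -> R -> R,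
  (forall i, continuous (v i)) /\
  forall i, trajectory (delta_mx i 0) (v i) 1 = 0.
Proof.
have /choice[p Hp] := @steering_polynomial n.
exists (fun i => horner (p i)^`(n)); split => i; first exact: continuous_horner.
have [p0 p1] := Hp i.
have vi : locint (horner (p i)^`(n)).
  exact/locint_cont0/cont0_continuous/continuous_horner.
have := polynomial_trajectory n (p i).
have -> : \col_(k < n) (p i)^`(k).[0] = delta_mx i 0.
  by apply/matrixP => k j; rewrite !mxE p0// ord1 eqxx andbT.
move=> /(trajectory_unique vi) ->; last exact: ler01.
by apply/matrixP => k j; rewrite !mxE p1.
Qed.

End Steering.

Section SteeringFamily.
Context {R : realType} {n : nat}.

Lemma trajectory_sum m (c : 'I_m -> R) (x : 'I_m -> 'cV[R]_n) (u : 'I_m -> R -> R) t :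
  (forall i, locint (u i)) -> 0 <= t ->
  trajectory (\sum_i c i *: x i) (fun s => \sum_i c i * u i s) t =
  \sum_i c i *: trajectory (x i) (u i) t.
Proof.
move=> ui t0; elim: m c x u ui => [|m IH] c x u ui.
  rewrite !big_ord0 (_ : (fun s => _) = (fun s => 0 * (fun=> 0) s + 0 * (fun=> 0) s)).
    rewrite -{1}[0 : 'cV[R]_n](addr0 0) -{1}[0 : 'cV[R]_n](scale0r 0).
    rewrite -{2}[0 : 'cV[R]_n](scale0r 0).
    by rewrite trajectory_lin ?scale0r ?addr0//; exact: locint_cst.
  by apply/funext => s; rewrite big_ord0 mul0r addr0.
rewrite !big_ord_recl -[X in _ *: x ord0 + X]scale1r.
rewrite (_ : (fun s => _) = (fun s => c ord0 * u ord0 s +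
    1 * \sum_(i < m) c (lift ord0 i) * u (lift ord0 i) s)); last first.
  by apply/funext => s; rewrite big_ord_recl mul1r.
have ri : locint (fun s => \sum_(i < m) c (lift ord0 i) * u (lift ord0 i) s).
  by apply: locint_sum => i; exact: locintZ.
rewrite (trajectory_lin _ _ _ _ (ui ord0) ri t0) scale1r; congr (_ + _).
by apply: IH.
Qed.

Lemma cV_sum_delta (h : 'cV[R]_n) : \sum_i h i 0 *: delta_mx i 0 = h.
Proof.
by rewrite [RHS]matrix_sum_delta; apply: eq_bigr => i _; rewrite big_ord1.
Qed.

Lemma cont0_bounded (W : normedModType R) (f : R -> W) T : cont0 f ->
  exists2 b, 0 <= b & forall t, 0 <= t -> t <= T -> `|f t| <= b.
Proof.
move=> fc.
have cK : compact ((fun s : R => f (Num.max s 0)) @` `[0, T]).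
  by apply: continuous_compact; [exact: continuous_subspaceT|exact: segment_compact].
have [M [_ MP]] := compact_bounded cK.
exists (Num.max 0 (M + 1)); first by rewrite le_max lexx.
move=> t t0 tT; apply: MP.
  by rewrite lt_max; apply/orP; right; rewrite ltrDl.
by exists t; rewrite /= ?in_itv/= ?t0// max_l.
Qed.

Lemma steering_family : exists (v : 'I_n -> R -> R) (C : R),
  [/\ 0 < C, forall i, continuous (v i),
    forall (h : 'cV[R]_n) t, 0 <= t -> t <= 1 -> `|\sum_i h i 0 * v i t| <= C * `|h|,
    forall (h : 'cV[R]_n) t, 0 <= t -> t <= 1 ->
      `|trajectory h (fun s => \sum_i h i 0 * v i s) t| <= C * `|h| &
    forall h : 'cV[R]_n, trajectory h (fun s => \sum_i h i 0 * v i s) 1 = 0].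
Proof.
have [v [vc v1]] := @steering_controls R n.
have vi i : locint (v i) by exact/locint_cont0/cont0_continuous/vc.
have /choice[b Hb] i : exists b, 0 <= b /\ forall t, 0 <= t -> t <= 1 -> `|v i t| <= b.
  by have [b b0 Hb] := cont0_bounded 1 (cont0_continuous (vc i)); exists b.
have /choice[b' Hb'] i : exists b, 0 <= b /\ forall t, 0 <= t -> t <= 1 ->
    `|trajectory (delta_mx i 0 : 'cV[R]_n) (v i) t| <= b.
  have [b0 b00 Hb0] := cont0_bounded 1 (cont0_trajectory (x0 := delta_mx i 0) (vi i)).
  by exists b0.
have b0 i : 0 <= b i by have [] := Hb i.
have b'0 i : 0 <= b' i by have [] := Hb' i.
(* One constant for controls and trajectories; the leading $1$ makes it positive in every
   dimension. *)
pose C := 1 + \sum_i (b i + b' i).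
have bC (d : 'I_n -> R) (h : 'cV[R]_n) : (forall i, 0 <= d i <= b i + b' i) ->
    \sum_i `|h i 0| * d i <= C * `|h|.
  move=> Hd; apply: (@le_trans _ _ (\sum_i `|h| * (b i + b' i))).
    apply: ler_sum => i _; have /andP[d0 db] := Hd i.
    by rewrite ler_pM// cV_coord_le.
  by rewrite -mulr_sumr mulrC ler_wpM2r// /C lerDr.
have tE (h : 'cV[R]_n) t : 0 <= t -> trajectory h (fun s => \sum_i h i 0 * v i s) t =
    \sum_i h i 0 *: trajectory (delta_mx i 0) (v i) t.
  by move=> t0; rewrite -(trajectory_sum _ _ vi t0) cV_sum_delta.
exists v, C; split.
- by rewrite ltr_pwDl// sumr_ge0// => i _; rewrite addr_ge0.
- exact: vc.
- move=> h t t0 t1; apply: le_trans (bC b h _); last first.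
    by move=> i; rewrite b0/= lerDl.
  apply: le_trans (ler_norm_sum _ _ _) _; apply: ler_sum => i _.
  by rewrite normrM ler_wpM2l// (proj2 (Hb i)).
- move=> h t t0 t1; rewrite tE//; apply: le_trans (bC b' h _); last first.
    by move=> i; rewrite b'0/= lerDr.
  apply: le_trans (ler_norm_sum _ _ _) _; apply: ler_sum => i _.
  by rewrite normrZ ler_wpM2l// (proj2 (Hb' i)).
- by move=> h; rewrite tE// big1// => i _; rewrite v1 scaler0.
Qed.

End SteeringFamily.

(** * Finiteness, dynamic programming and convexity of the value *)

Section ValueFunction.
Context {R : realType} {n : nat}.
Variables (q : R) (q1 : 1 < q) (F : 'cV[R]_n -> R).
Hypotheses (cF : C1 F) (convF : convex_on_space F) (Fpd : positive_definite F).
Notation halfline := (`[0, +oo[%classic : set (measurableTypeR R)).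
Implicit Types (u v : R -> R) (T : R).

Let q0 : 0 < q. Proof. by rewrite (lt_trans ltr01). Qed.
Let F0 x : 0 <= F x. Proof. exact: positive_definite_ge0. Qed.
Let Fc : continuous F. Proof. exact: C1_continuous. Qed.
Let cvxF := convex_on_spaceP convF.

Lemma cost_zero : cost q F 0 (fun=> 0) = 0%E.
Proof.
have i0 : locint (fun _ : R => 0 : R) by exact: locint_cst.
have t0 t : 0 <= t -> trajectory (0 : 'cV[R]_n) (fun=> 0) t = 0.
  move=> t0; have := trajectory_lin 0 0 (0 : 'cV[R]_n) 0 i0 i0 t0.
  rewrite !scale0r !addr0 (_ : (fun _ => _ + _) = (fun=> 0))//.
  by apply/funext => s; rewrite !mul0r addr0.
rewrite /cost integral0_eq// => t; rewrite /= in_itv/= andbT => /t0 ->.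
by rewrite normr0 powR0 ?gt_eqF// mul0r add0r (proj1 Fpd).
Qed.

(** Steering to the origin in unit time and then applying the zero control has finite cost. *)
Lemma value_fin_num x0 : value_function q F x0 \is a fin_num.
Proof.
have [v [C [C0 vc _ _ v1]]] := @steering_family R n.
have uc : cont0 (fun s => \sum_i x0 i 0 * v i s).
  apply: cont0_continuous; apply: continuous_sum => i; apply: continuous_mul => //.
  exact: continuous_cst.
have Lu := cont0_Lq_loc q1 uc.
have := value_reach q1 Fc F0 (reach_initial F x0 Lu ler01).
rewrite v1 => H; rewrite ge0_fin_numE; last first.
  by apply/ereal_infP => _ [u _ <-]; exact: cost_ge0.
apply: le_lt_trans H _; apply: lte_add_pinfty; first exact: ltry.
apply: (@le_lt_trans _ _ 0%E); last exact: ltry.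
rewrite -cost_zero; apply: value_le_cost.
apply/(Lq_control_lty q1); split; first exact: measurable_cst.
by rewrite integral0_eq ?ltry// => t _; rewrite normr0 powR0// gt_eqF.
Qed.

Definition real_value (x : 'cV[R]_n) : R := fine (value_function q F x).

Lemma real_valueE x : value_function q F x = (real_value x)%:E.
Proof. by rewrite /real_value fineK// value_fin_num. Qed.

Lemma real_value_ge0 x : 0 <= real_value x.
Proof.
by rewrite -lee_fin -real_valueE; apply/ereal_infP => _ [u _ <-]; exact: cost_ge0.
Qed.

Lemma optimal_exists x : exists u, Lq_control q u /\ cost q F x u = (real_value x)%:E.
Proof. exact: (minimizer_exists q1 Fc F0 cvxF (real_valueE x)). Qed.

Lemma real_value_reach T x0 c x1 : reach q F T x0 c x1 ->
  real_value x0 <= c + real_value x1.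
Proof.
by move=> /(value_reach q1 Fc F0); rewrite !real_valueE -EFinD lee_fin.
Qed.

(** The other half of dynamic programming: the tail of [u] is admissible from the point reached at
    time [T], so it costs at least the value there. *)
Lemma optimal_dynamic x0 u T : Lq_control q u -> 0 <= T ->
  cost q F x0 u = (real_value x0)%:E ->
  IR (running_cost q F x0 u) T + real_value (trajectory x0 u T) <= real_value x0.
Proof.
move=> Lu T0 uc; rewrite -lee_fin -uc (cost_split q1 Fc F0 x0 (Lq_control_loc q1 Lu) T0).
rewrite EFinD leeD2l// -real_valueE; apply: value_le_cost.
exact: Lq_control_shift.
Qed.

Lemma powR_norm_convex (l a b : R) : 0 <= l -> l <= 1 ->
  `|l * a + (1 - l) * b| `^ q / q <= l * (`|a| `^ q / q) + (1 - l) * (`|b| `^ q / q).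
Proof.
move=> l0 l1; set c := l * a + (1 - l) * b.
have Ha := ler_wpM2l l0 (powR_tangent_le c a q1).
have l1' : 0 <= 1 - l by lra.
have Hb := ler_wpM2l l1' (powR_tangent_le c b q1).
apply: le_trans (lerD Ha Hb).
rewrite le_eqVlt; apply/orP; left; apply/eqP.
by move: (_ / q) (signed_pow _ _) => s r; rewrite /c; ring.
Qed.

Lemma real_value_convex (l : R) (x y : 'cV[R]_n) : 0 <= l -> l <= 1 ->
  real_value (l *: x + (1 - l) *: y) <= l * real_value x + (1 - l) * real_value y.
Proof.
move=> l0 l1; have l1' : 0 <= 1 - l by rewrite subr_ge0.
have [u [Lu uc]] := optimal_exists x; have [v [Lv vc]] := optimal_exists y.
have Lu' := Lq_control_loc q1 Lu; have Lv' := Lq_control_loc q1 Lv.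
have ui := Lq_loc_locint q1 Lu'; have vi := Lq_loc_locint q1 Lv'.
have Lw := Lq_control_lin q1 l (1 - l) Lu Lv.
rewrite -lee_fin -real_valueE; apply: (le_trans (value_le_cost _ _ Lw)).
have mr z x1 : Lq_loc q z -> measurable_fun halfline (running_cost q F x1 z).
  by move=> Lz; apply: locint_measurable; exact: locint_running_cost.
have rc0 z x1 t : 0 <= t -> 0 <= running_cost q F x1 z t.
  by move=> _; exact: running_cost_ge0.
have -> : ((l * real_value x + (1 - l) * real_value y)%:E =
    l%:E * cost q F x u + (1 - l)%:E * cost q F y v)%E by rewrite uc vc.
have E := Ih_lin l0 l1' (mr _ x Lu') (mr _ y Lv') (rc0 u x) (rc0 v y).
rewrite /cost -[X in (_ <= X)%E]E; apply: le_Ih.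
- exact: mr (Lq_control_loc q1 Lw).
- by apply: measurable_fun_lin; exact: mr.
- exact: rc0.
move=> t t0; apply: (le_trans (running_cost_convex q cvxF x y ui vi l0 l1 t0)).
have := powR_norm_convex (u t) (v t) l0 l1; rewrite /running_cost.
move: (F (trajectory x u t)) (F (trajectory y v t)) => a b.
move: (`|_| `^ q / q) (`|u t| `^ q / q) (`|v t| `^ q / q) => c d e; lra.
Qed.

End ValueFunction.

Section ValueDifferentiability.
Context {R : realType} {n : nat}.
Variables (q : R) (q1 : 1 < q) (F : 'cV[R]_n -> R).
Hypotheses (cF : C1 F) (convF : convex_on_space F) (Fpd : positive_definite F).
Notation V := (real_value q F).
Implicit Types (u v : R -> R) (T : R).

Let q0 : 0 < q. Proof. by rewrite (lt_trans ltr01). Qed.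
Let F0 x : 0 <= F x. Proof. exact: positive_definite_ge0. Qed.
Let Fc : continuous F. Proof. exact: C1_continuous. Qed.

Lemma trajectory_steering (v : 'I_n -> R -> R) (h : 'cV[R]_n) t :
  (forall i, locint (v i)) -> 0 <= t ->
  trajectory h (fun s => \sum_i h i 0 * v i s) t =
  \sum_i h i 0 *: trajectory (delta_mx i 0) (v i) t.
Proof. by move=> vi t0; rewrite -(trajectory_sum _ _ vi t0) cV_sum_delta. Qed.

Lemma locint_signed_pow u : Lq_loc q u -> locint (fun t => signed_pow (u t) (q - 1)).
Proof.
move=> [mu' iu]; have r0 : 0 < q - 1 by rewrite subr_gt0.
apply: (@locint_le _ _ (fun t => 1 + `|u t| `^ q)).
- apply: (@measurableT_comp _ _ _ _ _ _ (fun a : R => signed_pow a (q - 1))) => //.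
  apply: continuous_measurable_fun; exact: continuous_signed_pow.
- move=> t _; rewrite norm_signed_pow//.
  have [u1|u1] := leP `|u t| 1.
    rewrite (@le_trans _ _ 1)// ?lerDl ?powR_ge0//.
    apply: (@le_trans _ _ (1 `^ (q - 1))); last by rewrite powR1.
    by apply: ge0_ler_powR; rewrite ?nnegrE ?(ltW r0)// ler01.
  apply: (@le_trans _ _ (`|u t| `^ q)); last by rewrite lerDr.
  by apply: ler_powR; [exact: ltW|rewrite gerBl].
- by apply: locintD => //; exact: locint_cst.
Qed.

(** The tangent at $a+b$, evaluated at $a$, bounds the increment by $b\lfloor a+b\rceil^{q-1}$; the
    hypothesis allows the slope to be taken at [a] instead. *)
Lemma powR_norm_expansion (a b e k : R) : 0 <= e -> `|b| <= k ->
  `|signed_pow (a + b) (q - 1) - signed_pow a (q - 1)| <= e * (1 + `|a| `^ q) ->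
  `|a + b| `^ q / q - `|a| `^ q / q - b * signed_pow a (q - 1) <=
    e * (1 + `|a| `^ q) * k.
Proof.
move=> e0 bk H; have := powR_tangent_le (a + b) a q1.
have -> : a - (a + b) = - b by ring.
move=> T; apply: (@le_trans _ _ ((signed_pow (a + b) (q - 1) - signed_pow a (q - 1)) * b)).
  by move: T; move: (_ / q) (_ / q) (signed_pow _ _) (signed_pow _ _) => x y z w; lra.
rewrite (le_trans (ler_norm _))// normrM ler_pM//.
Qed.

(** The vector [p] is the first variation of the cost over $[0,1]$: $p_i=\int_0^1(v_i\lfloor
    u\rceil^{q-1}+\nabla F(x)\cdot y_i)$, where $y_i$ is the trajectory steering $e_i$ to $0$ with
    control $v_i$. *)
Lemma real_value_upper_diff x0 : exists p, forall e, 0 < e ->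
  exists2 d, 0 < d & forall h, `|h| <= d ->
     V (x0 + h) - V x0 - dot_cV p h <= e * `|h|.
Proof.
have [v [C [C0 vc svC yhC yh1]]] := @steering_family R n.
have vi i : locint (v i) by exact/locint_cont0/cont0_continuous/vc.
have [u [Lu uopt]] := optimal_exists q1 cF convF Fpd x0.
have Lu' := Lq_control_loc q1 Lu; have ui := Lq_loc_locint q1 Lu'.
pose x := trajectory x0 u.
have xc : cont0 x by exact: cont0_trajectory.
pose y i := trajectory (delta_mx i 0 : 'cV[R]_n) (v i).
have yc i : cont0 (y i) by exact: cont0_trajectory.
pose sg t := signed_pow (u t) (q - 1).
have sgi : locint sg by exact: locint_signed_pow.
pose l i s := v i s * sg s + \sum_j gradient F (x s) j 0 * y i s j 0.
have li i : locint (l i).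
  apply: locintD; first by apply: locintM => //; exact/cont0_continuous/vc.
  apply: locint_sum => j; apply: locintM.
    exact: (cont0_comp xc (C1_gradient_coord (i := j) cF)).
  by apply: locint_cont0; exact: (cont0_coord (i := j) (yc i)).
exists (\col_i IR (l i) 1) => e e0.
pose I := IR (fun t => `|u t| `^ q) 1.
have I0 : 0 <= I by apply: IR_ge0 => t _ _; exact: powR_ge0.
(* The control part of the remainder integrates to $C|h|(1+I)$ and the part of $F$, with $n$
   coordinates each at most $C|h|$, to $C|h|n$, both times $e/K$; the total is $e|h|$. *)
pose K := C * (1 + n%:R + I).
have K0 : 0 < K by rewrite mulr_gt0// -addrA ltr_pwDl// addr_ge0.
have e1 : 0 < e / K by rewrite divr_gt0.
have [d1 d10 Hd1] := signed_pow_unif_continuous q1 e1.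
have [M M0 xM] := cont0_bounded 1 xc.
have [d2 d20 Hd2] := C1_unif_diff M cF e1.
(* Both the added control and the added trajectory are bounded by $C|h|$ on $[0,1]$. *)
exists (Num.min d1 d2 / C); first by rewrite divr_gt0// lt_min d10.
move=> h; rewrite ler_pdivlMr// mulrC le_min => /andP[hd1 hd2].
pose sv s := \sum_i h i 0 * v i s.
have svc : cont0 sv.
  apply: cont0_continuous; apply: continuous_sum => i.
  by apply: continuous_mul; [exact: continuous_cst|exact: vc].
have Lsv := cont0_Lq_loc q1 svc; have svi := Lq_loc_locint q1 Lsv.
pose w s := 1 * u s + 1 * sv s.
have Lw : Lq_loc q w by exact: Lq_loc_lin.
have wE t : 0 <= t -> trajectory (x0 + h) w t = x t + trajectory h sv t.
  move=> t0; have := trajectory_lin 1 1 x0 h ui svi t0.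
  by rewrite !(scale1r x0) (scale1r h) (scale1r (x t)) (scale1r (trajectory h sv t)).
have dotE : dot_cV (\col_i IR (l i) 1) h = IR (fun s => sv s * sg s +
    \sum_j gradient F (x s) j 0 * trajectory h sv s j 0) 1.
  rewrite /dot_cV; transitivity (\sum_i IR (fun s => h i 0 * l i s) 1).
    by apply: eq_bigr => i _; rewrite mxE IRZ// mulrC.
  rewrite -IR_sum; last by move=> i; exact: locintZ.
  apply: eq_IR => s s0 _; rewrite /l; under eq_bigr do rewrite mulrDr mulrA.
  rewrite big_split/= -mulr_suml; congr (_ + _).
  under eq_bigr do rewrite mulr_sumr.
  rewrite exchange_big/=; apply: eq_bigr => j _.
  rewrite /sv (trajectory_steering _ vi s0) summxE mulr_sumr; apply: eq_bigr => i _.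
  by rewrite [X in _ = _ * X]mxE mulrCA.
have H1 : V (x0 + h) <= IR (running_cost q F (x0 + h) w) 1 + V (x 1).
  have := real_value_reach q1 cF Fpd (reach_initial F (x0 + h) Lw ler01).
  by rewrite (wE 1 ler01) (yh1 h) addr0.
have H2 := optimal_dynamic q1 cF Fpd Lu ler01 uopt.
have rwi := locint_running_cost q1 Fc (x0 + h) Lw.
have rui := locint_running_cost q1 Fc x0 Lu'.
have lini : locint (fun s => sv s * sg s +
    \sum_j gradient F (x s) j 0 * trajectory h sv s j 0).
  apply: locintD; first exact: locintM.
  apply: locint_sum => j; apply: locintM.
    exact: (cont0_comp xc (C1_gradient_coord (i := j) cF)).
  apply: locint_cont0; exact: (cont0_coord (i := j) (cont0_trajectory (x0 := h) svi)).
suff H3 : IR (running_cost q F (x0 + h) w) 1 - IR (running_cost q F x0 u) 1 -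
    dot_cV (\col_i IR (l i) 1) h <= e * `|h|.
  move: H1 H2 H3; rewrite -/x; move: (dot_cV _ _) (V (x 1)) (V x0) (V (x0 + h)) => a b c d.
  by move: (IR _ 1) (IR _ 1) => f g; lra.
rewrite dotE -!IRB//; last exact: locintB.
have -> : e * `|h| = IR (fun s => e / K * (C * `|h|) * (1 + n%:R + `|u s| `^ q)) 1.
  have [_ iu] := Lu'.
  rewrite IRZ; last by apply: locintD => //; exact: locint_cst.
  rewrite IRD//; last exact: locint_cst.
  rewrite IR_cst// mulr1 -/I -[X in X = _](mulfVK (lt0r_neq0 K0)) /K; ring.
have [_ iu] := Lu'.
apply: le_IR.
- by apply: locintB => //; exact: locintB.
- by apply: locintZ; apply: locintD => //; exact: locint_cst.
move=> s s0 s1; rewrite /running_cost (wE s s0) /w !mul1r.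
have svs := svC h s s0 s1.
have ys := yhC h s s0 s1; rewrite -/sv in ys.
have P1 := powR_norm_expansion (ltW e1) svs (Hd1 (u s) (sv s) (le_trans svs hd1)).
have P2 : F (x s + trajectory h sv s) - F (x s) -
    \sum_j gradient F (x s) j 0 * trajectory h sv s j 0 <= e / K * (n%:R * (C * `|h|)).
  have := Hd2 (x s) (x s + trajectory h sv s) (xM s s0 s1).
  rewrite opprD addNKr normrN => /(_ (le_trans ys hd2)).
  rewrite [x s + _ - x s]addrC addKr => /(le_trans (ler_norm _)) /le_trans; apply.
  apply: ler_wpM2l; first exact: ltW.
  apply: (@le_trans _ _ (\sum_(j < n) C * `|h|)).
    by apply: ler_sum => j _; rewrite (le_trans (cV_coord_le _ _)).
  by rewrite sumr_const card_ord mulr_natl.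
rewrite -/x -/(sg s) in P1 P2 *.
set a := trajectory h sv s in P2 *.
have -> : e / K * (C * `|h|) * (1 + n%:R + `|u s| `^ q) =
  e / K * (1 + `|u s| `^ q) * (C * `|h|) + e / K * (n%:R * (C * `|h|)) by ring.
apply: le_trans (lerD P1 P2).
rewrite le_eqVlt; apply/orP; left; apply/eqP.
move: (\sum_j gradient F (x s) j 0 * a j 0) (F (x s + a)) (F (x s)) => f1 f2 f3.
move: (sv s * sg s) (`|u s + sv s| `^ q / q) (`|u s| `^ q / q) => f4 f5 f6.
ring.
Qed.

Lemma real_value_C1 : C1 V.
Proof.
apply: convex_upper_differentiable_C1; last exact: real_value_upper_diff.
by move=> l x y; exact: real_value_convex.
Qed.

End ValueDifferentiability.

(** Reads an inequality at time $0$ off integral inequalities: if $G(0)<0$, then $G\le G(0)/2$ on a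
    short interval, where the integral would be negative. *)
Lemma IR_ge0_at0 (R : realType) (G : R -> R) : cont0 G ->
  (forall h, 0 <= h -> 0 <= IR G h) -> 0 <= G 0.
Proof.
move=> Gc H; rewrite leNgt; apply/negP => G0.
have e0 : 0 < - (G 0 / 2) by rewrite oppr_gt0 pmulr_llt0// invr_gt0.
have := Gc 0; rewrite /continuous_at maxxx => /cvgrPdist_lt /(_ _ e0).
move=> /nbhs_normP[d /= d0 Hd].
have d20 : 0 < d / 2 by rewrite divr_gt0.
have B s : 0 <= s -> s <= d / 2 -> G s <= G 0 / 2.
  move=> s0 sd; have /Hd : ball_ Num.norm 0 d s.
    rewrite /= sub0r normrN ger0_norm// (le_lt_trans sd)// gtr_pMr//; lra.
  by rewrite /= max_l// distrC => /(le_lt_trans (ler_norm _)) /ltW; lra.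
have := H _ (ltW d20); have := le_IR (locint_cont0 Gc) (locint_cst (G 0 / 2)) B.
rewrite IR_cst ?(ltW d20)// => L /le_trans/(_ L); apply/negP; rewrite -ltNge.
by rewrite pmulr_llt0// pmulr_llt0// invr_gt0.
Qed.

(** * The Hamilton-Jacobi-Bellman equation *)

Section HamiltonJacobiBellman.
Context {R : realType} {n : nat}.
Variables (q : R) (q1 : 1 < q) (F : 'cV[R]_n -> R).
Hypotheses (cF : C1 F) (convF : convex_on_space F) (Fpd : positive_definite F).
Notation mu := (@lebesgue_measure R).
Notation V := (real_value q F).
Implicit Types (u v : R -> R) (T : R).

Let q0 : 0 < q. Proof. by rewrite (lt_trans ltr01). Qed.
Let F0 x : 0 <= F x. Proof. exact: positive_definite_ge0. Qed.
Let Fc : continuous F. Proof. exact: C1_continuous. Qed.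
Let cV : C1 V. Proof. exact: real_value_C1. Qed.

Lemma real_value_posdef : positive_definite V.
Proof.
split=> [|x0 x00].
  apply/eqP; rewrite eq_le (real_value_ge0 q1 cF Fpd 0) andbT.
  rewrite -lee_fin -(real_valueE q1 cF Fpd 0).
  apply: (@le_trans _ _ (cost q F 0 (fun=> 0))); last by rewrite (cost_zero q1 Fpd).
  apply: value_le_cost; apply/(Lq_control_lty q1); split; first exact: measurable_cst.
  by rewrite integral0_eq ?ltry// => t _; rewrite normr0 powR0// gt_eqF.
rewrite lt_neqAle (real_value_ge0 q1 cF Fpd x0) andbT eq_sym.
(* If the value at [x0] is zero, the optimal trajectory has zero running cost on every $[0,h]$, so
   the continuous function $-F(x(s))$ has nonnegative integrals and $F(x_0)\le0$. *)
apply: contra_neq x00 => V0.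
have [u [Lu uopt]] := optimal_exists q1 cF convF Fpd x0.
have Lu' := Lq_control_loc q1 Lu; have ui := Lq_loc_locint q1 Lu'.
have xc := cont0_trajectory (x0 := x0) ui.
pose G s := 0 - F (trajectory x0 u s).
have Fxc : cont0 (fun s => F (trajectory x0 u s)) by exact: (cont0_comp xc Fc).
have : 0 <= G 0.
  apply: IR_ge0_at0 => [|h h0].
    have NFc : continuous (fun y => 0 - F y).
      by apply: continuous_sub; [exact: continuous_cst|exact: Fc].
    exact: (cont0_comp xc NFc).
  have D := optimal_dynamic q1 cF Fpd Lu h0 uopt; rewrite V0 in D.
  have E : IR G h = - IR (fun s => F (trajectory x0 u s)) h.
    rewrite -mulN1r -IRZ; last exact: locint_cont0.
    by apply: eq_IR => s _ _; rewrite mulN1r /G sub0r.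
  have L : IR (fun s => F (trajectory x0 u s)) h <= IR (running_cost q F x0 u) h.
    apply: le_IR; [exact: locint_cont0|exact: locint_running_cost|move=> s _ _].
    by rewrite /running_cost lerDr divr_ge0 ?powR_ge0// ltW.
  rewrite E oppr_ge0 (le_trans L)//; apply: le_trans D; rewrite lerDl.
  exact: real_value_ge0.
rewrite /G (trajectory0 x0 ui) sub0r oppr_ge0 => Fx; apply/eqP.
by apply: contraTT Fx => /(proj2 Fpd); rewrite -ltNge.
Qed.

Lemma real_value_subsolution (x0 : 'cV[R]_n) (a : R) :
  0 <= `|a| `^ q / q + F x0 + (drift_part V x0 + partial_last V x0 * a).
Proof.
have ac : cont0 (fun _ : R => a) by apply: cont0_continuous => t; exact: cvg_cst.
have La := cont0_Lq_loc q1 ac; have ai := Lq_loc_locint q1 La.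
have xc := cont0_trajectory (x0 := x0) ai.
pose g x := `|a| `^ q / q + F x + (drift_part V x + partial_last V x * a).
have gc : continuous g.
  apply: continuous_add.
    by apply: continuous_add; [exact: continuous_cst|exact: Fc].
  apply: continuous_add; first exact: C1_drift_part.
  by apply: continuous_mul; [exact: C1_partial_last|exact: continuous_cst].
pose G s := g (trajectory x0 (fun=> a) s).
have Gc : cont0 G by exact: (cont0_comp xc gc).
suff : 0 <= G 0 by rewrite /G (trajectory0 x0 ai).
apply: (IR_ge0_at0 Gc) => h h0.
have D := real_value_reach q1 cF Fpd (reach_initial F x0 La h0).
have E := chain_rule cV ai (trajectoryP x0 ai) h0.
have S : IR G h = IR (running_cost q F x0 (fun=> a)) h +
    IR (fun s => drift_part V (trajectory x0 (fun=> a) s) +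
      partial_last V (trajectory x0 (fun=> a) s) * a) h.
  rewrite -IRD; first exact: eq_IR.
    exact: locint_running_cost.
  exact: (locint_chain_integrand cV x0 ai).
by rewrite S; move: D; rewrite E addrCA lerDl.
Qed.

(** Along the optimal control, dynamic programming bounds an integral that still contains [u].
    Young's inequality replaces the terms in [u] by their minimum, which depends on the state only
    and is therefore continuous at time $0$. *)
Lemma real_value_supersolution (x0 : 'cV[R]_n) :
  drift_part V x0 - (q - 1) / q * `|partial_last V x0| `^ (q / (q - 1)) + F x0 <= 0.
Proof.
have [u [Lu uopt]] := optimal_exists q1 cF convF Fpd x0.
have Lu' := Lq_control_loc q1 Lu; have ui := Lq_loc_locint q1 Lu'.
have xc := cont0_trajectory (x0 := x0) ui.
pose g x := (q - 1) / q * `|partial_last V x| `^ (q / (q - 1)) - drift_part V x - F x.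
have gc : continuous g.
  apply: continuous_sub => //; apply: continuous_sub; last exact: C1_drift_part.
  apply: continuous_mul; first exact: continuous_cst.
  move=> x; apply: (@continuous_comp _ _ _ (partial_last V) (fun b : R => `|b| `^ (q / (q - 1)))).
    exact: C1_partial_last.
  by apply: continuous_powR_norm; rewrite divr_gt0// subr_gt0.
pose G s := g (trajectory x0 u s).
have Gc : cont0 G by exact: (cont0_comp xc gc).
suff : 0 <= G 0.
  by rewrite /G (trajectory0 x0 ui) /g; move: (drift_part V x0) (F x0) (_ / q * _) => *; lra.
apply: (IR_ge0_at0 Gc) => h h0.
have D := optimal_dynamic q1 cF Fpd Lu h0 uopt.
have E := chain_rule cV ui (trajectoryP x0 ui) h0.
pose K s := - (running_cost q F x0 u s + (drift_part V (trajectory x0 u s) +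
      partial_last V (trajectory x0 u s) * u s)).
have Ki := locint_running_cost q1 Fc x0 Lu'.
have Ci := locint_chain_integrand cV x0 ui.
have S : IR K h = - (IR (running_cost q F x0 u) h +
    IR (fun s => drift_part V (trajectory x0 u s) +
      partial_last V (trajectory x0 u s) * u s) h).
  rewrite -IRD// -mulN1r -IRZ; last exact: locintD.
  by apply: eq_IR => s _ _; rewrite mulN1r.
have KG : IR K h <= IR G h.
  apply: le_IR; last first.
  - clear D E S Ki Ci; move=> s _ _; rewrite /K /G /g /running_cost.
    have := young_gap_ge0 (u s) (partial_last V (trajectory x0 u s)) q1.
    rewrite /young_gap; move: (trajectory x0 u s) => y.
    move: (`|u s| `^ q / q) (F y) (drift_part V y) (partial_last V y * u s) => b c d e.
    by move: ((q - 1) / q * `|partial_last V y| `^ (q / (q - 1))) => f; lra.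
  - exact: locint_cont0.
  - apply: eq_locint (locintZ (-1) (locintD Ki Ci)) => s /=.
    by rewrite mulN1r.
by apply: le_trans KG; rewrite S oppr_ge0; move: D; rewrite E addrCA gerDl.
Qed.

Lemma real_value_HJB : HJB_solution q F V.
Proof.
move=> x; apply/eqP; rewrite eq_le; apply/andP; split.
  exact: real_value_supersolution.
(* The constant control minimizing the Hamiltonian at [x] gives the converse inequality. *)
have := real_value_subsolution x (hamilton_argmin q (partial_last V x)).
have := hamilton_min (partial_last V x) q1; rewrite -/(drift_part V x).
move: (drift_part V x) (F x) (`|hamilton_argmin _ _| `^ q / q) => b c d.
by move: (partial_last V x * _) ((q - 1) / q * _) => e f; lra.
Qed.

Lemma HJB_uniqueness (W : 'cV[R]_n -> R) :
  C1 W -> positive_definite W -> HJB_solution q F W -> W = V.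
Proof.
move=> cW Wpd hjbW; apply/funext => x; apply/eqP; rewrite eq_le; apply/andP; split.
  rewrite -lee_fin -(real_valueE q1 cF Fpd x).
  by apply/ereal_infP => _ [u Lu <-]; exact: (hjb_le_cost q1 Fc convF Fpd cW Wpd hjbW).
rewrite -lee_fin -(real_valueE q1 cF Fpd x).
apply: (value_le_hjb q1 Fc convF Fpd cW Wpd hjbW) => e e0.
(* The smallness of the value near the origin, required for the upper bound by [W], is the
   continuity of the value at $0$. *)
have [d d0 Hd] := V_small cV real_value_posdef e0.
by exists d => // y yd; rewrite (real_valueE q1 cF Fpd y) lee_fin; exact: Hd.
Qed.

Lemma minimizerP (x0 : 'cV[R]_n) u : minimizer q F x0 u <->
  Lq_control q u /\ cost q F x0 u = (V x0)%:E.
Proof.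
split=> [[Lu H]|[Lu H]].
  split=> //; have [v [Lv vc]] := optimal_exists q1 cF convF Fpd x0.
  apply/eqP; rewrite eq_le -{1}vc (H v Lv)/= -(real_valueE q1 cF Fpd x0).
  exact: value_le_cost.
split; first exact: Lu.
by move=> v Lv; rewrite H -(real_valueE q1 cF Fpd x0); exact: (value_le_cost F x0 Lv).
Qed.

Lemma optimal_control_exists (x0 : 'cV[R]_n) : exists u, optimal_control q F x0 u.
Proof.
have [u [Lu uc]] := optimal_exists q1 cF convF Fpd x0.
exists u; split; first exact/minimizerP.
move=> v /minimizerP[Lv vc].
exact: (minimizer_unique q1 Fc F0 (convex_on_spaceP convF) (real_valueE q1 cF Fpd x0) Lu Lv uc vc).
Qed.

(** The verification identity for the value itself, compared with [optimal_dynamic], leaves a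
    nonpositive integral of the nonnegative gap on every $[0,T]$. *)
Lemma HJB_feedback : optimal_feedback q F
  (fun x => hamilton_argmin q (partial_last V x)).
Proof.
move=> x0; split; first exact: optimal_control_exists.
move=> u [/minimizerP[Lu uopt] _].
have Lu' := Lq_control_loc q1 Lu; have ui := Lq_loc_locint q1 Lu'.
pose gap s := young_gap q (u s) (partial_last V (trajectory x0 u s)).
have gi : locint gap by exact: (locint_young_gap q1 Fc cV real_value_HJB x0 Lu').
have gap0 s : 0 <= gap s by exact: young_gap_ge0.
have IR0 T : 0 <= T -> IR gap T = 0.
  move=> T0; apply/eqP; rewrite eq_le IR_ge0 ?andbT//.
  have := optimal_dynamic q1 cF Fpd Lu T0 uopt.
  rewrite (hjb_identity q1 Fc cV real_value_HJB x0 Lu' T0) -/gap.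
  by rewrite addrAC subrK gerDl.
(* The exceptional null set depends on the interval; countably many intervals cover the
   half-line. *)
pose I (N : nat) : set (measurableTypeR R) := `[0, N%:R]%classic.
have mI N : measurable (I N) by exact: measurable_itv.
have gN N : {ae mu, forall t, I N t -> (gap t)%:E = 0%E}.
  have mg : measurable_fun (I N) (EFin \o gap) by exact: (measurable_int mu (gi N%:R)).
  have /(ae_eq_integral_abs mu (mI N) mg) : (\int[mu]_(t in I N) `|(gap t)%:E| = 0)%E.
    transitivity (\int[mu]_(t in I N) (gap t)%:E)%E.
      by apply: eq_integral => s _; rewrite /= ger0_norm.
    by rewrite (fine_IR _ gi) IR0.
  exact.
apply: (@filterS _ _ (ae_filter_ringOfSetsType mu) _ _ _ (ae_foralln gN)) => t H t0.
have IN : I (Num.trunc t).+1 t by rewrite /I/= in_itv/= t0/= ltW// truncnS_gt.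
have [G0] := H _ IN.
exact: (young_gap_eq0 q1 G0).
Qed.

End HamiltonJacobiBellman.

Theorem corollary5p3 (R : realType) (n : nat) (q : R)
    (hn : (1 <= n)%N) (hq : 1 < q) :
  (forall F : 'cV[R]_n -> R,
     C1 F -> convex_on_space F -> positive_definite F ->
     exists V : 'cV[R]_n -> R,
       [/\ forall x, value_function q F x = (V x)%:E,
           [/\ C1 V, positive_definite V & HJB_solution q F V]
         & forall V' : 'cV[R]_n -> R,
             C1 V' -> positive_definite V' -> HJB_solution q F V' ->
             V' = V])
  /\
  (forall W : 'cV[R]_n -> R,
     C1 W -> positive_definite W ->
     C1 (inverse_running_cost q W) ->
     convex_on_space (inverse_running_cost q W) ->
     positive_definite (inverse_running_cost q W) ->
     (forall x, value_function q (inverse_running_cost q W) x = (W x)%:E) /\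
     optimal_feedback q (inverse_running_cost q W)
       (fun x => - signed_pow (partial_last W x) (1 / (q - 1)))).
Proof.
split=> [F cF convF Fpd|W cW Wpd cF convF Fpd].
  exists (real_value q F); split; first exact: real_valueE.
    split; [exact: real_value_C1|exact: real_value_posdef|exact: real_value_HJB].
  by move=> V'; exact: HJB_uniqueness.
(* By definition of [inverse_running_cost], [W] solves the equation for this running cost;
   uniqueness identifies it with the value. *)
have WV : W = real_value q (inverse_running_cost q W).
  apply: (HJB_uniqueness hq cF convF Fpd cW Wpd) => x.
  by rewrite /inverse_running_cost addrA subrK subrr.
split=> [x|]; first by rewrite [in RHS]WV; exact: real_valueE.
have := HJB_feedback hq cF convF Fpd; rewrite -WV; exact.
Qed.
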